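(* Let $\pi:\mathcal X\to\Delta^k$ be an analytic family of compact complex manifolds over the unit polydisc $\Delta^k\subset\mathbb C^k$ with fibres $X_t=\pi^{-1}(t)$, $X=X_0$, and Beltrami differentials $\phi(t)$. Let $E$ be a holomorphic tensor bundle on $X$ and $E_t$ the corresponding holomorphic tensor bundle on $X_t$. Let $\bar\partial$ and $\bar\partial_t$ be the Dolbeault operators on $X$ and $X_t$ respectively, and let $\rho:A^{0,\bullet}(X,E)\to A^{0,\bullet}(X_t,E_t)$ be the extension operator. Then $$\rho^{-1}\bar\partial_t\rho=\bar\partial-\langle\phi(t)|\qquad\text{on }A^{0,\bullet}(X,E).$$ In particular, for $\sigma\in A^{0,q}(X,E)$, the form $\rho\sigma\in A^{0,q}(X_t,E_t)$ is $\bar\partial_t$-closed if and only if $$\bar\partial\sigma-\langle\phi(t)|\sigma\rangle=0.$$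
   Context: An analytic family of compact complex manifolds is a proper surjective holomorphic submersion between complex manifolds. A holomorphic tensor bundle is a holomorphic vector bundle formed by tensor products or exterior products from $T_X^{1,0}$ and its dual $\Omega_X$. $A^{0,q}(X,E)$ is the space of smooth $E$-valued $(0,q)$-forms. **Beltrami differential.** A smooth trivialization $X\times\Delta^k\cong\mathcal X$ is fixed, so $X_t$ and $X$ are identified as smooth manifolds; $t$ is taken sufficiently small. With $z^1,\dots,z^n$ and $w^1,\dots,w^n$ local holomorphic coordinates on $X$ and $X_t$ (all regarded as functions on $X$), $\phi(t)=\phi^\alpha_\beta\,d\bar z^\beta\otimes\frac{\partial}{\partial z^\alpha}$ with $\phi^\alpha_\beta=\big((\partial w/\partial z)^{-1}\big)_{\alpha i}\frac{\partial w^i}{\partial\bar z^\beta}$; this is a global element of $A^{0,1}(X,T_X^{1,0})$. **Extension operator.** For $\varphi=\xi\otimes v$ with $\xi$ a $(0,k)$-form and $v$ a $(1,0)$-vector field, $i_\varphi\beta=\xi\wedge(v\lrcorner\beta)$ (extended linearly). $\rho:A^{0,q}(X,E)\to A^{0,q}(X_t,E_t)$ is the $C^\infty$-linear isomorphism compatible with tensor and wedge products such that $\rho f=f$ for functions, $\rho(d\bar z^\alpha)=\frac{\partial\bar z^\alpha}{\partial\bar w^i}d\bar w^i$, $\rho\big(\frac{\partial}{\partial z^\alpha}\big)=\frac{\partial w^i}{\partial z^\alpha}\frac{\partial}{\partial w^i}$, and $\rho=e^{i_{\phi(t)}}=\sum_{m\ge0}i_{\phi(t)}^m/m!$ on sections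 of $\Omega_X^p$ (so $\rho(dz^\alpha)=dz^\alpha+i_{\phi(t)}dz^\alpha$). **Pairing.** $\mathcal L^{1,0}_\varphi=i_\varphi\partial-(-1)^{k-1}\partial i_\varphi$ on forms, for $\varphi\in A^{0,k}(X,T_X^{1,0})$. $[\cdot,\cdot]$ is the Frölicher–Nijenhuis bracket: for $\varphi=\varphi^\alpha\otimes\partial_\alpha$ of degree $k$ and $\psi=\psi^\beta\otimes\partial_\beta$ of degree $l$, $[\varphi,\psi]=\big(\varphi^\alpha\wedge\partial_\alpha\psi^\beta-(-1)^{kl}\psi^\alpha\wedge\partial_\alpha\varphi^\beta\big)\otimes\partial_\beta$, where $\partial_\alpha=\partial/\partial z^\alpha$. The operator $\langle\varphi|:A^{0,\bullet}(X,E)\to A^{0,\bullet+k}(X,E)$ equals $[\varphi,\cdot]$ on $A^{0,\bullet}(X,T_X^{1,0})$, equals $\mathcal L_\varphi^{1,0}$ on $A^{0,\bullet}(X)$ and on $A^{0,\bullet}(X,\Omega_X)$ (identify $\beta\otimes s$ with $\beta\wedge s$), and is extended by Leibniz's rule: $\langle\varphi|(\beta\otimes e_1\otimes\cdots\otimes e_m)=\mathcal L^{1,0}_\varphi\beta\otimes e_1\otimes\cdots\otimes e_m+(-1)^{kq}\sum_i\beta\wedge(e_1\otimes\cdots\otimes\langle\varphi|e_i\otimes\cdots\otimes e_m)$ for a $(0,q)$-form $\beta$ (form parts moved to the front), similarly for exterior products. Write $\langle\varphi|\sigma\rangle:=\langle\varphi|\sigma$. *)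

(* Defs.v *)
From HB Require Import structures.
From mathcomp Require Import all_boot all_order all_algebra all_fingroup.
From mathcomp Require Import all_classical all_reals all_analysis.
From mathcomp Require Import complex.

Set Implicit Arguments.
Unset Strict Implicit.
Unset Printing Implicit Defensive.

Import Order.TTheory GRing.Theory Num.Theory.
Import numFieldNormedType.Exports.

Local Open Scope classical_set_scope.
Local Open Scope ring_scope.

(* The complex numbers over R, typed so that the canonical topology of a
   numFieldType (and hence the product topology on 'rV[C R]_n) is found. *)
Definition C (R : realType) : numClosedFieldType := R[i].

Section Calculus.
Context {R : realType} {n : nat}.
Implicit Types (f : 'rV[C R]_n -> C R) (u v : 'rV[C R]_n) (U : set 'rV[C R]_n).

Definition re_line f u v (s : R) : R := complex.Re (f (u + (s%:C)%C *: v)).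
Definition im_line f u v (s : R) : R := complex.Im (f (u + (s%:C)%C *: v)).

Definition rderivable f u v : Prop :=
  derivable (re_line f u v) 0 1 /\ derivable (im_line f u v) 0 1.

Definition rderive v f u : C R :=
  (derive1 (re_line f u v) 0 +i* derive1 (im_line f u v) 0)%C.

(* With u_j = x_j + i y_j: the direction of x_j (b = false) or y_j (b = true).*)
Definition axis (j : 'I_n) (b : bool) : 'rV[C R]_n :=
  (if b then 'i else 1) *: delta_mx 0 j.

(* All iterated partial derivatives of order m in x_1, y_1, ..., x_n, y_n exist
   and are continuous on the open set U. *)
Fixpoint continuous_partials m U f : Prop :=
  if m is m'.+1 then
    forall j b, (forall u, U u -> rderivable f u (axis j b)) /\
                continuous_partials m' U (rderive (axis j b) f)
  else forall u, U u -> {for u, continuous f}.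

Definition smooth_on U f : Prop := forall m, continuous_partials m U f.

(* Wirtinger derivatives d/du^j and d/d(conj u^j). *)
Definition dz (j : 'I_n) f u : C R :=
  2^-1 * (rderive (axis j false) f u - 'i * rderive (axis j true) f u).
Definition dzb (j : 'I_n) f u : C R :=
  2^-1 * (rderive (axis j false) f u + 'i * rderive (axis j true) f u).

(* Holomorphy as smoothness plus the Cauchy-Riemann equations. *)
Definition holomorphic_on U f : Prop :=
  smooth_on U f /\ (forall u j, U u -> dzb j f u = 0).

End Calculus.

(* [coord] and [param] are mutually inverse homeomorphisms between [dom] and an
   open subset of C^n (see [is_chart]); they are irrelevant elsewhere. *)
Record chart (R : realType) (X : topologicalType) (n : nat) := Chart {
  dom : set X;
  coord : X -> 'rV[C R]_n;
  param : 'rV[C R]_n -> X }.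

HB.instance Definition _ R X n := gen_eqMixin (chart R X n).
HB.instance Definition _ R X n := gen_choiceMixin (chart R X n).

Section Charts.
Context {R : realType} {X : topologicalType} {n : nat}.
Implicit Types (c d : chart R X n) (f : X -> C R).

Definition chart_img c : set 'rV[C R]_n := coord c @` dom c.

Definition is_chart c : Prop :=
  [/\ open (dom c), open (chart_img c),
      forall x, dom c x -> {for x, continuous (coord c)},
      forall u, chart_img c u -> {for u, continuous (param c)} &
      forall x, dom c x -> param c (coord c x) = x].

Definition holo_transition c d : Prop :=
  forall i, holomorphic_on (coord c @` (dom c `&` dom d))
              (fun u => coord d (param c u) 0 i).

Definition holo_atlas (A : set (chart R X n)) : Prop :=
  [/\ forall c, A c -> is_chart c,
      forall c d, A c -> A d -> holo_transition c d &
      forall x, exists2 c, A c & dom c x].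

Definition zc c (i : 'I_n) : X -> C R := fun x => coord c x 0 i.
Definition zbc c (i : 'I_n) : X -> C R := fun x => (coord c x 0 i)^*.

(* d f / d z^j and d f / d (conj z^j), at x, in the coordinates z of c. *)
Definition pd c f (j : 'I_n) (x : X) : C R :=
  dz j (fun u => f (param c u)) (coord c x).
Definition pdb c f (j : 'I_n) (x : X) : C R :=
  dzb j (fun u => f (param c u)) (coord c x).

(* A chart of A around x; the default c0 is irrelevant when A covers X. *)
Definition chart_at (A : set (chart R X n)) (c0 : chart R X n) (x : X) :
    chart R X n :=
  xget c0 [set c | A c /\ dom c x].

End Charts.

Record complexManifold (R : realType) (n : nat) := ComplexManifold {
  points :> topologicalType;
  atlas : set (chart R points n);
  points_hausdorff : hausdorff_space points;
  points_second_countable : @second_countable points;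
  atlas_holo : holo_atlas atlas }.

Definition max_atlas (R : realType) n (M : complexManifold R n) :
    set (chart R M n) :=
  [set c | is_chart c /\
     (forall d, atlas d -> holo_transition c d /\ holo_transition d c)].

Definition polydisc (R : realType) k : set 'rV[C R]_k :=
  [set t | forall j, `|t 0 j| < 1].
Arguments polydisc R k : clear implicits.

Record analyticFamily (R : realType) (n k : nat) := AnalyticFamily {
  total :> complexManifold R (n + k);
  proj : total -> 'rV[C R]_k;
  proj_holo : forall W i, atlas W ->
    holomorphic_on (chart_img W) (fun u => proj (param W u) 0 i);
  proj_range : range proj = polydisc R k;
  proj_proper : forall K, K `<=` polydisc R k -> compact K ->
    compact (proj @^-1` K);
  proj_submersion : forall W x, atlas W -> dom W x ->
    \rank (\matrix_(i < k, j < n + k) pd W (fun y => proj y 0 i) j x) = k }.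

Section Fibres.
Context {R : realType} {n k : nat} (P : analyticFamily R n k).

Definition fibre (t : 'rV[C R]_k) : set P := [set p | proj p = t].

Definition central_fibre : topologicalType := set_type (fibre 0).

(* A chart W = (w, pi) of the total space whose last k coordinates are pi; then
   w restricts to local holomorphic coordinates on every fibre. *)
Definition adapted (W : chart R P (n + k)) : Prop :=
  max_atlas W /\ (forall p, dom W p -> rsubmx (coord W p) = proj p).

Section Identification.
(* For t in the polydisc, F(., t) : X -> X_t with inverse the restriction of G. *)
Variables (F : central_fibre -> 'rV[C R]_k -> P) (G : P -> central_fibre).

(* The coordinates w of W on X_t, as functions on X. *)
Definition fibre_chart (W : chart R P (n + k)) (t : 'rV[C R]_k) :
    chart R central_fibre n :=
  Chart [set x | dom W (F x t)]
        (fun x => lsubmx (coord W (F x t)))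
        (fun u => G (param W (row_mx u t))).

(* The complex structure of X_t, carried to X. *)
Definition fibre_atlas_of (t : 'rV[C R]_k) : set (chart R central_fibre n) :=
  [set c | exists2 W, adapted W & c = fibre_chart W t].

End Identification.

(* A diffeomorphism X * polydisc -> P over the polydisc which restricts to the
   inclusion of X = X_0 over 0. *)
Record trivialization := Trivialization {
  triv : central_fibre -> 'rV[C R]_k -> P;
  triv_inv : P -> central_fibre;
  triv0 : forall x, triv x 0 = set_val x;
  proj_triv : forall x t, polydisc R k t -> proj (triv x t) = t;
  trivK : forall x t, polydisc R k t -> triv_inv (triv x t) = x;
  triv_invK : forall p, triv (triv_inv p) (proj p) = p;
  triv_continuous : forall x t, polydisc R k t ->
    {for (x, t), continuous (fun a => triv a.1 a.2)};
  triv_inv_continuous : continuous triv_inv;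
  triv_smooth : forall c W i, fibre_atlas_of triv triv_inv 0 c -> atlas W ->
    smooth_on
      [set v : 'rV[C R]_(n + k) |
         [/\ chart_img c (lsubmx v), polydisc R k (rsubmx v) &
             dom W (triv (param c (lsubmx v)) (rsubmx v))]]
      (fun v => coord W (triv (param c (lsubmx v)) (rsubmx v)) 0 i);
  triv_inv_smooth : forall c W i, fibre_atlas_of triv triv_inv 0 c -> atlas W ->
    smooth_on [set v | chart_img W v /\ dom c (triv_inv (param W v))]
      (fun v => coord c (triv_inv (param W v)) 0 i) }.

Definition fibre_atlas (T : trivialization) (t : 'rV[C R]_k) :=
  fibre_atlas_of (triv T) (triv_inv T) t.

End Fibres.

(* [Ext 0 E] is the trivial line bundle. *)
Inductive tbundle :=
| Tan                               (* T^{1,0} *)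
| Cot                               (* Omega *)
| Tens of tbundle & tbundle
| Ext of nat & tbundle.             (* exterior power *)

(* Indices of the components of E in the frame built from d/dz^i and dz^i.
   Sections of Ext p E are encoded as alternating sections of the p-th tensor
   power, e_1 /\ ... /\ e_p being the sum over s of
   sgn(s) e_s(1) (x) ... (x) e_s(p); the constraint is [fibre_vector]. *)
Fixpoint idx (n : nat) (E : tbundle) : finType :=
  match E with
  | Tan | Cot => 'I_n
  | Tens E1 E2 => (idx n E1 * idx n E2)%type
  | Ext p E1 => {ffun 'I_p -> idx n E1}
  end.

(* Components of a form of degree q, relative to covectors indexed by I:
   alternating functions of q indices, b = 1/q! sum_J b(J) theta^J, so that
   (theta^1 /\ ... /\ theta^q)(1, ..., q) = 1. *)
Notation coform R I q := ({ffun 'I_q -> I} -> C R).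

Definition alternating (R : realType) (I : Type) q (b : coform R I q) : Prop :=
  forall (s : 'S_q) (J : {ffun 'I_q -> I}), b [ffun k => J (s k)] = (-1) ^+ s * b J.

Definition del (I : Type) q (i : 'I_q.+1) (J : {ffun 'I_q.+1 -> I}) :
    {ffun 'I_q -> I} := [ffun k => J (lift i k)].

Definition push (I : Type) q (a : I) (J : {ffun 'I_q -> I}) :
    {ffun 'I_q.+1 -> I} := [ffun k => oapp J a (unlift ord0 k)].

(* theta /\ b and b /\ theta, for a 1-form theta. *)
Definition wedgel (R : realType) (I : Type) q (theta : I -> C R)
    (b : coform R I q) : coform R I q.+1 :=
  fun J => \sum_(i < q.+1) (-1) ^+ i * (theta (J i) * b (del i J)).
Definition wedger (R : realType) (I : Type) q (b : coform R I q)
    (theta : I -> C R) : coform R I q.+1 :=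
  fun J => \sum_(i < q.+1) (-1) ^+ (q - i) * (b (del i J) * theta (J i)).

Fixpoint fibre_vector (R : realType) n E : (idx n E -> C R) -> Prop :=
  match E return (idx n E -> C R) -> Prop with
  | Tan | Cot => fun _ => True
  | Tens E1 E2 => fun v =>
      (forall b, fibre_vector (fun a => v (a, b))) /\
      (forall a, fibre_vector (fun b => v (a, b)))
  | Ext p E1 => fun v =>
      alternating v /\
      (forall (i : 'I_p) (K : {ffun 'I_p -> idx n E1}), fibre_vector
         (fun a => v [ffun j => if j == i then a else K j]))
  end.

(* The matrix on E induced by v^a |-> sum_b T_{ba} w^b on Tan and
   O_{ba} on Cot, multiplicatively in tensor and exterior products. *)
Fixpoint induced (R : realType) n (T O : 'M[C R]_n) E : idx n E -> idx n E -> C R :=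
  match E return idx n E -> idx n E -> C R with
  | Tan => fun b a => T b a
  | Cot => fun b a => O b a
  | Tens E1 E2 => fun b a =>
      @induced R n T O E1 b.1 a.1 * @induced R n T O E2 b.2 a.2
  | Ext p E1 => fun b a => \prod_(i < p) @induced R n T O E1 (b i) (a i)
  end.

Notation ecomps R n q E := ({ffun 'I_q -> 'I_n} -> idx n E -> C R).

(* Change of frame: d(conj z)^j |-> sum_i Q_{ij} d(conj w)^i on the form part,
   [induced T O E] on the bundle part. *)
Definition act (R : realType) n q E (Q T O : 'M[C R]_n)
    (v : ecomps R n q E) : ecomps R n q E :=
  fun I b => \sum_(J : {ffun 'I_q -> 'I_n}) \sum_(a : idx n E)
    (\prod_(i < q) Q (I i) (J i)) * @induced R n T O E b a * v J a.

(* An E-valued (0,q)-form is given by its components in all charts. *)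
Notation eform R X n q E := (chart R X n -> X -> ecomps R n q E).

Section Forms.
Context {R : realType} {X : topologicalType} {n : nat}.
Implicit Types (A B : set (chart R X n)) (c d z w : chart R X n).

(* Normalization: components vanish where they are meaningless, so that two
   forms are equal iff they have the same components in the charts of A. *)
Definition on_atlas A q E (s : eform R X n q E) : eform R X n q E :=
  fun c x J a => if `[< A c /\ dom c x >] then s c x J a else 0.

(* From the frame of c to that of d, both charts of one complex structure. *)
Definition transition c d (x : X) q E : ecomps R n q E -> ecomps R n q E :=
  act (\matrix_(i, j) pdb d (zbc c j) i x)
      (\matrix_(b, a) pd c (zc d b) a x)
      (\matrix_(b, a) pd d (zc c a) b x).

(* A^{0,q}(X, E), for the complex structure on X given by A. *)
Definition A0 A q E : set (eform R X n q E) :=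
  [set s |
    [/\ on_atlas A s = s,
        forall c J a, A c ->
          smooth_on (chart_img c) (fun u => s c (param c u) J a),
        forall c d x, A c -> A d -> dom c x -> dom d x ->
          s d x = transition c d x (s c x),
        forall c x a, alternating (fun J => s c x J a) &
        forall c x J, fibre_vector (s c x J)]].

Definition dolbeault A q E (s : eform R X n q E) : eform R X n q.+1 E :=
  on_atlas A (fun c x J a =>
    \sum_(i < q.+1) (-1) ^+ i * pdb c (fun y => s c y (del i J) a) (J i) x).

(* The Beltrami differential of the complex structure B relative to A:
   (dw/dz)^{-1} (dw/d(conj z)), z in A, w in B. *)
Definition beltrami A B : eform R X n 1 Tan :=
  on_atlas A (q := 1) (E := Tan) (fun z x J a =>
    let w := chart_at B z x in
    (invmx (\matrix_(i, b) pd z (zc w i) b x) *m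
       \matrix_(i, b) pdb z (zc w i) b x) a (J ord0)).

(* Forms of arbitrary type in a chart c: inl a stands for dz^a and inr a for
    d(conj z)^a. *)
Notation mform m := (X -> coform R ('I_n + 'I_n)%type m).

Definition del_mform c m (b : mform m) : mform m.+1 := fun x K =>
  \sum_(i < m.+1) (-1) ^+ i *
    (if K i is inl a then pd c (fun y => b y (del i K)) a x else 0).

(* v -| b = b(v, ...) and i_phi b = sum_a phi^a /\ (d/dz^a -| b), where
   phi = sum_a phi^a (x) d/dz^a is a T^{1,0}-valued (0,1)-form. *)
Definition iop c (phi : eform R X n 1 Tan) m : mform m -> mform m :=
  match m return mform m -> mform m with
  | 0 => fun _ _ _ => 0
  | m'.+1 => fun b x K => \sum_(a < n)
      wedgel (fun e => if e is inr g then phi c x [ffun=> g] a else 0)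
             (fun K' => b x (push (inl a) K')) K
  end.

(* L^{1,0}_phi = i_phi del - (-1)^(1 - 1) del i_phi. *)
Definition lie c phi m (b : mform m) : mform m.+1 :=
  fun x K => iop c phi (del_mform c b) x K - del_mform c (iop c phi b) x K.

Definition dz_mform (a : 'I_n) : mform 1 := fun _ K => (K ord0 == inl a)%:R.

(* A (0,q)-form as a form, and the (0,q)-components of a form. *)
Definition anti_mform q (b : X -> coform R 'I_n q) : mform q := fun x K =>
  \sum_(J : {ffun 'I_q -> 'I_n}) (K == [ffun k => inr (J k)])%:R * b x J.
Definition anti_part q (b : mform q) (x : X) : coform R 'I_n q :=
  fun J => b x [ffun k => inr (J k)].

(* [phi, psi] = (phi^a /\ d_a psi^b - (-1)^l psi^a /\ d_a phi^b) (x) d_b. *)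
Definition bracket c (phi : eform R X n 1 Tan) l
    (psi : X -> ecomps R n l Tan) : X -> ecomps R n l.+1 Tan :=
  fun x J b => \sum_(a < n)
    (wedgel (fun g => phi c x [ffun=> g] a)
            (fun J' => pd c (fun y => psi y J' b) a x) J
     - (-1) ^+ l *
       wedger (fun J' => psi x J' a)
              (fun g => pd c (fun y => phi c y [ffun=> g] b) a x) J).

(* <phi| e_a = sum_{g, b} [frame_pairing g b a] d(conj z)^g (x) e_b on the frame
   (e_a) of E. On Cot, d(conj z)^g (x) dz^b is identified with
   d(conj z)^g /\ dz^b, whose component at (inr g, inl b) is 1. *)
Fixpoint frame_pairing c (phi : eform R X n 1 Tan) E (x : X) (g : 'I_n) :
    idx n E -> idx n E -> C R :=
  match E return idx n E -> idx n E -> C R with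
  | Tan => fun b a =>
      bracket c phi (l := 0) (fun _ _ e => (e == a)%:R) x [ffun=> g] b
  | Cot => fun b a =>
      lie c phi (dz_mform a) x
        [ffun i : 'I_2 => if i == ord0 then inr g else inl b]
  | Tens E1 E2 => fun b a =>
      frame_pairing c phi x g b.1 a.1 * (b.2 == a.2)%:R +
      (b.1 == a.1)%:R * frame_pairing c phi x g b.2 a.2
  | Ext p E1 => fun b a => \sum_(i < p)
      frame_pairing c phi x g (b i) (a i) *
      \prod_(j < p | j != i) (b j == a j)%:R
  end.

(* <phi|(sum_a s_a (x) e_a)
     = sum_a (L^{1,0}_phi s_a (x) e_a + (-1)^q s_a /\ <phi| e_a). *)
Definition pairing A (phi : eform R X n 1 Tan) q E (s : eform R X n q E) :
    eform R X n q.+1 E :=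
  on_atlas A (fun c x J b =>
    anti_part (lie c phi (anti_mform (fun y J' => s c y J' b))) x J
    + (-1) ^+ q * \sum_(a : idx n E)
        wedger (fun J' => s c x J' a)
               (fun g => frame_pairing c phi x g b a) J).

(* e^{i_phi} dz^a = dz^a + i_phi dz^a, at x; the sum stops as i_phi dz^a is a
   (0,1)-form. *)
Definition exp_dz c phi (a : 'I_n) (x : X) (e : 'I_n + 'I_n) : C R :=
  dz_mform a x [ffun=> e] + iop c phi (dz_mform a) x [ffun=> e].

(* The extension operator, from the frames of z in A to those of w in B; on the
   cotangent bundle, the coefficient on dw^b of
     e^{i_phi} dz^a = sum_g (xi_g dz^g + xi'_g d(conj z)^g).
   Being compatible with wedge products it is e^{i_phi} on Ext p Cot. *)
Definition extension A B (phi : eform R X n 1 Tan) q E (s : eform R X n q E) :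
    eform R X n q E :=
  on_atlas B (fun w x =>
    let z := chart_at A w x in
    act (\matrix_(i, j) pdb w (zbc z j) i x)
        (\matrix_(b, a) pd z (zc w b) a x)
        (\matrix_(b, a) \sum_(g < n)
           (exp_dz z phi a x (inl g) * pd w (zc z g) b x +
            exp_dz z phi a x (inr g) * pd w (zbc z g) b x))
        (s z x)).

End Forms.

Arguments A0 {R X n} A q E _.
Arguments extension {R X n} A B phi q E s.

(* Main.v *)
(* Let z and w be local coordinates of X and X_t, seen as functions on X, and
   phi = phi^a_j d(conj z)^j (x) d/dz^a.  The relation
   dw/d(conj z) = (dw/dz) phi turns the chain rule into
     d/d(conj w)^i = sum_j d(conj z)^j/d(conj w)^i D_j,
     D_j = d/d(conj z)^j - sum_a phi^a_j d/dz^a,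
   and gives D_j (dw^b/dz^c) = sum_a (d phi^a_j/dz^c) dw^b/dz^a, by the symmetry
   of second derivatives.  In the frames of z and w, rho is induced by the
   matrices d(conj z)/d(conj w), dw/dz and (dw/dz)^{-1}.  So in dbar_t (rho s)
   the operators D_j acting on the components of s give dbar - L^{1,0}_phi, the
   derivatives of dw/dz give the pairing with the frame, and those of
   d(conj z)/d(conj w) cancel by antisymmetry.
   The matrix dw/dz is the identity for t = 0 and a suitable choice of w, hence
   invertible for small t by compactness of X; the coordinates w exist by the
   holomorphic inverse function theorem. *)
Require Import Defs.
From HB Require Import structures.
From mathcomp Require Import all_boot all_order all_algebra all_fingroup.
From mathcomp Require Import all_classical all_reals all_analysis.
From mathcomp Require Import complex.
From mathcomp Require Import ring lra.

Set Implicit Arguments.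
Unset Strict Implicit.
Unset Printing Implicit Defensive.

Import Defs.
Import Order.TTheory GRing.Theory Num.Theory.
Import numFieldNormedType.Exports.

Local Open Scope classical_set_scope.
Local Open Scope ring_scope.

(** * Calculus in C^n *)

(** The definitions differentiate only along real lines, and smoothness speaks only of iterated
    partial derivatives on open sets. Strict differentiability is the notion that makes these
    usable: continuous partial derivatives imply it, and it yields the chain rule, the symmetry of
    second derivatives and the inverse function theorem. The tensor computation itself is then
    pointwise, in one chart [z] of X and one chart [w] of X_t. Two obstacles lie outside that
    computation. The operators [beltrami] and [extension] choose a chart at each point, and this
    choice need not vary continuously; cocycle identities for the frame matrices replace it by a
    chart fixed near the point before anything is differentiated. Moreover the theorem inverts rho
    on [A0], so [dolbeault A s - pairing A phi s] has to be known to be a global form; its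
    transition law is not computed but inherited from [dolbeault At (rho s)] through the inverse of
    rho. *)

Section RealNorms.
Context {R : realType}.
Implicit Types (x y z : C R) (r s e : R).

(* [cRe], [cIm], [rc] each fix one elaboration of the maps between R and C R, so
   that C can be made opaque to unification below. *)
Definition cRe (z : C R) : R := complex.Re z.
Definition cIm (z : C R) : R := complex.Im z.
Definition rc (s : R) : C R := (s%:C)%C.
Local Notation Re := cRe.
Local Notation Im := cIm.

Lemma eq_ReIm x y : Re x = Re y -> Im x = Im y -> x = y.
Proof. by case: x y => [a b] [c d]; rewrite /cRe /cIm /= => -> ->. Qed.

Lemma cReD x y : Re (x + y) = Re x + Re y. Proof. by case: x; case: y. Qed.
Lemma cImD x y : Im (x + y) = Im x + Im y. Proof. by case: x; case: y. Qed.
Lemma cReN x : Re (- x) = - Re x. Proof. by case: x. Qed.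
Lemma cImN x : Im (- x) = - Im x. Proof. by case: x. Qed.
Lemma cReM x y : Re (x * y) = Re x * Re y - Im x * Im y.
Proof. by case: x; case: y. Qed.
Lemma cImM x y : Im (x * y) = Re x * Im y + Im x * Re y.
Proof. by case: x; case: y. Qed.
Lemma cRe_conj x : Re (x^*) = Re x. Proof. by case: x. Qed.
Lemma cIm_conj x : Im (x^*) = - Im x. Proof. by case: x. Qed.
Lemma cRe_i : Re ('i : C R) = 0. Proof. by []. Qed.
Lemma cIm_i : Im ('i : C R) = 1. Proof. by []. Qed.

Lemma cReV x : Re x^-1 = Re x / (Re x ^+ 2 + Im x ^+ 2).
Proof. by case: x. Qed.
Lemma cImV x : Im x^-1 = - Im x / (Re x ^+ 2 + Im x ^+ 2).
Proof. by case: x => a b; rewrite /cRe /cIm /= mulNr. Qed.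
Lemma cRe0 : Re 0 = 0. Proof. by []. Qed.
Lemma cIm0 : Im 0 = 0. Proof. by []. Qed.
Lemma cRe1 : Re 1 = 1. Proof. by []. Qed.
Lemma cIm1 : Im 1 = 0. Proof. by []. Qed.
Lemma cRe_rc s : Re (rc s) = s. Proof. by []. Qed.
Lemma cIm_rc s : Im (rc s) = 0. Proof. by []. Qed.
Lemma rcD s r : rc (s + r) = rc s + rc r. Proof. exact: rmorphD. Qed.
Lemma rc0 : rc 0 = 0. Proof. by []. Qed.
Lemma rc_conj s : (rc s)^* = rc s.
Proof. by apply: eq_ReIm; rewrite ?cRe_conj ?cIm_conj ?cIm_rc ?oppr0. Qed.
Lemma rc_ReIm z : z = rc (Re z) + 'i * rc (Im z).
Proof. exact: complexE. Qed.

Definition ReIm := (cReD, cImD, cReN, cImN, cReM, cImM, cRe_conj, cIm_conj, cRe_i, cIm_i,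
  cRe_rc, cIm_rc, cRe0, cIm0, cRe1, cIm1).

(* The l^1 norms, with values in R rather than in the partially ordered C R. *)
Definition absC (z : C R) : R := `|Re z| + `|Im z|.
Definition absV n (u : 'rV[C R]_n) : R := \sum_j absC (u 0 j).

Lemma absC_ge0 x : 0 <= absC x. Proof. by rewrite addr_ge0. Qed.
Hint Resolve absC_ge0 : core.

Lemma absC0 : absC 0 = 0. Proof. by rewrite /absC !ReIm !normr0 addr0. Qed.

Lemma absC_eq0 x : absC x = 0 -> x = 0.
Proof.
move/eqP; rewrite paddr_eq0 // !normr_eq0 => /andP[/eqP h1 /eqP h2].
exact: eq_ReIm.
Qed.

Lemma absCD x y : absC (x + y) <= absC x + absC y.
Proof.
rewrite /absC !ReIm; have := ler_normD (Re x) (Re y).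
have := ler_normD (Im x) (Im y); lra.
Qed.

Lemma absCN x : absC (- x) = absC x.
Proof. by rewrite /absC !ReIm !normrN. Qed.

Lemma absC_conj x : absC x^* = absC x.
Proof. by rewrite /absC !ReIm normrN. Qed.

Lemma absCM x y : absC (x * y) <= absC x * absC y.
Proof.
rewrite /absC !ReIm; apply: (@le_trans _ _
  ((`|Re x * Re y| + `|Im x * Im y|) + (`|Re x * Im y| + `|Im x * Re y|))).
  by apply: lerD; [exact: ler_normB|exact: ler_normD].
rewrite !normrM; lra.
Qed.

Lemma absCMr r x : absC (rc r * x) = `|r| * absC x.
Proof. by rewrite /absC !ReIm /= !mul0r subr0 addr0 !normrM mulrDr. Qed.

Lemma absC_sum (I : finType) (P : pred I) (F : I -> C R) :
  absC (\sum_(i | P i) F i) <= \sum_(i | P i) absC (F i).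
Proof.
elim/big_rec2: _ => [|i a b _ h]; first by rewrite absC0.
by rewrite (le_trans (absCD _ _)) // lerD2l.
Qed.

Section V.
Context {n : nat}.
Implicit Types u v w : 'rV[C R]_n.

Lemma absV_ge0 u : 0 <= absV u. Proof. exact: sumr_ge0. Qed.
Lemma absV0 : absV (0 : 'rV[C R]_n) = 0.
Proof. by rewrite /absV big1 // => j _; rewrite mxE absC0. Qed.
Lemma absVD u v : absV (u + v) <= absV u + absV v.
Proof.
by rewrite /absV -big_split; apply: ler_sum => j _; rewrite mxE absCD.
Qed.
Lemma absVN u : absV (- u) = absV u.
Proof. by apply: eq_bigr => j _; rewrite mxE absCN. Qed.
Lemma absVB u v : absV (u - v) = absV (v - u).
Proof. by rewrite -absVN opprB. Qed.
Lemma absVBD w u v : absV (u - v) <= absV (u - w) + absV (w - v).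
Proof. by rewrite (le_trans _ (absVD _ _)) // addrA subrK. Qed.
Lemma absV_eq0 u : absV u = 0 -> u = 0.
Proof.
move=> h; apply/rowP => j; rewrite mxE; apply: absC_eq0.
apply/eqP; rewrite eq_le absC_ge0 andbT -h /absV (bigD1 j) //= lerDl.
exact: sumr_ge0.
Qed.
Lemma absVZ r u : absV (rc r *: u) = `|r| * absV u.
Proof. by rewrite /absV mulr_sumr; apply: eq_bigr => j _; rewrite mxE absCMr. Qed.
Lemma absC_le_absV u j : absC (u 0 j) <= absV u.
Proof. by rewrite /absV (bigD1 j) //= lerDl sumr_ge0. Qed.

Lemma absV_mulmx p (A : 'M[C R]_(n, p)) :
  exists2 c : R, 0 < c & forall u, absV (u *m A) <= c * absV u.
Proof.
exists (1 + \sum_i \sum_j absC (A i j)) => [|u].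
  by rewrite ltr_pwDl // sumr_ge0 // => i _; apply: sumr_ge0.
apply: (@le_trans _ _ (\sum_j \sum_i absC (u 0 i) * absC (A i j))).
  apply: ler_sum => j _; rewrite mxE (le_trans (absC_sum _ _)) //.
  by apply: ler_sum => i _; exact: absCM.
rewrite exchange_big /= mulrDl mul1r.
apply: (@le_trans _ _ (\sum_i absV u * \sum_j absC (A i j))).
  apply: ler_sum => i _; rewrite mulr_sumr; apply: ler_sum => j _.
  by rewrite ler_wpM2r // absC_le_absV.
by rewrite -mulr_sumr mulrC lerDr absV_ge0.
Qed.
End V.

Lemma normC_le_absC x : `|x| <= ((absC x)%:C)%C.
Proof.
rewrite normc_def lecR /absC -[leRHS]ger0_norm ?addr_ge0 // -[leRHS]sqrtr_sqr.
apply: ler_wsqrtr.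
have := mulr_ge0 (normr_ge0 (Re x)) (normr_ge0 (Im x)).
have := real_normK (num_real (Re x)); have := real_normK (num_real (Im x)).
lra.
Qed.

Lemma absC_le_normC x e : `|x| < (e%:C)%C -> absC x < 2 * e.
Proof.
rewrite normc_def ltcR => h.
have hr : `|Re x| < e.
  by apply: le_lt_trans h; rewrite -sqrtr_sqr ler_wsqrtr // lerDl sqr_ge0.
have hi : `|Im x| < e.
  by apply: le_lt_trans h; rewrite -sqrtr_sqr ler_wsqrtr // lerDr sqr_ge0.
rewrite /absC; lra.
Qed.

Lemma nbhsCP x (S : set (C R)) :
  nbhs x S <-> exists2 e : R, 0 < e & forall y, absC (y - x) < e -> S y.
Proof.
split.
  move/nbhs_ballP => [e /= e0 h].
  (* Radii of balls in [C R] are elements of [C R]; a positive one is real. *)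
  have he : e = ((Re e)%:C)%C by apply/esym/eqP; rewrite RRe_real // gtr0_real.
  exists (Re e); first by rewrite he ltcR in e0.
  move=> y hy; apply: h; rewrite -ball_normE /= distrC he.
  by apply: le_lt_trans (normC_le_absC _) _; rewrite ltcR.
move=> [e e0 h]; apply/nbhs_ballP; exists ((e / 2)%:C)%C => /=.
  by rewrite (ltcR 0) divr_gt0.
move=> y; rewrite -ball_normE /= distrC => /absC_le_normC hy.
by apply: h; apply: lt_le_trans hy _; rewrite mulrC divfK.
Qed.

Lemma nbhsVP n (u : 'rV[C R]_n) (S : set 'rV[C R]_n) :
  nbhs u S <-> exists2 e : R, 0 < e & forall v, absV (v - u) < e -> S v.
Proof.
split.
  move/nbhs_ballP => [e /= e0 h].
  have he : e = ((Re e)%:C)%C by apply/esym/eqP; rewrite RRe_real // gtr0_real.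
  exists (Re e); first by rewrite he ltcR in e0.
  move=> v hv; apply: h; split=> // i j; rewrite ord1 -ball_normE /= distrC.
  rewrite he (le_lt_trans (normC_le_absC _)) // ltcR; apply: le_lt_trans hv.
  by have := absC_le_absV (v - u) j; rewrite !mxE.
(* The 2 pays for [absC_le_normC]; [n.+1] rather than [n] makes the sum of the [n] coordinates
   strictly less than [e] and covers [n = 0]. *)
move=> [e e0 h]; apply/nbhs_ballP; exists ((e / (2 * n.+1%:R))%:C)%C => /=.
  by rewrite (ltcR 0) divr_gt0 // mulr_gt0.
move=> v [_ hv]; apply: h; apply: (@le_lt_trans _ _ (\sum_(j < n) e / n.+1%:R)).
  apply: ler_sum => j _; apply: ltW.
  have := hv 0 j; rewrite -ball_normE /= distrC => /absC_le_normC.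
  by rewrite !mxE invfM [e * _]mulrC 2!mulrA divff // mul1r mulrC.
rewrite sumr_const card_ord -[_ *+ n]mulr_natr -mulrA gtr_pMr //.
by rewrite mulrC ltr_pdivrMr // mul1r ltr_nat.
Qed.

Lemma continuousCP n (f : 'rV[C R]_n -> C R) u :
  {for u, continuous f} <->
  forall e : R, 0 < e -> \forall v \near u, absC (f v - f u) < e.
Proof.
split => [h e e0|h].
  have hN : nbhs (f u) [set z | absC (z - f u) < e] by apply/nbhsCP; exists e.
  exact: (h _ hN).
move=> S /nbhsCP[e e0 hS]; change (\forall v \near u, S (f v)).
by apply: filterS (h e e0) => v /hS.
Qed.

Lemma continuousVP m n (f : 'rV[C R]_m -> 'rV[C R]_n) u :
  {for u, continuous f} <->
  forall i, {for u, continuous (fun v => f v 0 i)}.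
Proof.
split => [h i|h].
  apply/continuousCP => e e0.
  have hN : nbhs (f u) [set v | absV (v - f u) < e] by apply/nbhsVP; exists e.
  have : \forall v \near u, absV (f v - f u) < e := h _ hN.
  apply: filterS => v /=; apply: le_lt_trans.
  by have := absC_le_absV (f v - f u) i; rewrite !mxE.
move=> S /nbhsVP[e e0 hS]; change (\forall v \near u, S (f v)).
have e0' : 0 < e / n.+1%:R by rewrite divr_gt0.
have h1 i : \forall v \near u, absC (f v 0 i - f u 0 i) < e / n.+1%:R.
  by have /continuousCP := h i; apply.
have h2 : \forall v \near u, forall i, absC (f v 0 i - f u 0 i) < e / n.+1%:R.
  exact: filter_forall h1.
apply: filterS h2 => v hv; apply: hS.
apply: (@le_lt_trans _ _ (\sum_(j < n) e / n.+1%:R)).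
  by apply: ler_sum => j _; apply: ltW; rewrite !mxE.
rewrite sumr_const card_ord -[_ *+ n]mulr_natr -mulrA gtr_pMr //.
by rewrite mulrC ltr_pdivrMr // mul1r ltr_nat.
Qed.

Section Lines.
Context {n : nat}.
Implicit Types (f : 'rV[C R]_n -> C R) (u v : 'rV[C R]_n).

Lemma re_lineE f u v : re_line f u v = Re \o (fun s => f (u + rc s *: v)).
Proof. by []. Qed.

Lemma im_lineE f u v : im_line f u v = Im \o (fun s => f (u + rc s *: v)).
Proof. by []. Qed.

Lemma cRe_rderive f u v : Re (rderive v f u) = derive1 (re_line f u v) 0.
Proof. by []. Qed.

Lemma cIm_rderive f u v : Im (rderive v f u) = derive1 (im_line f u v) 0.
Proof. by []. Qed.
End Lines.

End RealNorms.
#[global] Opaque C rderive.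
#[export] Hint Resolve absC_ge0 absV_ge0 : core.

(** * Derivatives of real functions and of curves in C *)

Section RealDerivative.
Context {R : realType}.
Implicit Types (g : R -> R) (s l e h : R).

(** This form has no division and no excluded point, so it is filtered along full neighbourhoods of
    0 and its error terms add up directly. *)
Lemma is_derive1P g s l : is_derive s 1 g l <->
  forall e, 0 < e -> \forall h \near 0, `|g (s + h) - g s - h * l| <= e * `|h|.
Proof.
have eqq h : g (h *: 1 + s) = g (s + h) by rewrite [h *: _]mulr1 addrC.
split.
  move=> [dg dgl] e e0.
  have : h^-1 *: ((g \o shift s) (h *: 1) - g s) @[h --> 0^'] --> l.
    by rewrite -dgl; exact: dg.
  move=> /cvgrPdist_le /(_ e e0); rewrite near_withinE => hn.
  apply: filterS hn => h hh; have [->|h0] := eqVneq h 0.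
    by rewrite addr0 subrr mul0r subr0 normr0 mulr0.
  have /= := hh h0; rewrite eqq => {}hh.
  have -> : g (s + h) - g s - h * l = - (h * (l - h^-1 *: (g (s + h) - g s))).
    by rewrite mulrBr [_ *: _]/( _ * _) mulVKf // opprB.
  by rewrite normrN normrM mulrC ler_wpM2r.
move=> hg.
have cv : h^-1 *: ((g \o shift s) (h *: 1) - g s) @[h --> 0^'] --> l.
  apply/cvgrPdist_le => e e0; rewrite near_withinE.
  apply: filterS (hg e e0) => h hh h0 /=; rewrite eqq.
  have -> : l - h^-1 *: (g (s + h) - g s) = - (h^-1 * (g (s + h) - g s - h * l)).
    by rewrite mulrBr mulKf // opprB.
  rewrite normrN normrM normfV mulrC ler_pdivrMr ?normr_gt0 //.
by split; [apply/cvg_ex; exists l|apply: cvg_lim cv].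
Qed.

(** The mean value theorem turns the increment into a slope, which lies within [e] of [l]; the
    symmetric range of [s] serves both signs of [c]. *)
Lemma real_mvt_bound g (g' : R -> R) (c l e : R) :
  (forall s, `|s| <= `|c| -> is_derive s 1 g (g' s) /\ `|g' s - l| <= e) ->
  `|g c - g 0 - c * l| <= e * `|c|.
Proof.
move=> hg.
have key a b : a <= b -> (forall s, s \in `[a, b]%R -> `|s| <= `|c|) ->
    `|g b - g a - (b - a) * l| <= e * (b - a).
  move=> ab hab.
  have cg : {within `[a, b], continuous g}.
    apply: derivable_within_continuous => s sab.
    by have [[]] := hg s (hab s sab).
  have [|t tab ->] := MVT_segment ab _ cg (df := g').
    move=> s sab; have [] // := hg s (hab s _).
    by apply: subset_itv_oo_cc.
  rewrite [(b - a) * l]mulrC -mulrBl normrM [`|b - a|]ger0_norm ?subr_ge0 //.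
  by rewrite ler_wpM2r ?subr_ge0 //; have [] := hg t (hab t tab).
have [c0|c0] := leP 0 c.
  have := key 0 c c0; rewrite !subr0 ger0_norm //; apply => s.
  by rewrite in_itv /= => /andP[? ?]; rewrite ger0_norm.
rewrite [`|c|]ltr0_norm //; have := key c 0 (ltW c0); rewrite sub0r => hk.
rewrite -normrN; have -> : - (g c - g 0 - c * l) = g 0 - g c - - c * l by ring.
apply: hk => s; rewrite in_itv /= => /andP[? ?].
by rewrite ler0_norm // [`|c|]ltr0_norm // lerN2.
Qed.

End RealDerivative.

Section CurveDerivative.
Context {R : realType}.
Implicit Types (g : R -> C R) (l : C R).
Local Notation Re := (@cRe R).
Local Notation Im := (@cIm R).

(** Derivative at the parameter 0 of a curve in C; no other parameter is needed, since [rderive]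
    differentiates along the line issuing from the point. *)
Definition cderiv g l : Prop := forall e : R, 0 < e ->
  \forall h \near (0 : R), absC (g h - g 0 - rc h * l) <= e * `|h|.

Lemma cderivP g l : cderiv g l <->
  is_derive (0 : R) 1 (Re \o g) (Re l) /\ is_derive (0 : R) 1 (Im \o g) (Im l).
Proof.
split.
  move=> hg; split; apply/is_derive1P => e e0; apply: filterS (hg e e0) => h;
    rewrite /absC add0r /= !ReIm /= !mul0r ?subr0 ?addr0;
    apply: le_trans; [rewrite lerDl|rewrite lerDr]; exact: normr_ge0.
move=> [/is_derive1P hr /is_derive1P hi] e e0.
have e2 : 0 < e / 2 by lra.
near=> h.
have : `|Re (g (0 + h)) - Re (g 0) - h * Re l| <= e / 2 * `|h|.
  by near: h; exact: hr.
have : `|Im (g (0 + h)) - Im (g 0) - h * Im l| <= e / 2 * `|h|.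
  by near: h; exact: hi.
rewrite /absC add0r !ReIm /= !mul0r ?subr0 ?addr0; lra.
Unshelve. all: by end_near. Qed.

Lemma cderiv_near g g' l : (\forall h \near (0 : R), g h = g' h) ->
  cderiv g l -> cderiv g' l.
Proof.
move=> hn hg e e0; have g0 := nbhs_singleton hn.
by apply: filterS2 hn (hg e e0) => h <-; rewrite -g0.
Qed.

Lemma cderiv_cst (c : C R) : cderiv (fun=> c) 0.
Proof.
move=> e e0; apply: filterE => h.
by rewrite subrr mulr0 subr0 absC0 mulr_ge0 // ltW.
Qed.

Lemma cderivD g1 g2 l1 l2 :
  cderiv g1 l1 -> cderiv g2 l2 -> cderiv (fun s => g1 s + g2 s) (l1 + l2).
Proof.
move=> /cderivP[h1 k1] /cderivP[h2 k2]; apply/cderivP; split.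
  rewrite cReD (_ : _ \o _ = (Re \o g1) + (Re \o g2)); first exact: is_deriveD.
  by apply/funext => s /=; rewrite cReD.
rewrite cImD (_ : _ \o _ = (Im \o g1) + (Im \o g2)); first exact: is_deriveD.
by apply/funext => s /=; rewrite cImD.
Qed.

Lemma cderivM g1 g2 l1 l2 : cderiv g1 l1 -> cderiv g2 l2 ->
  cderiv (fun s => g1 s * g2 s) (l1 * g2 0 + g1 0 * l2).
Proof.
move=> /cderivP[h1 k1] /cderivP[h2 k2]; apply/cderivP; split.
  rewrite (_ : _ \o _ = (Re \o g1) * (Re \o g2) - (Im \o g1) * (Im \o g2)).
    by apply: is_derive_eq; rewrite /= !ReIm /GRing.scale /=; ring.
  by apply/funext => s /=; rewrite cReM.
rewrite (_ : _ \o _ = (Re \o g1) * (Im \o g2) + (Im \o g1) * (Re \o g2)).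
  by apply: is_derive_eq; rewrite /= !ReIm /GRing.scale /=; ring.
by apply/funext => s /=; rewrite cImM.
Qed.

Lemma cderiv_conj g l : cderiv g l -> cderiv (fun s => (g s)^*) l^*.
Proof.
move=> hg e e0; apply: filterS (hg e e0) => h.
by rewrite -absC_conj !rmorphB rmorphM /= rc_conj.
Qed.

Lemma cderiv_line (c z : C R) : cderiv (fun s => c + rc s * z) z.
Proof.
move=> e e0; apply: filterE => h.
have -> : c + rc h * z - (c + rc 0 * z) - rc h * z = 0.
  by rewrite rc0 mul0r; ring.
by rewrite absC0 mulr_ge0 // ltW.
Qed.

Lemma cderiv_bound g l : cderiv g l ->
  \forall h \near (0 : R), absC (g h - g 0) <= (absC l + 1) * `|h|.
Proof.
move=> hg; apply: filterS (hg 1 ltr01) => h; rewrite mul1r => hh.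
have -> : g h - g 0 = (g h - g 0 - rc h * l) + rc h * l by rewrite subrK.
apply: le_trans (absCD _ _) _; rewrite absCMr; lra.
Qed.

End CurveDerivative.

(** * Strict differentiability and the chain rule along curves *)

Section StrictDifferential.
Context {R : realType} {n : nat}.
Implicit Types (f : 'rV[C R]_n -> C R) (u v w : 'rV[C R]_n) (l : C R).
Local Notation Re := (@cRe R).
Local Notation Im := (@cIm R).

Lemma rderivableP f u v : rderivable f u v <->
  exists l, cderiv (fun s => f (u + rc s *: v)) l.
Proof.
rewrite /rderivable re_lineE im_lineE.
split => [[h1 h2]|[l /cderivP[[h1 _] [h2 _]]]]; last by split.
exists (rderive v f u); apply/cderivP; rewrite cRe_rderive cIm_rderive !derive1E re_lineE im_lineE.
by split; exact: derivableP.
Qed.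

Lemma cderiv_rderive f u v l :
  cderiv (fun s => f (u + rc s *: v)) l -> rderive v f u = l.
Proof.
by move=> /cderivP[[_ h1] [_ h2]]; apply: eq_ReIm;
  rewrite ?cRe_rderive ?cIm_rderive derive1E ?re_lineE ?im_lineE.
Qed.

Lemma rderive_cderiv f u v : rderivable f u v ->
  cderiv (fun s => f (u + rc s *: v)) (rderive v f u).
Proof. by move=> /rderivableP[l h]; rewrite (cderiv_rderive h). Qed.

Lemma near_line u v (P : set 'rV[C R]_n) : (\forall w \near u, P w) ->
  \forall s \near (0 : R), P (u + rc s *: v).
Proof.
move=> /nbhsVP[e e0 h].
have c0 : 0 < absV v + 1 := ltr_wpDl (absV_ge0 v) ltr01.
apply/nbhs_ballP; exists (e / (absV v + 1)); first by rewrite /= divr_gt0.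
move=> s; rewrite -ball_normE /= sub0r normrN => hs; apply: h.
rewrite addrC addKr absVZ; rewrite ltr_pdivlMr // in hs.
by apply: le_lt_trans hs; rewrite ler_wpM2l // lerDl.
Qed.

Lemma rderivable_near f g u v : (\forall w \near u, f w = g w) ->
  rderivable f u v -> rderivable g u v /\ rderive v g u = rderive v f u.
Proof.
move=> h /rderive_cderiv hf.
have hg : cderiv (fun s => g (u + rc s *: v)) (rderive v f u).
  by apply: cderiv_near hf; exact: (near_line v h).
by split; [apply/rderivableP; exists (rderive v f u)|exact: cderiv_rderive].
Qed.

(** The mean value theorem is false for complex values, so it is applied to real and imaginary
    parts; adding both errors in the l^1 norm costs the factor 2. *)
Lemma mvt_line f u v (c e : R) l :
  (forall s : R, `|s| <= `|c| -> rderivable f (u + rc s *: v) v /\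
     absC (rderive v f (u + rc s *: v) - l) <= e) ->
  absC (f (u + rc c *: v) - f u - rc c * l) <= 2 * e * `|c|.
Proof.
move=> h.
have shiftE (s t : R) : u + rc s *: v + rc t *: v = u + rc (s + t) *: v.
  by rewrite -addrA -scalerDl rcD.
pose d s := rderive v f (u + rc s *: v).
have hr : `|re_line f u v c - re_line f u v 0 - c * Re l| <= e * `|c|.
  apply: (@real_mvt_bound _ _ (Re \o d)) => s hs.
  have [/rderive_cderiv/cderivP[/is_derive1P h1 _] h2] := h s hs; split.
    apply/is_derive1P => e' /h1; apply: filterS => t /=.
    by rewrite re_lineE /= add0r !shiftE addr0.
  by rewrite (le_trans _ h2) // /absC !ReIm lerDl.
have hi : `|im_line f u v c - im_line f u v 0 - c * Im l| <= e * `|c|.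
  apply: (@real_mvt_bound _ _ (Im \o d)) => s hs.
  have [/rderive_cderiv/cderivP[_ /is_derive1P h1] h2] := h s hs; split.
    apply/is_derive1P => e' /h1; apply: filterS => t /=.
    by rewrite im_lineE /= add0r !shiftE addr0.
  by rewrite (le_trans _ h2) // /absC !ReIm lerDr.
move: hr hi; rewrite re_lineE im_lineE /= rc0 scale0r addr0.
rewrite /absC !ReIm /= !mul0r subr0 addr0; lra.
Qed.

(** Strict differentiability: both points move. This is what gives the contraction estimate of the
    inverse function theorem and controls second differences. *)
Definition sdiff f u (L : 'rV[C R]_n -> C R) : Prop :=
  forall e : R, 0 < e -> exists2 d : R, 0 < d & forall v w,
    absV (v - u) < d -> absV (w - u) < d ->
    absC (f v - f w - L (v - w)) <= e * absV (v - w).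

Definition differential f u v : C R :=
  \sum_j (rc (Re (v 0 j)) * rderive (axis j false) f u +
          rc (Im (v 0 j)) * rderive (axis j true) f u).

Definition axis_coef v (p : 'I_n * bool) : R :=
  if p.2 then Im (v 0 p.1) else Re (v 0 p.1).

Lemma pair_bool_sum (V : nmodType) (F : 'I_n * bool -> V) :
  \sum_p F p = \sum_j (F (j, false) + F (j, true)).
Proof.
rewrite (eq_bigr (fun p => F (p.1, p.2))) => [|[]//].
rewrite -(pair_bigA _ (fun j b => F (j, b))) /=.
by apply: eq_bigr => j _; rewrite big_bool addrC.
Qed.

Lemma axis_decomp v : v = \sum_p rc (axis_coef v p) *: axis p.1 p.2.
Proof.
rewrite pair_bool_sum [LHS]row_sum_delta; apply: eq_bigr => j _.
rewrite /axis /axis_coef /= scale1r scalerA -scalerDl; congr (_ *: _).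
by rewrite [LHS]rc_ReIm mulrC.
Qed.

Lemma absV_axis_coef v : absV v = \sum_p `|axis_coef v p|.
Proof. by rewrite pair_bool_sum. Qed.

Lemma absV_axis (j : 'I_n) b : absV (axis j b : 'rV[C R]_n) = 1.
Proof.
rewrite /absV (bigD1 j) //= big1 ?addr0; last first.
  move=> k kj; rewrite !mxE (negbTE kj) /= mulr0; exact: absC0.
by rewrite !mxE !eqxx /= mulr1 /absC; case: b; rewrite !ReIm ?normr0 ?normr1 ?addr0 ?add0r.
Qed.

(** Walk from [w] to [v] along the 2n real axes, one after the other. On each leg the mean value
    theorem applies with the partial derivative frozen at [u], from which it differs by less than
    e/2 on the whole walk. *)
Lemma sdiff_axes f u :
  (forall j b, \forall v \near u, rderivable f v (axis j b)) ->
  (forall j b, {for u, continuous (rderive (axis j b) f)}) ->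
  sdiff f u (differential f u).
Proof.
move=> hd hc e e0; have e2 : 0 < e / 2 by lra.
pose good v := forall p : 'I_n * bool, rderivable f v (axis p.1 p.2) /\
  absC (rderive (axis p.1 p.2) f v - rderive (axis p.1 p.2) f u) < e / 2.
have hgood1 (p : 'I_n * bool) : \forall v \near u, rderivable f v (axis p.1 p.2) /\
    absC (rderive (axis p.1 p.2) f v - rderive (axis p.1 p.2) f u) < e / 2.
  apply: filterS2 (hd p.1 p.2) _ => [v h1 h2|]; first by split; [exact: h1|exact: h2].
  by have /continuousCP := hc p.1 p.2; apply.
have : \forall v \near u, good v by exact: filter_forall hgood1.
(* Every point of the walk lies within |w - u| + |v - w| < d/3 + 2d/3 of [u]. *)
move=> /nbhsVP[d d0 hgood]; exists (d / 3); first by lra.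
pose L (p : 'I_n * bool) := rderive (axis p.1 p.2) f u.
(* Stated for an arbitrary list of axes and starting point, so that induction can remove the first
   leg. *)
have path (r : seq ('I_n * bool)) (c : 'I_n * bool -> R) w :
    absV (w - u) + \sum_(p <- r) `|c p| < d ->
    absC (f (w + \sum_(p <- r) rc (c p) *: axis p.1 p.2) - f w
          - \sum_(p <- r) rc (c p) * L p) <= e * \sum_(p <- r) `|c p|.
  elim: r w => [|p r ih] w; rewrite ?big_nil ?big_cons => hw.
    by rewrite addr0 subrr subr0 absC0 mulr0.
  set w' := w + rc (c p) *: axis p.1 p.2.
  have hw' : absV (w' - u) + \sum_(p <- r) `|c p| < d.
    apply: le_lt_trans hw; rewrite addrA lerD2r /w' addrAC.
    by rewrite (le_trans (absVD _ _)) // lerD2l absVZ absV_axis mulr1.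
  have h1 := ih w' hw'.
  have h2 : absC (f w' - f w - rc (c p) * L p) <= 2 * (e / 2) * `|c p|.
    apply: mvt_line => s hs.
    have hw'' : absV (w + rc s *: axis p.1 p.2 - u) < d.
      apply: le_lt_trans hw; rewrite addrAC (le_trans (absVD _ _)) // lerD2l.
      rewrite absVZ absV_axis mulr1 (le_trans hs) // lerDl.
      by rewrite sumr_ge0.
    by have [h3 /ltW h4] := hgood _ hw'' p.
  rewrite addrA -/w'; set S := \sum_(p <- r) _ *: _ in h1 *.
  set T := \sum_(p <- r) _ * _ in h1 *.
  have -> : f (w' + S) - f w - (rc (c p) * L p + T) =
     (f (w' + S) - f w' - T) + (f w' - f w - rc (c p) * L p) by ring.
  apply: le_trans (absCD _ _) _; move: h2; rewrite mulrDr; lra.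
move=> v w hv hw.
have := path (index_enum _) (axis_coef (v - w)) w.
rewrite -axis_decomp -absV_axis_coef [w + (v - w)]addrC subrK.
have -> : \sum_p rc (axis_coef (v - w) p) * L p = differential f u (v - w).
  by rewrite pair_bool_sum.
apply; have := absVBD u v w; rewrite (absVB u w); lra.
Qed.

End StrictDifferential.

Section ChainAlongCurve.
Context {R : realType} {n : nat}.
Implicit Types (f : 'rV[C R]_n -> C R) (u v w : 'rV[C R]_n) (l : C R).
Lemma cderiv_sdiff f u (L : 'rV[C R]_n -> C R) (g : R -> 'rV[C R]_n)
    (g' : 'rV[C R]_n) :
  g 0 = u -> sdiff f u L -> (exists M, forall v, absC (L v) <= M * absV v) ->
  (forall v w, L (v - w) = L v - L w) ->
  (forall (s : R) v, L (rc s *: v) = rc s * L v) ->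
  (forall j, cderiv (fun s => g s 0 j) (g' 0 j)) ->
  cderiv (fun s => f (g s)) (L g').
Proof.
move=> g0 hf [M0 hM0] LB LZ hg.
(* The given bound [M0] may be zero or negative, and [M] occurs in a denominator. *)
pose M := `|M0| + 1; have M1 : 0 < M by rewrite ltr_wpDl.
have hM v : absC (L v) <= M * absV v.
  apply: le_trans (hM0 v) _; rewrite ler_wpM2r ?absV_ge0 //.
  by rewrite (le_trans (ler_norm _)) // /M lerDl.
pose B := absV g' + n%:R; have B0 : 0 <= B by rewrite addr_ge0 ?absV_ge0.
have hb : \forall s \near (0 : R), absV (g s - u) <= B * `|s|.
  have hb j : \forall s \near (0 : R), absC (g s 0 j - u 0 j) <=
      (absC (g' 0 j) + 1) * `|s| by rewrite -g0; exact: cderiv_bound.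
  have hb' : \forall s \near (0 : R), forall j, absC (g s 0 j - u 0 j) <=
      (absC (g' 0 j) + 1) * `|s| by exact: filter_forall hb.
  apply: filterS hb' => s hs.
  apply: (@le_trans _ _ (\sum_j (absC (g' 0 j) + 1) * `|s|)).
    by apply: ler_sum => j _; have := hs j; rewrite !mxE.
  by rewrite -mulr_suml big_split /= sumr_const card_ord.
(* Half of the error goes to [e1] times the Lipschitz bound [B] of the curve, half to [M] times the
   [n] componentwise linearization errors [e2]. *)
move=> e e0; pose e1 := e / (2 * (B + 1)).
have B1 : 0 < B + 1 by lra.
have e10 : 0 < e1 by rewrite divr_gt0 // mulr_gt0.
have [d d0 hd] := hf e1 e10.
pose e2 := e / (2 * M * n.+1%:R).
have e20 : 0 < e2 by rewrite divr_gt0 // !mulr_gt0.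
have hlin1 j : \forall s \near (0 : R),
    absC (g s 0 j - u 0 j - rc s * g' 0 j) <= e2 * `|s|.
  by rewrite -g0; exact: hg.
have hlin : \forall s \near (0 : R), forall j,
    absC (g s 0 j - u 0 j - rc s * g' 0 j) <= e2 * `|s|.
  exact: filter_forall hlin1.
have hsm : \forall s \near (0 : R), B * `|s| < d.
  apply/nbhs_ballP; exists (d / (B + 1)); first by rewrite /= divr_gt0.
  move=> s; rewrite -ball_normE /= sub0r normrN ltr_pdivlMr // => hs.
  by apply: le_lt_trans hs; rewrite mulrC ler_wpM2l // lerDl.
near=> s.
have h1 : absV (g s - u) <= B * `|s| by near: s.
have h2 : forall j, absC (g s 0 j - u 0 j - rc s * g' 0 j) <= e2 * `|s|.
  by near: s.
have h3 : B * `|s| < d by near: s.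
have h4 := hd (g s) u (le_lt_trans h1 h3).
rewrite subrr absV0 in h4; have {}h4 := h4 d0.
have h5 : absC (L (g s - u) - rc s * L g') <= e / 2 * `|s|.
  rewrite -LZ -LB; apply: le_trans (hM _) _.
  apply: (@le_trans _ _ (M * \sum_(j < n) e2 * `|s|)).
    rewrite ler_wpM2l ?(ltW M1) //; apply: ler_sum => j _.
    by have := h2 j; rewrite !mxE.
  rewrite sumr_const card_ord -[_ *+ n]mulr_natl !mulrA ler_wpM2r //.
rewrite ler_pdivrMr ?mulr_gt0 //.
  have -> : e / 2 * (2 * M * n.+1%:R) = M * n.+1%:R * e by field.
  by rewrite ler_wpM2r ?(ltW e0) // ler_wpM2l ?(ltW M1) // ler_nat.
have h6 : e1 * absV (g s - u) <= e / 2 * `|s|.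
  apply: (@le_trans _ _ (e1 * (B * `|s|))); first by rewrite ler_wpM2l // ltW.
  rewrite mulrA ler_wpM2r ?absV_ge0 // /e1 mulrAC ler_pdivrMr ?mulr_gt0 //.
  have -> : e / 2 * (2 * (B + 1)) = e * (B + 1) by field.
  by rewrite ler_wpM2l ?(ltW e0) // lerDl.
rewrite g0; have -> : f (g s) - f u - rc s * L g' =
   (f (g s) - f u - L (g s - u)) + (L (g s - u) - rc s * L g') by ring.
apply: le_trans (absCD _ _) _; lra.
Unshelve. all: by end_near. Qed.

End ChainAlongCurve.

(** * Germs of smooth functions *)

Section Germs.
Context {R : realType}.

Lemma near_near (T : topologicalType) (x : T) (P : set T) :
  (\forall y \near x, P y) -> \forall y \near x, \forall z \near y, P z.
Proof. exact: nbhs_interior. Qed.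

(** The class C^m of a germ: conditions hold near [u], so closure properties carry no domains.
    Unlike in [continuous_partials], continuity is recorded at every order, so that lower orders
    follow. *)
Fixpoint germ_C n m (f : 'rV[C R]_n -> C R) (u : 'rV[C R]_n) : Prop :=
  (\forall v \near u, {for v, continuous f}) /\
  (if m is m'.+1 then
     forall j b, (\forall v \near u, rderivable f v (axis j b)) /\
                 germ_C m' (rderive (axis j b) f) u
   else True).

Definition smooth n (f : 'rV[C R]_n -> C R) (u : 'rV[C R]_n) : Prop := forall m, germ_C m f u.

Section OneFunction.
Context {n : nat}.
Implicit Types (f g : 'rV[C R]_n -> C R) (u v w : 'rV[C R]_n).

Lemma smooth_onP (U : set 'rV[C R]_n) f : open U ->
  smooth_on U f <-> forall u, U u -> smooth f u.
Proof.
move=> oU; have nU u : U u -> \forall v \near u, U v by move=> Uu; exact: open_nbhs_nbhs.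
split.
  move=> hf u Uu m; move: f hf; elim: m => [|m ih] f hf; split=> //.
  - by apply: filterS (nU u Uu) => v Uv; exact: (hf 0 v Uv).
  - by apply: filterS (nU u Uu) => v Uv; exact: (hf 0 v Uv).
  move=> j b; split; last by apply: ih => k; have [] := hf k.+1 j b.
  by apply: filterS (nU u Uu) => v Uv; have [h _] := hf 1 j b; exact: h.
move=> hf m; have {hf} : forall u, U u -> germ_C m f u by move=> u /hf.
elim: m f => [|m ih] f hf.
  by move=> u /hf[/nbhs_singleton].
move=> j b; split=> [u /hf[_ /(_ j b)[/nbhs_singleton]]//|].
by apply: ih => u /hf[_ /(_ j b)[]].
Qed.

Lemma germ_C_le m f u : germ_C m.+1 f u -> germ_C m f u.
Proof.
elim: m f => [|m ih] f [h1 h2]; split=> // j b.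
by have [h3 h4] := h2 j b; split=> //; exact: ih.
Qed.

Lemma germ_C_le0 m f u : germ_C m f u -> germ_C 0 f u.
Proof. by case: m => [|m] [h1 _]. Qed.

Lemma germ_C_near m f u : germ_C m f u -> \forall v \near u, germ_C m f v.
Proof.
elim: m f => [|m ih] f [/near_near h1 h2]; first by apply: filterS h1 => v h3; split.
have h3 (p : 'I_n * bool) : \forall v \near u,
    (\forall x \near v, rderivable f x (axis p.1 p.2)) /\
    germ_C m (rderive (axis p.1 p.2) f) v.
  have [/near_near h4 /ih h5] := h2 p.1 p.2.
  by apply: filterS2 h4 h5 => v.
have h4 : \forall v \near u, forall p : 'I_n * bool,
    (\forall x \near v, rderivable f x (axis p.1 p.2)) /\
    germ_C m (rderive (axis p.1 p.2) f) v by exact: filter_forall h3.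
by apply: filterS2 h1 h4 => v k1 k2; split=> // j b; exact: (k2 (j, b)).
Qed.

Lemma near_continuous f g u : (\forall v \near u, f v = g v) ->
  (\forall v \near u, {for v, continuous f}) ->
  \forall v \near u, {for v, continuous g}.
Proof.
move=> hfg h; apply: filterS2 h (near_near hfg) => v /continuousCP hv hn.
have hnv := nbhs_singleton hn.
by apply/continuousCP => e e0; apply: filterS2 (hv e e0) hn => w; rewrite hnv => + <-.
Qed.

Lemma germ_C_eq m f g u : (\forall v \near u, f v = g v) ->
  germ_C m f u -> germ_C m g u.
Proof.
elim: m f g => [|m ih] f g hfg [h1 h2].
  by split; [exact: near_continuous hfg h1|].
split; first exact: near_continuous hfg h1.
move=> j b; have [h3 h4] := h2 j b; split.
  by apply: filterS2 h3 (near_near hfg) => v k1 k2; have [] := rderivable_near k2 k1.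
apply: (ih (rderive (axis j b) f)); last exact: h4.
by apply: filterS2 h3 (near_near hfg) => v k1 k2; have [_ ->] := rderivable_near k2 k1.
Qed.

Lemma smooth_eq f g u : (\forall v \near u, f v = g v) -> smooth f u -> smooth g u.
Proof. by move=> h hf m; exact: germ_C_eq (hf m). Qed.

Lemma germ_C_continuous m f u : germ_C m f u -> {for u, continuous f}.
Proof. by move=> /germ_C_le0[/nbhs_singleton]. Qed.

Lemma germ_C1_sdiff f u : germ_C 1 f u -> sdiff f u (differential f u).
Proof.
move=> [_ h]; apply: sdiff_axes => j b; first by have [] := h j b.
by have [_ h2] := h j b; exact: (@germ_C_continuous 0).
Qed.

Lemma differentialE f u v :
  differential f u v = \sum_j (dz j f u * v 0 j + dzb j f u * (v 0 j)^*).
Proof.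
apply: eq_bigr => j _; rewrite /dz /dzb; set x := rderive _ _ _; set y := rderive _ _ _.
set z := v 0 j.
have hzc : z^* = rc (cRe z) - 'i * rc (cIm z).
  by rewrite {1}[z]rc_ReIm rmorphD rmorphM /= !rc_conj conjCi mulNr.
have hz := rc_ReIm z; move: hz hzc.
move: (rc (cRe z)) (rc (cIm z)) => a b hz hzc; rewrite hzc hz.
have i2 : ('i : C R) * 'i = -1 by rewrite -expr2 sqrCi.
transitivity (a * x - ('i * 'i) * (b * y)); last by field.
by rewrite i2; ring.
Qed.

Lemma differential_bound f u : exists M, forall v, absC (differential f u v) <= M * absV v.
Proof.
exists (\sum_j (absC (dz j f u) + absC (dzb j f u))) => v.
rewrite differentialE mulr_suml; apply: le_trans (absC_sum _ _) _.
apply: ler_sum => j _; apply: le_trans (absCD _ _) _; rewrite mulrDl.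
by apply: lerD; apply: le_trans (absCM _ _) _;
  rewrite ?absC_conj ler_wpM2l ?absC_ge0 ?absC_le_absV.
Qed.

Lemma differentialB f u v w :
  differential f u (v - w) = differential f u v - differential f u w.
Proof.
rewrite !differentialE -sumrB; apply: eq_bigr => j _.
by rewrite !mxE rmorphB /=; ring.
Qed.

Lemma differentialZ f u (s : R) v :
  differential f u (rc s *: v) = rc s * differential f u v.
Proof.
rewrite !differentialE mulr_sumr; apply: eq_bigr => j _; rewrite mxE rmorphM /=.
by rewrite rc_conj; ring.
Qed.

Lemma chain_curve f (g : R -> 'rV[C R]_n) (g' : 'rV[C R]_n) :
  germ_C 1 f (g 0) -> (forall j, cderiv (fun s => g s 0 j) (g' 0 j)) ->
  cderiv (fun s => f (g s)) (differential f (g 0) g').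
Proof.
move=> hf hg; apply: cderiv_sdiff => //; first exact: germ_C1_sdiff.
- exact: differential_bound.
- exact: differentialB.
- exact: differentialZ.
Qed.

(** Smoothness is stated for the axes only; the strict differential provides the derivative in every
    direction, as a real-linear function of it. *)
Lemma germ_C1_rderive f u v : germ_C 1 f u ->
  rderivable f u v /\ rderive v f u = differential f u v.
Proof.
move=> hf.
have h : cderiv (fun s => f (u + rc s *: v)) (differential f u v).
  have := @chain_curve f (fun s => u + rc s *: v) v.
  rewrite rc0 scale0r addr0; apply=> // j.
  apply: cderiv_near (cderiv_line (u 0 j) (v 0 j)).
  by apply: filterE => s; rewrite !mxE.
by split; [apply/rderivableP; exists (differential f u v)|exact: cderiv_rderive].
Qed.

End OneFunction.

Lemma rderive_comp m n (f : 'rV[C R]_n -> C R) (g : 'rV[C R]_m -> 'rV[C R]_n) u v :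
  germ_C 1 f (g u) -> (forall i, rderivable (fun w => g w 0 i) u v) ->
  rderivable (f \o g) u v /\
  rderive v (f \o g) u = \sum_i (dz i f (g u) * rderive v (fun w => g w 0 i) u +
     dzb i f (g u) * (rderive v (fun w => g w 0 i) u)^*).
Proof.
move=> hf hg.
pose g' := \row_i rderive v (fun w => g w 0 i) u.
have h : cderiv (fun s => f (g (u + rc s *: v))) (differential f (g u) g').
  have := @chain_curve _ f (fun s => g (u + rc s *: v)) g'.
  rewrite rc0 scale0r addr0; apply=> // j.
  by rewrite mxE; exact: rderive_cderiv (hg j).
split; first by apply/rderivableP; exists (differential f (g u) g').
rewrite (cderiv_rderive h) differentialE.
by apply: eq_bigr => i _; rewrite mxE.
Qed.

End Germs.

(** * Differentiation rules and closure properties of germs *)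

Section GermClosure.
Context {R : realType}.

Section Closure.
Context {n : nat}.
Implicit Types (f g : 'rV[C R]_n -> C R) (u v w : 'rV[C R]_n).

Lemma rderive_cst (c : C R) u v :
  rderivable (fun=> c) u v /\ rderive v (fun=> c) u = 0.
Proof.
have h := cderiv_cst c; split; last exact: cderiv_rderive h.
by apply/rderivableP; exists 0.
Qed.

Lemma rderive_coord j u v :
  rderivable (fun w => w 0 j) u v /\ rderive v (fun w => w 0 j) u = v 0 j.
Proof.
have h : cderiv (fun s => (u + rc s *: v) 0 j) (v 0 j).
  apply: cderiv_near (cderiv_line (u 0 j) (v 0 j)).
  by apply: filterE => s; rewrite !mxE.
split; last exact: (cderiv_rderive (f := fun w => w 0 j) h).
by apply/rderivableP; exists (v 0 j).
Qed.

Lemma rderiveD f g u v : rderivable f u v -> rderivable g u v ->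
  rderivable (fun w => f w + g w) u v /\
  rderive v (fun w => f w + g w) u = rderive v f u + rderive v g u.
Proof.
move=> /rderive_cderiv hf /rderive_cderiv hg; have h := cderivD hf hg.
split; last exact: (cderiv_rderive (f := fun w => f w + g w) h).
by apply/rderivableP; exists (rderive v f u + rderive v g u).
Qed.

Lemma rderiveM f g u v : rderivable f u v -> rderivable g u v ->
  rderivable (fun w => f w * g w) u v /\
  rderive v (fun w => f w * g w) u = rderive v f u * g u + f u * rderive v g u.
Proof.
move=> /rderive_cderiv hf /rderive_cderiv hg; have h := cderivM hf hg.
rewrite /= rc0 scale0r addr0 in h.
split; last exact: (cderiv_rderive (f := fun w => f w * g w) h).
by apply/rderivableP; exists (rderive v f u * g u + f u * rderive v g u).
Qed.

Lemma rderive_conj f u v : rderivable f u v ->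
  rderivable (fun w => (f w)^*) u v /\
  rderive v (fun w => (f w)^*) u = (rderive v f u)^*.
Proof.
move=> /rderive_cderiv hf; have h := cderiv_conj hf.
split; last exact: (cderiv_rderive (f := fun w => (f w)^*) h).
by apply/rderivableP; exists (rderive v f u)^*.
Qed.

(** The real and imaginary parts of 1/f are quotients by N = |f|^2, which reduces the claim to real
    functions. *)
Lemma rderivableV f u v : f u != 0 -> rderivable f u v ->
  rderivable (fun w => (f w)^-1) u v.
Proof.
move=> fu0 [hr hi].
pose N := re_line f u v * re_line f u v + im_line f u v * im_line f u v.
have dN : derivable N 0 1 := derivableD (derivableM hr hr) (derivableM hi hi).
have NE s : N s = re_line f u v s ^+ 2 + im_line f u v s ^+ 2 by rewrite !expr2.
have N0 : N 0 != 0.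
  rewrite NE; apply: contra fu0.
  rewrite paddr_eq0 ?sqr_ge0 // !sqrf_eq0 re_lineE im_lineE /=.
  rewrite rc0 scale0r addr0 => /andP[/eqP k1 /eqP k2].
  by apply/eqP; apply: eq_ReIm; rewrite ?ReIm.
pose NV : R -> R := fun y => (N y)^-1.
have dV : derivable NV 0 1 := derivableV N0 dN.
have er : re_line (fun w => (f w)^-1) u v = re_line f u v * NV.
  by apply/funext => s; rewrite [in LHS]re_lineE /= cReV -[X in _ / X]NE.
have ei : im_line (fun w => (f w)^-1) u v = - im_line f u v * NV.
  by apply/funext => s; rewrite [in LHS]im_lineE /= cImV -[X in _ / X]NE.
split.
  by rewrite er; have := derivableM hr dV.
by rewrite ei; have := derivableM (derivableN hi) dV.
Qed.

(** Differentiability being known, the value is read off by differentiating f * f^-1 = 1, an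
    identity that must hold near [u]. *)
Lemma rderiveV f u v : f u != 0 -> (\forall w \near u, f w != 0) ->
  rderivable f u v ->
  rderive v (fun w => (f w)^-1) u = - rderive v f u * ((f u)^-1 * (f u)^-1).
Proof.
move=> fu0 nf hf; have hV := rderivableV fu0 hf.
have [h1 h2] := rderiveM hf hV.
have h3 : \forall w \near u, f w * (f w)^-1 = 1.
  by apply: filterS nf => w; exact: divff.
have [_ h4] := rderivable_near h3 h1; have [_ h5] := rderive_cst 1 u v.
rewrite h5 h2 in h4; set d := rderive v (fun w => (f w)^-1) u in h4 *.
apply: (mulfI fu0); have -> : f u * d = - (rderive v f u * (f u)^-1).
  by apply/eqP; rewrite -addr_eq0 addrC -h4.
by field.
Qed.

Lemma continuousC_D f g u : {for u, continuous f} -> {for u, continuous g} ->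
  {for u, continuous (fun w => f w + g w)}.
Proof. by move=> h1 h2; apply: (@cvgD _ _ _ _ _ f g _ _ h1 h2). Qed.

Lemma continuousC_M f g u : {for u, continuous f} -> {for u, continuous g} ->
  {for u, continuous (fun w => f w * g w)}.
Proof. by move=> h1 h2; apply: (@cvgM _ _ _ _ f g _ _ h1 h2). Qed.

Lemma continuousC_V f u : f u != 0 -> {for u, continuous f} ->
  {for u, continuous (fun w => (f w)^-1)}.
Proof. by move=> h1 h2; apply: (@cvgV _ _ _ _ f _ h1 h2). Qed.

Lemma continuousC_conj f u : {for u, continuous f} ->
  {for u, continuous (fun w => (f w)^*)}.
Proof.
move=> /continuousCP h; apply/continuousCP => e e0; apply: filterS (h e e0) => w.
by rewrite -rmorphB absC_conj.
Qed.

Lemma germ_C_cst m c u : germ_C m (fun _ : 'rV[C R]_n => c) u.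
Proof.
have hc (d : C R) : \forall v \near u, {for v, continuous (fun _ : 'rV[C R]_n => d)}.
  apply: filterE => v; apply/continuousCP => e e0; apply: filterE => w.
  by rewrite subrr absC0.
elim: m c => [|m ih] c; first by split; [exact: hc|].
split; first exact: hc.
move=> j b; split; first by apply: filterE => v; have [] := rderive_cst c v (axis j b).
apply: germ_C_eq (ih 0); apply: filterE => v.
by have [_ ->] := rderive_cst c v (axis j b).
Qed.

Lemma germ_C_coord m j u : germ_C m (fun w : 'rV[C R]_n => w 0 j) u.
Proof.
have hc : \forall v \near u, {for v, continuous (fun w : 'rV[C R]_n => w 0 j)}.
  apply: filterE => v; apply/continuousCP => e e0; apply/nbhsVP; exists e => // w.
  by apply: le_lt_trans; have := absC_le_absV (w - v) j; rewrite !mxE.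
case: m => [|m]; first by split; [exact: hc|].
split; first exact: hc.
move=> k b; split; first by apply: filterE => v; have [] := rderive_coord j v (axis k b).
apply: germ_C_eq (germ_C_cst m (axis k b 0 j) u); apply: filterE => v.
by have [_ ->] := rderive_coord j v (axis k b).
Qed.

Lemma germ_CD m f g u : germ_C m f u -> germ_C m g u ->
  germ_C m (fun w => f w + g w) u.
Proof.
elim: m f g => [|m ih] f g [h1 h2] [k1 k2].
  by split; [apply: filterS2 h1 k1 => v; exact: continuousC_D|].
split; first by apply: filterS2 h1 k1 => v; exact: continuousC_D.
move=> j b; have [h3 h4] := h2 j b; have [k3 k4] := k2 j b; split.
  by apply: filterS2 h3 k3 => v h k; have [] := rderiveD h k.
apply: germ_C_eq (ih _ _ h4 k4); apply: filterS2 h3 k3 => v h k.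
by have [_ ->] := rderiveD h k.
Qed.

Lemma germ_CM m f g u : germ_C m f u -> germ_C m g u ->
  germ_C m (fun w => f w * g w) u.
Proof.
elim: m f g => [|m ih] f g hf hg.
  move: hf hg => [h1 _] [k1 _].
  by split; [apply: filterS2 h1 k1 => v; exact: continuousC_M|].
have h5 := germ_C_le hf; have k5 := germ_C_le hg; move: hf hg => [h1 h2] [k1 k2].
split; first by apply: filterS2 h1 k1 => v; exact: continuousC_M.
move=> j b; have [h3 h4] := h2 j b; have [k3 k4] := k2 j b; split.
  by apply: filterS2 h3 k3 => v h k; have [] := rderiveM h k.
apply: germ_C_eq (germ_CD (ih _ _ h4 k5) (ih _ _ h5 k4)).
by apply: filterS2 h3 k3 => v h k; have [_ ->] := rderiveM h k.
Qed.

Lemma germ_C_conj m f u : germ_C m f u -> germ_C m (fun w => (f w)^*) u.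
Proof.
elim: m f => [|m ih] f [h1 h2].
  by split; [apply: filterS h1 => v; exact: continuousC_conj|].
split; first by apply: filterS h1 => v; exact: continuousC_conj.
move=> j b; have [h3 h4] := h2 j b; split.
  by apply: filterS h3 => v h; have [] := rderive_conj h.
apply: germ_C_eq (ih _ h4); apply: filterS h3 => v h.
by have [_ ->] := rderive_conj h.
Qed.

Lemma germ_CN m f u : germ_C m f u -> germ_C m (fun w => - f w) u.
Proof.
move=> h; apply: germ_C_eq (germ_CM (germ_C_cst m (-1) u) h).
by apply: filterE => v; rewrite mulN1r.
Qed.

Lemma continuous_neq0_near f u : {for u, continuous f} -> f u != 0 ->
  \forall v \near u, f v != 0.
Proof.
move=> /continuousCP h fu0; have a0 : 0 < absC (f u).
  by rewrite lt_neqAle absC_ge0 andbT eq_sym; apply: contra fu0 => /eqP/absC_eq0 ->.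
apply: filterS (h _ a0) => v; apply: contraTneq => ->.
by rewrite sub0r absCN ltxx.
Qed.

Lemma germ_CV m f u : f u != 0 -> germ_C m f u -> germ_C m (fun w => (f w)^-1) u.
Proof.
move=> fu0; elim: m f fu0 => [|m ih] f fu0 hf.
  have nf := continuous_neq0_near (germ_C_continuous hf) fu0; case: hf => h1 _.
  by split; [apply: filterS2 h1 nf => v h k; exact: continuousC_V|].
have nf := continuous_neq0_near (germ_C_continuous hf) fu0.
have h5 := ih _ fu0 (germ_C_le hf); move: hf => [h1 h2].
split; first by apply: filterS2 h1 nf => v h k; exact: continuousC_V.
move=> j b; have [h3 h4] := h2 j b; split.
  by apply: filterS2 h3 nf => v h k; exact: rderivableV.
apply: germ_C_eq (germ_CM (germ_CN h4) (germ_CM h5 h5)).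
by apply: filterS3 h3 nf (near_near nf) => v h k k'; rewrite rderiveV.
Qed.

Lemma germ_C_sum m (I : Type) (r : seq I) (F : I -> 'rV[C R]_n -> C R) u :
  (forall i, germ_C m (F i) u) -> germ_C m (fun w => \sum_(i <- r) F i w) u.
Proof.
move=> h; elim: r => [|i r ih].
  apply: germ_C_eq (germ_C_cst m 0 u).
  by apply: filterE => w; rewrite big_nil.
apply: germ_C_eq (germ_CD (h i) ih).
by apply: filterE => w; rewrite big_cons.
Qed.

Lemma germ_C_prod m (I : Type) (r : seq I) (F : I -> 'rV[C R]_n -> C R) u :
  (forall i, germ_C m (F i) u) -> germ_C m (fun w => \prod_(i <- r) F i w) u.
Proof.
move=> h; elim: r => [|i r ih].
  apply: germ_C_eq (germ_C_cst m 1 u).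
  by apply: filterE => w; rewrite big_nil.
apply: germ_C_eq (germ_CM (h i) ih).
by apply: filterE => w; rewrite big_cons.
Qed.

Lemma germ_C_dz m f u j : germ_C m.+1 f u -> germ_C m (dz j f) u.
Proof.
move=> [_ h]; have [_ h1] := h j false; have [_ h2] := h j true.
exact: germ_CM (germ_C_cst _ _ _) (germ_CD h1 (germ_CN (germ_CM (germ_C_cst _ _ _) h2))).
Qed.

Lemma germ_C_dzb m f u j : germ_C m.+1 f u -> germ_C m (dzb j f) u.
Proof.
move=> [_ h]; have [_ h1] := h j false; have [_ h2] := h j true.
exact: germ_CM (germ_C_cst _ _ _) (germ_CD h1 (germ_CM (germ_C_cst _ _ _) h2)).
Qed.

End Closure.

End GermClosure.

(** * Composition of germs and symmetry of second derivatives *)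

Section GermComposition.
Context {R : realType}.

(** Induction on the order: by the chain rule a partial derivative of [f \o g] is a sum of products
    of first derivatives of [g], their conjugates, and Wirtinger derivatives of [f] composed with
    [g], all of order one less. *)
Lemma germ_C_comp k m n (f : 'rV[C R]_n -> C R) (g : 'rV[C R]_m -> 'rV[C R]_n) u :
  germ_C k f (g u) -> (forall i, germ_C k (fun w => g w 0 i) u) ->
  germ_C k (f \o g) u.
Proof.
have pull (P : set 'rV[C R]_n) : (forall i, germ_C 0 (fun w => g w 0 i) u) ->
    (\forall v \near g u, P v) -> \forall w \near u, P (g w).
  move=> hg; have hc : {for u, continuous g}.
    by apply/continuousVP => i; exact: germ_C_continuous (hg i).
  exact: hc.
have cont (h : 'rV[C R]_n -> C R) : (forall i, germ_C 0 (fun w => g w 0 i) u) ->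
    (\forall v \near g u, {for v, continuous h}) ->
    \forall w \near u, {for w, continuous (h \o g)}.
  move=> hg hh.
  have hcg : \forall w \near u, forall i, {for w, continuous (fun x => g x 0 i)}.
    have hcg1 i : \forall w \near u, {for w, continuous (fun x => g x 0 i)}.
      by have [] := hg i.
    exact: filter_forall hcg1.
  apply: filterS2 (pull _ hg hh) hcg => w k1 /continuousVP k2.
  exact: continuous_comp.
elim: k f => [|k ih] f hf hg.
  by split; [apply: cont => //; case: hf => h _; exact: h|].
have hg0 i : germ_C 0 (fun w => g w 0 i) u by exact: germ_C_le0 (hg i).
split; first by apply: cont => //; case: hf => h _; exact: h.
have hg' i : germ_C k (fun w => g w 0 i) u by exact: germ_C_le.
have hf1 : \forall v \near g u, germ_C 1 f v.
  apply: germ_C_near; elim: (k) (hf) => // k' ihk /germ_C_le; exact: ihk.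
move=> j b.
have hgd : \forall w \near u, forall i, rderivable (fun x => g x 0 i) w (axis j b).
  have hgd1 i : \forall w \near u, rderivable (fun x => g x 0 i) w (axis j b).
    by have [_ /(_ j b)[]] := hg i.
  exact: filter_forall hgd1.
have hd : \forall w \near u, rderivable (f \o g) w (axis j b) /\
  rderive (axis j b) (f \o g) w =
    \sum_i (dz i f (g w) * rderive (axis j b) (fun x => g x 0 i) w +
            dzb i f (g w) * (rderive (axis j b) (fun x => g x 0 i) w)^*).
  by apply: filterS2 (pull _ hg0 hf1) hgd => w; exact: rderive_comp.
split; first by apply: filterS hd => w [].
have hgi i : germ_C k (rderive (axis j b) (fun x => g x 0 i)) u.
  by have [_ /(_ j b)[]] := hg i.
apply: germ_C_eq (_ : germ_C k (fun w =>
    \sum_i (dz i f (g w) * rderive (axis j b) (fun x => g x 0 i) w +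
            dzb i f (g w) * (rderive (axis j b) (fun x => g x 0 i) w)^*)) u).
  by apply: filterS hd => w [_ ->].
apply: germ_C_sum => i; apply: germ_CD; apply: germ_CM => //.
- exact: ih (germ_C_dz i hf) hg'.
- exact: ih (germ_C_dzb i hf) hg'.
- exact: germ_C_conj.
Qed.

(** The second difference is the increment along [v] of [Fh x = f (x + h w) - f x]. The derivative
    of [Fh] along [v] is an increment of [rderive v f] along [w], which strict differentiability
    compares with [h] times the mixed derivative, uniformly in the base point. *)
Lemma second_difference n (f : 'rV[C R]_n -> C R) (u v w : 'rV[C R]_n) (e : R) :
  absV v = 1 -> absV w = 1 -> (\forall x \near u, rderivable f x v) ->
  germ_C 1 (rderive v f) u -> 0 < e ->
  \forall h \near (0 : R),
   absC (f (u + rc h *: v + rc h *: w) - f (u + rc h *: v) - (f (u + rc h *: w) - f u)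
      - rc h * (rc h * rderive w (rderive v f) u)) <= 2 * (e * `|h|) * `|h|.
Proof.
move=> v1 w1 /nbhsVP[r r0 hr] hfv e0.
have [_ Lw] := germ_C1_rderive w hfv.
have [d d0 hd] := germ_C1_sdiff hfv e0.
have : \forall h \near (0 : R), `|h| + `|h| < Num.min d r.
  have m0 : 0 < Num.min d r by rewrite lt_min d0.
  apply/nbhs_ballP; exists (Num.min d r / 2); first by rewrite /= divr_gt0.
  move=> h; rewrite -ball_normE /= sub0r normrN; lra.
apply: filterS => h; rewrite lt_min => /andP[hd1 hr1].
pose Fh x := f (x + rc h *: w) - f x.
change (absC (Fh (u + rc h *: v) - Fh u - rc h * (rc h * rderive w (rderive v f) u))
   <= 2 * (e * `|h|) * `|h|).
apply: mvt_line => s hs.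
have n1 : absV (u + rc s *: v - u) <= `|h|.
  by rewrite addrAC subrr add0r absVZ v1 mulr1.
have n2 : absV (u + rc s *: v + rc h *: w - u) <= `|h| + `|h|.
  rewrite addrAC (le_trans (absVD _ _)) // lerD //.
  by rewrite absVZ w1 mulr1.
have h0 := normr_ge0 h.
have le_h2 : `|h| <= `|h| + `|h| by rewrite lerDl.
have d1 : rderivable f (u + rc s *: v) v.
  by apply: hr; exact: le_lt_trans (le_trans n1 le_h2) hr1.
have d2 : rderivable f (u + rc s *: v + rc h *: w) v.
  by apply: hr; exact: le_lt_trans n2 hr1.
have {n2}n2 := le_lt_trans n2 hd1.
have {n1}n1 := le_lt_trans (le_trans n1 le_h2) hd1.
move: (u + rc s *: v) d1 d2 n1 n2 => x d1 d2 n1 n2.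
have /rderive_cderiv c2 := d2; have /rderive_cderiv c1 := d1.
have c3 : cderiv (fun t => Fh (x + rc t *: v))
    (rderive v f (x + rc h *: w) - rderive v f x).
  have := cderivD c2 (cderivM (cderiv_cst (-1)) c1).
  rewrite mul0r add0r mulN1r; apply: cderiv_near.
  by apply: filterE => t; rewrite mulN1r /Fh addrAC.
split; first by apply/rderivableP; eexists; exact: c3.
rewrite (cderiv_rderive c3).
have := hd (x + rc h *: w) x n2 n1.
have -> : x + rc h *: w - x = rc h *: w by rewrite addrAC subrr add0r.
by rewrite differentialZ -Lw absVZ w1 mulr1.
Qed.

Lemma clairaut n (f : 'rV[C R]_n -> C R) u (i j : 'I_n) (a b : bool) :
  germ_C 2 f u ->
  rderive (axis j b) (rderive (axis i a) f) u = rderive (axis i a) (rderive (axis j b) f) u.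
Proof.
move=> hf.
have key k c l d (e : R) (e0 : 0 < e) := second_difference (absV_axis k c) (absV_axis l d)
  (hf.2 k c).1 (hf.2 k c).2 e0.
apply/eqP; rewrite -subr_eq0; apply/eqP/absC_eq0/eqP; rewrite eq_le absC_ge0 andbT.
apply/ler_addgt0Pl => e e0; rewrite addr0.
(* Two errors of 2 (e/4) |h|^2 add up to e |h|^2. *)
have e4 : 0 < e / 4 by lra.
have h1 := key i a j b _ e4; have h2 := key j b i a _ e4.
move: (axis i a) (axis j b) h1 h2 => v w h1 h2.
have h3 : \forall h \near (0 : R)^', h != 0 by exact: nbhs_dnbhs_neq.
have : \forall h \near (0 : R)^', absC (rderive w (rderive v f) u - rderive v (rderive w f) u) <= e.
  apply: filterS3 h3 (nbhs_dnbhs h1) (nbhs_dnbhs h2) => h h0 k1 k2.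
  (* The second difference is symmetric in the two directions, so it approximates both mixed
     derivatives. *)
  rewrite [u + rc h *: w + rc h *: v]addrAC in k2.
  move: k1 k2; move: (f _) (f _) (f _) (f _) => x1 x2 x3 x4.
  set A := rderive w _ u; set B := rderive v _ u; set t := rc h => k1 k2.
  have hh : 0 < `|h| * `|h| by rewrite mulr_gt0 // normr_gt0.
  rewrite -(ler_pM2l hh) -mulrA -!absCMr.
  have -> : t * (t * (A - B)) =
      (x4 - x2 - (x3 - x1) - t * (t * B)) - (x4 - x3 - (x2 - x1) - t * (t * A)) by ring.
  apply: le_trans (absCD _ _) _; rewrite absCN; apply: le_trans (lerD k2 k1) _.
  by rewrite le_eqVlt; apply/orP; left; apply/eqP; field.
by move=> /filter_ex[].
Qed.

End GermComposition.

(** * Wirtinger derivatives *)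

(* Locked, since conversion problems between distinct derivatives diverge. *)
HB.lock Definition wd (R : realType) n (b : bool) (j : 'I_n) (f : 'rV[C R]_n -> C R)
    (u : 'rV[C R]_n) : C R :=
  if b then dzb j f u else dz j f u.

Section Wirtinger.
Context {R : realType}.

Lemma dz_wd n (j : 'I_n) (f : 'rV[C R]_n -> C R) u : dz j f u = wd false j f u.
Proof. by rewrite wd.unlock. Qed.

Lemma dzb_wd n (j : 'I_n) (f : 'rV[C R]_n -> C R) u : dzb j f u = wd true j f u.
Proof. by rewrite wd.unlock. Qed.

Lemma wdE n b (j : 'I_n) (f : 'rV[C R]_n -> C R) u : wd b j f u =
  2^-1 * (rderive (axis j false) f u + (if b then 'i else - 'i) * rderive (axis j true) f u).
Proof. by rewrite wd.unlock; case: b; rewrite /dz /dzb ?mulNr. Qed.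

Section Rules.
Context {n : nat}.
Implicit Types (f g : 'rV[C R]_n -> C R) (u v : 'rV[C R]_n) (j : 'I_n).

Lemma wd_eq b j f g u : germ_C 1 f u -> (\forall v \near u, f v = g v) ->
  wd b j g u = wd b j f u.
Proof.
move=> hf h; rewrite !wdE.
have [_ ->] := rderivable_near h (germ_C1_rderive (axis j false) hf).1.
by have [_ ->] := rderivable_near h (germ_C1_rderive (axis j true) hf).1.
Qed.

Lemma wd_cst b j (c : C R) u : wd b j (fun=> c) u = 0.
Proof.
rewrite wdE; have [_ ->] := rderive_cst c u (axis j false).
by have [_ ->] := rderive_cst c u (axis j true); rewrite mulr0 addr0 mulr0.
Qed.

Lemma wdD b j f g u : germ_C 1 f u -> germ_C 1 g u ->
  wd b j (fun v => f v + g v) u = wd b j f u + wd b j g u.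
Proof.
move=> hf hg; rewrite !wdE.
have [_ ->] := rderiveD (germ_C1_rderive (axis j false) hf).1 (germ_C1_rderive (axis j false) hg).1.
have [_ ->] := rderiveD (germ_C1_rderive (axis j true) hf).1 (germ_C1_rderive (axis j true) hg).1.
move: (rderive _ f u) (rderive _ f u) (rderive _ g u) (rderive _ g u) (if b then _ else _).
by move=> x1 x2 x3 x4 z; ring.
Qed.

Lemma wdM b j f g u : germ_C 1 f u -> germ_C 1 g u ->
  wd b j (fun v => f v * g v) u = wd b j f u * g u + f u * wd b j g u.
Proof.
move=> hf hg; rewrite !wdE.
have [_ ->] := rderiveM (germ_C1_rderive (axis j false) hf).1 (germ_C1_rderive (axis j false) hg).1.
have [_ ->] := rderiveM (germ_C1_rderive (axis j true) hf).1 (germ_C1_rderive (axis j true) hg).1.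
move: (rderive _ f u) (rderive _ f u) (rderive _ g u) (rderive _ g u) (if b then _ else _).
by move=> x1 x2 x3 x4 z; ring.
Qed.

Lemma wd_conj b j f u : germ_C 1 f u ->
  wd b j (fun v => (f v)^*) u = (wd (~~ b) j f u)^*.
Proof.
move=> hf; rewrite !wdE.
have [_ ->] := rderive_conj (germ_C1_rderive (axis j false) hf).1.
have [_ ->] := rderive_conj (germ_C1_rderive (axis j true) hf).1.
rewrite rmorphM rmorphD rmorphM /= fmorphV rmorph_nat.
by case: b => /=; rewrite ?rmorphN /= conjCi ?opprK.
Qed.

Lemma wd_coord b j i u : wd b j (fun v => v 0 i) u = ((~~ b) && (j == i))%:R.
Proof.
rewrite wdE; have [_ ->] := rderive_coord i u (axis j false).
have [_ ->] := rderive_coord i u (axis j true).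
rewrite /axis !mxE eqxx /= eq_sym; case: (j == i); rewrite ?andbF ?andbT /=.
  rewrite !mulr1; case: b => /=; rewrite ?mulNr -expr2 sqrCi ?opprK ?subrr ?mulr0 //.
  by rewrite -[1 + 1]/2%:R mulVf // pnatr_eq0.
by rewrite !mulr0 addr0 mulr0.
Qed.

Lemma wd_sum b j (I : Type) (r : seq I) (F : I -> 'rV[C R]_n -> C R) u :
  (forall i, germ_C 1 (F i) u) ->
  wd b j (fun v => \sum_(i <- r) F i v) u = \sum_(i <- r) wd b j (F i) u.
Proof.
move=> h; elim: r => [|i r ih].
  rewrite big_nil -[RHS](wd_cst b j 0 u); apply: wd_eq; first exact: germ_C_cst.
  by apply: filterE => v; rewrite big_nil.
rewrite big_cons -ih -wdD; [|exact: h|exact: germ_C_sum].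
apply: wd_eq; first by apply: germ_CD; [exact: h|exact: germ_C_sum].
by apply: filterE => v; rewrite big_cons.
Qed.

Lemma germ_C_wd m b j f u : germ_C m.+1 f u -> germ_C m (wd b j f) u.
Proof. by rewrite wd.unlock; case: b; [exact: germ_C_dzb|exact: germ_C_dz]. Qed.

Lemma wdC a b i j f u : germ_C 2 f u -> wd a i (wd b j f) u = wd b j (wd a i f) u.
Proof.
have key c k d l : germ_C 2 f u -> wd c k (wd d l f) u =
    2^-1 * (2^-1 * (rderive (axis k false) (rderive (axis l false) f) u +
      (if d then 'i else - 'i) * rderive (axis k false) (rderive (axis l true) f) u) +
     (if c then 'i else - 'i) * (2^-1 * (rderive (axis k true) (rderive (axis l false) f) u +
      (if d then 'i else - 'i) * rderive (axis k true) (rderive (axis l true) f) u))).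
  move=> hf.
  have h0 := (hf.2 l false).2; have h1 := (hf.2 l true).2.
  rewrite wdE; set z := (if d then _ else _).
  have r b' : rderive (axis k b') (wd d l f) u = 2^-1 *
      (rderive (axis k b') (rderive (axis l false) f) u +
       z * rderive (axis k b') (rderive (axis l true) f) u).
    pose g v := 2^-1 * (rderive (axis l false) f v + z * rderive (axis l true) f v).
    have -> : wd d l f = g by apply/funext => v; exact: wdE.
    have d0 := (germ_C1_rderive (axis k b') h0).1.
    have d1 := (germ_C1_rderive (axis k b') h1).1.
    have [e1 e1'] := rderiveM (rderive_cst z u (axis k b')).1 d1.
    have [e2 e2'] := rderiveD d0 e1.
    have [e3 e3'] := rderiveM (rderive_cst 2^-1 u (axis k b')).1 e2.
    rewrite /g e3' e2' e1' (rderive_cst 2^-1 u (axis k b')).2 (rderive_cst z u (axis k b')).2.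
    by rewrite !mul0r !add0r.
  by rewrite !r.
move=> hf.
(* The second partial derivatives are hidden behind an abstract symmetric family, leaving a
   polynomial identity. *)
have [D hD hs] : exists2 D : bool -> 'I_n -> bool -> 'I_n -> C R,
   (forall c k d l, wd c k (wd d l f) u =
      2^-1 * (2^-1 * (D false k false l + (if d then 'i else - 'i) * D false k true l) +
     (if c then 'i else - 'i) *
        (2^-1 * (D true k false l + (if d then 'i else - 'i) * D true k true l)))) &
   forall c k d l, D c k d l = D d l c k.
  exists (fun c k d l => rderive (axis k c) (rderive (axis l d) f) u) => c k d l.
    exact: key.
  exact: clairaut.
rewrite (hD a i b j) (hD b j a i) (hs false j false i) (hs false j true i)
  (hs true j false i) (hs true j true i).
by move: (if a then _ else _) (if b then _ else _) => x y; ring.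
Qed.

End Rules.

Lemma wd_comp m n b j (f : 'rV[C R]_n -> C R) (g : 'rV[C R]_m -> 'rV[C R]_n) u :
  germ_C 1 f (g u) -> (forall i, germ_C 1 (fun w => g w 0 i) u) ->
  wd b j (f \o g) u = \sum_i (dz i f (g u) * wd b j (fun w => g w 0 i) u +
     dzb i f (g u) * wd b j (fun w => (g w 0 i)^*) u).
Proof.
move=> hf hg.
have hd v i := (germ_C1_rderive v (hg i)).1.
have hc v i := rderive_conj (hd v i).
rewrite wdE (rderive_comp hf (hd _)).2 (rderive_comp hf (hd _)).2.
rewrite [_ * \sum_i _]mulr_sumr -big_split mulr_sumr; apply: eq_bigr => i _ /=.
rewrite !wdE !(hc _ i).2.
move: (rderive _ _ u) (rderive _ _ u) (dz i f _) (dzb i f _) (if b then _ else _).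
move=> x1 x2 x3 x4 z; ring.
Qed.

Section Smooth.
Context {n : nat}.
Implicit Types (f g : 'rV[C R]_n -> C R) (u v : 'rV[C R]_n) (j : 'I_n).

Lemma smooth_wd b j f u : smooth f u -> smooth (wd b j f) u.
Proof. by move=> h m; exact: germ_C_wd. Qed.
Lemma smooth_cst (c : C R) u : smooth (fun=> c) u.
Proof. by move=> m; exact: germ_C_cst. Qed.
Lemma smooth_coord j u : smooth (fun v : 'rV[C R]_n => v 0 j) u.
Proof. by move=> m; exact: germ_C_coord. Qed.
Lemma smoothM f g u : smooth f u -> smooth g u -> smooth (fun v => f v * g v) u.
Proof. by move=> hf hg m; exact: germ_CM. Qed.
Lemma smooth_conj f u : smooth f u -> smooth (fun v => (f v)^*) u.
Proof. by move=> hf m; exact: germ_C_conj. Qed.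
Lemma smooth_sum (I : Type) (r : seq I) (F : I -> 'rV[C R]_n -> C R) u :
  (forall i, smooth (F i) u) -> smooth (fun v => \sum_(i <- r) F i v) u.
Proof. by move=> hf m; apply: germ_C_sum => i; exact: hf. Qed.
Lemma smooth_prod (I : Type) (r : seq I) (F : I -> 'rV[C R]_n -> C R) u :
  (forall i, smooth (F i) u) -> smooth (fun v => \prod_(i <- r) F i v) u.
Proof. by move=> hf m; apply: germ_C_prod => i; exact: hf. Qed.

Lemma germ_C_det m p (A : 'rV[C R]_n -> 'M[C R]_p) u :
  (forall k l : 'I_p, germ_C m (fun v => A v k l) u) -> germ_C m (fun v => \det (A v)) u.
Proof.
move=> h; apply: germ_C_sum => s; apply: germ_CM; first exact: germ_C_cst.
by apply: germ_C_prod => i; exact: h.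
Qed.

Lemma germ_C_invmx m p (A : 'rV[C R]_n -> 'M[C R]_p) u (i j : 'I_p) : A u \in unitmx ->
  (forall k l : 'I_p, germ_C m (fun v => A v k l) u) -> germ_C m (fun v => invmx (A v) i j) u.
Proof.
move=> Au h; have dA : \det (A u) != 0 by rewrite -unitfE -unitmxE.
have hd := germ_C_det h.
have nd := continuous_neq0_near (germ_C_continuous hd) dA.
(* Cramer's rule, valid near [u], where the determinant stays nonzero. *)
apply: (@germ_C_eq _ _ _ (fun v => (\det (A v))^-1 * \adj (A v) i j)).
  by apply: filterS nd => v dv; rewrite /invmx unitmxE unitfE dv !mxE.
apply: germ_CM; first exact: germ_CV.
apply: (@germ_C_eq _ _ _ (fun v => cofactor (A v) j i)).
  by apply: filterE => v; rewrite mxE.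
apply: germ_CM; first exact: germ_C_cst.
apply: germ_C_det => k l; apply: germ_C_eq (h (lift j k) (lift i l)).
by apply: filterE => v; rewrite !mxE.
Qed.

Lemma smooth_invmx p (A : 'rV[C R]_n -> 'M[C R]_p) u (i j : 'I_p) : A u \in unitmx ->
  (forall k l : 'I_p, smooth (fun v => A v k l) u) -> smooth (fun v => invmx (A v) i j) u.
Proof. by move=> Au h m; apply: germ_C_invmx => // k l; exact: h. Qed.

Lemma near_unitmx p (A : 'rV[C R]_n -> 'M[C R]_p) u : A u \in unitmx ->
  (forall k l : 'I_p, germ_C 0 (fun v => A v k l) u) -> \forall v \near u, A v \in unitmx.
Proof.
move=> Au h; have dA : \det (A u) != 0 by rewrite -unitfE -unitmxE.
apply: filterS (continuous_neq0_near (germ_C_continuous (germ_C_det h)) dA) => v.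
by rewrite unitmxE unitfE.
Qed.

End Smooth.

Lemma smooth_comp m n (f : 'rV[C R]_n -> C R) (g : 'rV[C R]_m -> 'rV[C R]_n) u :
  smooth f (g u) -> (forall i, smooth (fun w => g w 0 i) u) -> smooth (f \o g) u.
Proof. by move=> hf hg k; apply: germ_C_comp => // i; exact: hg. Qed.

End Wirtinger.

(** * The holomorphic inverse function theorem *)

Section NearIdentity.
Context {R : realType} {n : nat}.
Variables (G : 'rV[C R]_n -> 'rV[C R]_n) (a : 'rV[C R]_n) (r : R).
Hypothesis GP : forall u v, absV (u - a) < r -> absV (v - a) < r ->
  absV (G u - G v - (u - v)) <= 2^-1 * absV (u - v).

Lemma near_identity_expand u v : absV (u - a) < r -> absV (v - a) < r ->
  absV (u - v) <= 2 * absV (G u - G v).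
Proof.
move=> hu hv; have h1 := GP hu hv.
have h2 := absVBD (G u - G v) (u - v) 0; rewrite !subr0 in h2.
rewrite absVB in h1; move: h1 h2.
move: (absV (u - v)) (absV (G u - G v)) (absV (u - v - _)) => x y z; lra.
Qed.

Lemma near_identity_lipschitz u v : absV (u - a) < r -> absV (v - a) < r ->
  absV (G u - G v) <= 2 * absV (u - v).
Proof.
move=> hu hv; have h1 := GP hu hv.
have h2 := absVBD (u - v) (G u - G v) 0; rewrite !subr0 in h2.
have h3 := absV_ge0 (u - v); move: h1 h2 h3.
move: (absV (u - v)) (absV (G u - G v)) (absV (G u - G v - _)) => x y z; lra.
Qed.

(** [Q] is a product of closed squares of half side [e], each the continuous image of a compact
    square of R^2; a coordinate in such a square has l^1 norm at most 2e. *)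
Lemma compact_box (c : 'rV[C R]_n) (e : R) : 0 < e ->
  exists2 Q : set 'rV[C R]_n, compact Q &
    (forall v, Q v -> absV (v - c) <= n%:R * (2 * e)) /\
    (forall v, absV (v - c) <= e -> Q v).
Proof.
move=> e0.
pose box (z : C R) : set (C R) :=
  (fun p : R * R => z + (rc p.1 + 'i * rc p.2)) @` (`[- e, e] `*` `[- e, e])%classic.
have cbox z : compact (box z).
  apply: continuous_compact; last by apply: compact_setX; exact: segment_compact.
  apply: continuous_subspaceT => p S /nbhsCP[d d0 hS].
  change (\forall q \near p, S (z + (rc q.1 + 'i * rc q.2))).
  apply/nbhs_ballP; exists (d / 2) => /=; first by rewrite divr_gt0.
  move=> q [/= h1 h2]; apply: hS.
  move: h1 h2; rewrite -!ball_normE /= distrC => h1; rewrite distrC => h2.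
  have -> : z + (rc q.1 + 'i * rc q.2) - (z + (rc p.1 + 'i * rc p.2)) =
    (rc q.1 - rc p.1) + 'i * (rc q.2 - rc p.2) by ring.
  rewrite /absC !ReIm !(mul0r, mul1r, subr0, addr0, add0r, oppr0); lra.
exists [set v | forall i, box (c 0 i) (v ord0 i)].
  exact: (@rV_compact _ n (fun i => box (c 0 i))).
split=> v hv.
  rewrite mulr_natl -[X in _ <= _ *+ X]card_ord -sumr_const; apply: ler_sum => j _.
  have [p [/= h1 h2] hp] := hv j.
  have {}hp : v 0 j = c 0 j + (rc p.1 + 'i * rc p.2) := esym hp.
  rewrite !mxE hp.
  move: h1 h2; rewrite !in_itv /= -!ler_norml => h1 h2.
  have -> : c 0 j + (rc p.1 + 'i * rc p.2) - c 0 j = rc p.1 + 'i * rc p.2 by ring.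
  rewrite /absC !ReIm !(mul0r, mul1r, subr0, addr0, add0r, oppr0); lra.
move=> j; have hj := le_trans (absC_le_absV (v - c) j) hv.
rewrite !mxE in hj; move: hj; move: (v 0 j) (c 0 j) => x y hj.
exists (cRe (x - y), cIm (x - y)); last by rewrite /= -rc_ReIm addrC subrK.
move: hj; rewrite /absC => hj.
have := normr_ge0 (cRe (x - y)); have := normr_ge0 (cIm (x - y)) => h1 h2.
by split; rewrite /= in_itv /= -ler_norml; lra.
Qed.

(** In place of a fixed point iteration, |G - y| is minimized over a compact box around [u0]. A
    positive minimum could be lowered by a small move along [y - G um], since [G] follows the move
    up to half its length. *)
Lemma near_identity_open u0 : absV (u0 - a) < r ->
  \forall y \near G u0, exists2 u, absV (u - a) < r & G u = y.
Proof.
move=> hu0.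
pose s := r - absV (u0 - a); have s0 : 0 < s by rewrite subr_gt0.
(* The box lies within distance 2ne < s of [u0], hence in the ball where [GP] applies. *)
pose e := s / (2 * n.+1%:R); have e0 : 0 < e by rewrite divr_gt0 // mulr_gt0.
have [Q cQ [Q1 Q2]] := compact_box u0 e0.
have Qr v : Q v -> absV (v - a) < r.
  move=> /Q1 hv; apply: le_lt_trans (absVBD u0 v a) _.
  suff : n%:R * (2 * e) < s by rewrite /s; move: (absV (v - u0)) (absV (u0 - a)) hv => x y; lra.
  have -> : n%:R * (2 * e) = s * (n%:R / n.+1%:R).
    have : n.+1%:R != 0 :> R by rewrite pnatr_eq0.
    by rewrite /e; move: (n.+1%:R : R) (n%:R : R) => x y x0; field.
  by rewrite gtr_pMr // ltr_pdivrMr // mul1r ltr_nat.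
(* The minimizer satisfies |um - u0| <= 2 |G um - G u0| <= 4 |G u0 - y| < e, which leaves room for a
   move inside the box. *)
apply/nbhsVP; exists (e / 4); first by rewrite divr_gt0.
move=> y hy.
pose f v := absV (G v - y).
have cf : {within Q, continuous f}.
  apply: continuous_in_subspaceT => v; rewrite inE => Qv.
  move=> S /nbhs_ballP[d /= d0 hS]; change (\forall w \near v, S (f w)).
  have : \forall w \near v, absV (w - v) < Num.min (d / 2) (r - absV (v - a)).
    apply/nbhsVP; exists (Num.min (d / 2) (r - absV (v - a))) => //.
    by rewrite lt_min divr_gt0 // subr_gt0 Qr.
  apply: filterS => w; rewrite lt_min => /andP[h1 h2]; apply: hS.
  have hw : absV (w - a) < r.
    by apply: le_lt_trans (absVBD v w a) _; rewrite -ltrBrDr.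
  have h3 := near_identity_lipschitz hw (Qr _ Qv).
  have h4 := absVBD (G w) (G v) y; have h5 := absVBD (G v) (G w) y.
  rewrite [absV (G v - G w)]absVB in h4.
  rewrite -ball_normE /= /f ltr_norml; move: h1 h3 h4 h5.
  move: (absV (w - v)) (absV (G w - G v)) (absV (G v - y)) (absV (G w - y)) => x1 x2 x3 x4.
  by move=> *; apply/andP; split; lra.
have Qu0 : Q u0 by apply: Q2; rewrite subrr absV0 ltW.
have [um /set_mem Qum hmin] := compact_EVT_min (ex_intro _ _ Qu0) cQ cf.
have hum := Qr _ Qum.
exists um => //; apply/eqP; rewrite -subr_eq0; apply/eqP/absV_eq0/eqP.
rewrite eq_le absV_ge0 andbT leNgt; apply/negP => d0.
set d := absV (G um - y) in d0.
have h1 : absV (um - u0) < e.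
  have h2 := near_identity_expand hum hu0.
  have h3 := absVBD y (G um) (G u0); rewrite (absVB y (G u0)) in h3.
  have h4 := hmin u0 (mem_set Qu0); rewrite /f -/d in h4.
  rewrite absVB in hy; move: h2 h3 h4 hy; rewrite -/d.
  move: (absV (G um - G u0)) (absV (um - u0)) (absV (G u0 - y)) => x1 x2 x3; lra.
(* The move has length [t * d] and stays within [e] of [u0]; it brings the distance to [y] down to
   at most (1 - t/2) d. *)
pose t := Num.min 1 ((e - absV (um - u0)) / d).
have t0 : 0 < t by rewrite lt_min ltr01 divr_gt0 // subr_gt0.
have t1 : t <= 1 by rewrite ge_min lexx.
have td : t * d <= e - absV (um - u0) by rewrite -ler_pdivlMr // ge_min lexx orbT.
pose v := um + rc t *: (y - G um).
have vum : v - um = rc t *: (y - G um) by rewrite /v addrAC subrr add0r.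
have nvum : absV (v - um) = t * d by rewrite vum absVZ gtr0_norm // absVB.
have Qv : Q v.
  apply: Q2; apply: le_trans (absVBD um v u0) _; rewrite nvum.
  by move: td; move: (absV _) (t * d) => x1 x2; lra.
have h5 := hmin v (mem_set Qv); rewrite /f -/d in h5.
have h6 := GP (Qr _ Qv) hum; rewrite nvum in h6.
have h7 : G v - y = (G v - G um - (v - um)) + rc (t - 1) *: (y - G um).
  rewrite vum rcD scalerDl.
  have -> : rc (-1) *: (y - G um) = G um - y.
    by rewrite (_ : rc (-1) = -1) ?scaleN1r ?opprB //; apply: eq_ReIm; rewrite ?ReIm ?oppr0.
  by rewrite addrA subrK addrA subrK.
have h8 : absV (G v - y) <= 2^-1 * (t * d) + (1 - t) * d.
  rewrite h7; apply: le_trans (absVD _ _) _; apply: lerD h6 _.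
  by rewrite absVZ absVB -/d distrC ger0_norm // subr_ge0.
have h9 : 0 < t * d by rewrite mulr_gt0.
move: h5 h8 h9; rewrite mulrBl mul1r; move: (absV _) (t * d) => x1 x2; lra.
Qed.

End NearIdentity.

Section HolomorphicInverse.
Context {R : realType} {n : nat}.
Implicit Types (u v y : 'rV[C R]_n).

Lemma common_radius p (Q : 'I_p -> R -> Prop) :
  (forall i d d', d' <= d -> Q i d -> Q i d') ->
  (forall i, exists2 d, 0 < d & Q i d) -> exists2 d, 0 < d & forall i, Q i d.
Proof.
move=> mono; elim: p Q mono => [|p ih] Q mono h; first by exists 1 => // -[].
have [|i|d d0 hd] := ih (fun i => Q (lift ord0 i)); [by move=> i; exact: mono|exact: h|].
have [d' d0' hd'] := h ord0.
exists (Num.min d d'); first by rewrite lt_min d0.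
move=> i; case: (unliftP ord0 i) => [j ->|->].
  by apply: mono (hd j); rewrite ge_min lexx.
by apply: mono hd'; rewrite ge_min lexx orbT.
Qed.

(* The complex Jacobian acts on row vectors from the right. *)
Definition holo_jacobian m (H : 'rV[C R]_n -> 'rV[C R]_m) u : 'M[C R]_(n, m) :=
  \matrix_(l, i) wd false l (fun v => H v 0 i) u.

Lemma holo_differential m (H : 'rV[C R]_n -> 'rV[C R]_m) u v i :
  (forall j, wd true j (fun v => H v 0 i) u = 0) ->
  differential (fun v => H v 0 i) u v = (v *m holo_jacobian H u) 0 i.
Proof.
move=> h; rewrite differentialE mxE; apply: eq_bigr => j _.
by rewrite dz_wd dzb_wd h mul0r addr0 mxE mulrC.
Qed.

Lemma sdiff_mulmx m (H : 'rV[C R]_n -> 'rV[C R]_m) u (e : R) : 0 < e ->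
  (forall i, germ_C 1 (fun v => H v 0 i) u) ->
  (forall i j, wd true j (fun v => H v 0 i) u = 0) ->
  exists2 d : R, 0 < d & forall v w, absV (v - u) < d -> absV (w - u) < d ->
    absV (H v - H w - (v - w) *m holo_jacobian H u) <= e * absV (v - w).
Proof.
move=> e0 hs hh.
have em : 0 < e / m.+1%:R by rewrite divr_gt0.
have [|i|d d0 hd] := @common_radius m (fun i d => forall v w,
    absV (v - u) < d -> absV (w - u) < d ->
    absC (H v 0 i - H w 0 i - ((v - w) *m holo_jacobian H u) 0 i) <= e / m.+1%:R * absV (v - w)).
- move=> i d d' dd' h v w hv hw.
  by apply: h; [exact: lt_le_trans hv dd'|exact: lt_le_trans hw dd'].
- have [d d0 hd] := germ_C1_sdiff (hs i) em; exists d => // v w hv hw.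
  by rewrite -holo_differential //; exact: hd.
exists d => // v w hv hw.
apply: (@le_trans _ _ (\sum_(i < m) e / m.+1%:R * absV (v - w))).
  by apply: ler_sum => i _; have := hd i v w hv hw; rewrite !mxE.
rewrite sumr_const card_ord -[_ *+ m]mulr_natr mulrAC ler_wpM2r ?absV_ge0 //.
by rewrite mulrAC ler_pdivrMr // ler_wpM2l ?(ltW e0) // ler_nat.
Qed.

Variables (H : 'rV[C R]_n -> 'rV[C R]_n) (a : 'rV[C R]_n) (U : set 'rV[C R]_n).
Hypotheses (oU : open U) (Ua : U a)
  (sH : forall u i, U u -> smooth (fun v => H v 0 i) u)
  (hH : forall u i j, U u -> wd true j (fun v => H v 0 i) u = 0)
  (Ja : holo_jacobian H a \in unitmx).

(** Right multiplication by the inverse Jacobian at [a] makes [H] a perturbation of the identity, to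
    which the preceding estimates apply. *)
Lemma holo_inverse_ball : exists2 r : R, 0 < r &
  [/\ forall u, absV (u - a) < r -> U u,
      forall u, absV (u - a) < r -> holo_jacobian H u \in unitmx &
      forall u v, absV (u - a) < r -> absV (v - a) < r ->
        absV (H u *m invmx (holo_jacobian H a) - H v *m invmx (holo_jacobian H a) - (u - v)) <=
        2^-1 * absV (u - v)].
Proof.
set A := invmx _.
have [c c0 hc] := absV_mulmx A.
(* Multiplication by [A] enlarges the linearization error by at most [c], to 1/2. *)
have ec : 0 < (2 * c)^-1 by rewrite invr_gt0 mulr_gt0.
have [|i j|d1 d10 hd1] := sdiff_mulmx ec (H := H) (u := a); first by move=> i; exact: sH.
  exact: hH.
have /nbhsVP[d2 d20 hd2] : \forall u \near a, U u by exact: open_nbhs_nbhs.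
have /nbhsVP[d3 d30 hd3] : \forall u \near a, holo_jacobian H u \in unitmx.
  apply: near_unitmx => // k l.
  apply: germ_C_eq (germ_C_wd false k (sH l Ua 1)).
  by apply: filterE => v; rewrite mxE.
exists (Num.min d1 (Num.min d2 d3)); first by rewrite !lt_min d10 d20.
split=> [u|u|u v]; rewrite !lt_min.
- by move=> /and3P[_ h _]; exact: hd2.
- by move=> /and3P[_ _ h]; exact: hd3.
move=> /and3P[hu _ _] /and3P[hv _ _].
have -> : H u *m A - H v *m A - (u - v) = (H u - H v - (u - v) *m holo_jacobian H a) *m A.
  by rewrite [in RHS]mulmxBl mulmxK // mulmxBl.
apply: le_trans (hc _) _; apply: le_trans (ler_wpM2l (ltW c0) (hd1 u v hu hv)) _.
rewrite mulrA ler_wpM2r ?absV_ge0 //.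
by rewrite invfM mulrCA divff ?gt_eqF // mulr1.
Qed.

(** Smoothness of [K] bootstraps: its differential at [y] is the inverse Jacobian of [H] at [K y],
    so its partial derivatives are as regular as [K] itself. Holomorphy follows because this
    differential is complex linear. *)
Lemma holo_inverse : exists (V : set 'rV[C R]_n) (K : 'rV[C R]_n -> 'rV[C R]_n),
  [/\ open V, V a, V `<=` U, open (H @` V) &
      [/\ forall u, V u -> K (H u) = u,
      forall y i, (H @` V) y -> smooth (fun y => K y 0 i) y &
      forall y i j, (H @` V) y -> wd true j (fun y => K y 0 i) y = 0]].
Proof.
have [r r0 [rU rJ rG]] := holo_inverse_ball.
set A := invmx (holo_jacobian H a) in rG.
have Au : A \in unitmx by rewrite unitmx_inv.
pose G u := H u *m A.
have GP : forall u v, absV (u - a) < r -> absV (v - a) < r ->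
  absV (G u - G v - (u - v)) <= 2^-1 * absV (u - v) by exact: rG.
have [c c0 hc] := absV_mulmx A.
pose V := [set u | absV (u - a) < r].
have oV : open V.
  rewrite openE => u Vu; apply/nbhsVP; exists (r - absV (u - a)); first by rewrite subr_gt0.
  by move=> v hv; apply: le_lt_trans (absVBD u v a) _; rewrite -ltrBrDr.
have oHV : open (H @` V).
  rewrite openE => _ [u Vu <-].
  have /nbhsVP[e e0 he] := near_identity_open GP Vu.
  apply/nbhsVP; exists (e / c); first by rewrite divr_gt0.
  move=> y hy; have [|v Vv Gv] := he (y *m A).
    by rewrite -mulmxBl; apply: le_lt_trans (hc _) _; rewrite mulrC -ltr_pdivlMr.
  by exists v => //; rewrite -[LHS](mulmxK Au) -/(G v) Gv mulmxK.
have expand u v : V u -> V v -> absV (u - v) <= 2 * c * absV (H u - H v).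
  move=> Vu Vv; apply: le_trans (near_identity_expand GP Vu Vv) _.
  by rewrite -mulrA ler_wpM2l // /G -mulmxBl.
(* By [expand], [H] is injective on [V], so the chosen preimage is the only one; the default [a]
   occurs only off the image of [V]. *)
pose K y := xget a [set u | V u /\ H u = y].
have KH u : V u -> K (H u) = u.
  move=> Vu; have : (H @` V) (H u) by exists u.
  rewrite /K; case: xgetP => [v _ [Vv Hv] _|h _]; last by case: (h u).
  have := expand v u Vv Vu; rewrite Hv subrr absV0 mulr0 => h.
  by apply/eqP; rewrite -subr_eq0; apply/eqP/absV_eq0/eqP; rewrite eq_le h absV_ge0.
have KV y : (H @` V) y -> V (K y) /\ H (K y) = y.
  by move=> [u Vu <-]; rewrite KH.
have nHV y : (H @` V) y -> \forall z \near y, (H @` V) z by move=> h; exact: open_nbhs_nbhs.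
have Kexp y z : (H @` V) y -> (H @` V) z -> absV (K y - K z) <= 2 * c * absV (y - z).
  move=> /KV[Vy {2}<-] /KV[Vz {2}<-]; exact: expand.
have cK y i : (H @` V) y -> {for y, continuous (fun z => K z 0 i)}.
  move=> hy; apply/continuousCP => e e0.
  have : \forall z \near y, absV (z - y) < e / (2 * c).
    by apply/nbhsVP; exists (e / (2 * c)) => //; rewrite divr_gt0 // mulr_gt0.
  apply: filterS2 (nHV y hy) => z hz h.
  have := absC_le_absV (K z - K y) i; rewrite !mxE => /le_lt_trans; apply.
  apply: le_lt_trans (Kexp _ _ hz hy) _.
  by rewrite mulrC -ltr_pdivlMr // mulr_gt0.
have dK y v i : (H @` V) y ->
    cderiv (fun s => K (y + rc s *: v) 0 i) ((v *m invmx (holo_jacobian H (K y))) 0 i).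
  move=> hy; have [Vu Hu] := KV y hy.
  set u := K y in Vu Hu *.
  have Uu := rU _ Vu; have Ju := rJ _ Vu.
  set B := invmx _.
  have [b b0 hb] := absV_mulmx B.
  have vv0 : 0 <= absV v := absV_ge0 v.
  have v0 : 0 < absV v + 1 by rewrite ltr_wpDl.
  move=> e e0.
  (* Here [b] bounds the inverse Jacobian and [2 * c] is the Lipschitz constant of [K]; the added 1
     allows [v = 0]. *)
  pose e1 := e / (b * (2 * c * (absV v + 1))).
  have e10 : 0 < e1 by rewrite divr_gt0 // !mulr_gt0.
  have [|i' j'|d d0 hd] := sdiff_mulmx e10 (H := H) (u := u); first by move=> i'; exact: sH.
    exact: hH.
  have n1 : \forall s \near (0 : R), (H @` V) (y + rc s *: v) by exact: near_line (nHV y hy).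
  have n2 : \forall s \near (0 : R), absV (y + rc s *: v - y) < d / (2 * c).
    apply: (near_line v (P := fun z => absV (z - y) < d / (2 * c))).
    by apply/nbhsVP; exists (d / (2 * c)) => //; rewrite divr_gt0 // mulr_gt0.
  apply: filterS2 n1 n2 => s hs1 hs2.
  have [Vs Hs] := KV _ hs1.
  have k1 := Kexp _ _ hs1 hy.
  have k2 : absV (K (y + rc s *: v) - u) < d.
    by apply: le_lt_trans k1 _; rewrite mulrC -ltr_pdivlMr // mulr_gt0.
  have k3 := hd (K (y + rc s *: v)) u k2.
  rewrite subrr absV0 in k3; have {}k3 := k3 d0.
  rewrite Hs Hu [y + _ - y]addrAC subrr add0r in k3 k1.
  rewrite -/u in k1; rewrite absVZ in k1.
  rewrite rc0 scale0r addr0 -/u.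
  move: (K (y + rc s *: v)) k1 k3 => w k1 k3.
  (* As [H] takes the increment [w - u] to [s v], the error of [K] is minus the linearization error
     of [H] times the inverse Jacobian. *)
  have -> : w 0 i - u 0 i - rc s * (v *m B) 0 i = (- ((rc s *: v - (w - u) *m holo_jacobian H u) *m B)) 0 i.
    by rewrite mulmxBl mulmxK // -scalemxAl opprB !mxE.
  apply: le_trans (absC_le_absV _ i) _; rewrite absVN; apply: le_trans (hb _) _.
  apply: (@le_trans _ _ (b * (e1 * (2 * c * (`|s| * absV v))))).
    rewrite ler_wpM2l ?(ltW b0) //; apply: le_trans k3 _.
    by rewrite ler_wpM2l ?(ltW e10).
  have -> : b * (e1 * (2 * c * (`|s| * absV v))) = (e * `|s|) * (absV v / (absV v + 1)).
    rewrite /e1; move: (`|s|) (absV v) v0 c0 b0 => x z z0 c0' b0'; field.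
    by rewrite !gt_eqF.
  rewrite ler_piMr ?mulr_ge0 ?(ltW e0) // ler_pdivrMr // mul1r.
  by move: (absV v) => x; lra.
have rK y v i : (H @` V) y -> rderivable (fun z => K z 0 i) y v /\
    rderive v (fun z => K z 0 i) y = (v *m invmx (holo_jacobian H (K y))) 0 i.
  move=> hy; split; last exact: cderiv_rderive (dK y v i hy).
  by apply/rderivableP; eexists; exact: dK.
have sK m y i : (H @` V) y -> germ_C m (fun z => K z 0 i) y.
  elim: m y i => [|m ih] y i hy.
    by split; [apply: filterS (nHV y hy) => z hz; exact: cK|].
  split; first by apply: filterS (nHV y hy) => z hz; exact: cK.
  move=> j b; split.
    by apply: filterS (nHV y hy) => z hz; exact: (rK z (axis j b) i hz).1.
  apply: (@germ_C_eq _ _ _ (fun z => \sum_l (axis j b : 'rV[C R]_n) 0 l *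
      ((fun u => invmx (holo_jacobian H u) l i) \o K) z)).
    apply: filterS (nHV y hy) => z hz; rewrite (rK z (axis j b) i hz).2.
    by rewrite [RHS]mxE.
  apply: germ_C_sum => l; apply: germ_CM; first exact: germ_C_cst.
  have [Vy _] := KV y hy.
  apply: germ_C_comp => [|i']; last exact: ih.
  apply: germ_C_invmx; first exact: rJ.
  move=> k k'; apply: germ_C_eq (germ_C_wd false k (sH k' (rU _ Vy) m.+1)).
  by apply: filterE => z; rewrite mxE.
exists V, K; split=> //.
- by rewrite /V /= subrr absV0.
- split=> // [y i hy m|y i j hy]; first exact: sK.
(* The y-axis is 'i times the x-axis, so complex linearity leaves Y + 'i 'i Y = 0. *)
rewrite wdE !(rK y _ i hy).2 /axis scale1r -scalemxAl.
move: (delta_mx _ _ *m _) => Y; rewrite (_ : ('i *: Y) 0 i = 'i * Y 0 i); last by rewrite mxE.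
by rewrite mulrA -expr2 sqrCi mulN1r subrr mulr0.
Qed.

End HolomorphicInverse.

(** * Calculus in charts *)

Section ChartCalculus.
Context {R : realType} {X : topologicalType} {n : nat}.
Implicit Types (c d : chart R X n) (f g : X -> C R) (x y : X) (i j : 'I_n).

Lemma chart_imgK c u : is_chart c -> chart_img c u ->
  coord c (param c u) = u /\ dom c (param c u).
Proof. by move=> [_ _ _ _ pK] [x cx <-]; rewrite pK. Qed.

Lemma near_dom c x : is_chart c -> dom c x -> \forall y \near x, dom c y.
Proof. by move=> [oc _ _ _ _] cx; exact: open_nbhs_nbhs. Qed.

Lemma near_img c x : is_chart c -> dom c x -> \forall u \near coord c x, chart_img c u.
Proof. by move=> [_ oc _ _ _] cx; apply: open_nbhs_nbhs; split=> //; exists x. Qed.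

Lemma near_param c x (Q : set X) : is_chart c -> dom c x ->
  (\forall y \near x, Q y) -> \forall u \near coord c x, Q (param c u).
Proof.
move=> [_ _ _ cp pK] cx hQ; have /cp h : chart_img c (coord c x) by exists x.
by apply: h; rewrite pK.
Qed.

Lemma near_coord c x (Q : set 'rV[C R]_n) : is_chart c -> dom c x ->
  (\forall u \near coord c x, Q u) -> \forall y \near x, Q (coord c y).
Proof. by move=> [_ _ cc _ _] cx hQ; have h := cc x cx; exact: h. Qed.

Definition gC m c f x : Prop := germ_C m (fun u => f (param c u)) (coord c x).
Definition sm c f x : Prop := smooth (fun u => f (param c u)) (coord c x).
Definition wp (b : bool) c i f x : C R := wd b i (fun u => f (param c u)) (coord c x).

Lemma pd_wp c f i x : pd c f i x = wp false c i f x.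
Proof. exact: dz_wd. Qed.

Lemma pdb_wp c f i x : pdb c f i x = wp true c i f x.
Proof. exact: dzb_wd. Qed.

Lemma smooth_on_chart c f : is_chart c ->
  smooth_on (chart_img c) (fun u => f (param c u)) <-> forall x, dom c x -> sm c f x.
Proof.
move=> hc; have [_ oi _ _ _] := hc; split.
  by move=> /(smooth_onP _ oi) h x cx; apply: h; exists x.
by move=> h; apply/smooth_onP => // _ [x cx <-]; exact: h.
Qed.

Section OneChart.
Variables (c : chart R X n) (x : X).
Hypotheses (hc : is_chart c) (cx : dom c x).

Lemma gC_eq m f g : (\forall y \near x, f y = g y) -> gC m c f x -> gC m c g x.
Proof. by move=> h; apply: germ_C_eq; exact: near_param h. Qed.

Lemma sm_eq f g : (\forall y \near x, f y = g y) -> sm c f x -> sm c g x.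
Proof. by move=> h s m; exact: gC_eq h (s m). Qed.

Lemma wp_eq b i f g : gC 1 c f x -> (\forall y \near x, f y = g y) ->
  wp b c i g x = wp b c i f x.
Proof. by move=> h e; apply: wd_eq => //; exact: near_param e. Qed.

Lemma sm_wp b i f : sm c f x -> sm c (wp b c i f) x.
Proof.
move=> h; apply: smooth_eq (smooth_wd b i h).
by apply: filterS (near_img hc cx) => u hu; rewrite /wp (chart_imgK hc hu).1.
Qed.

Lemma wpC a b i j f : sm c f x -> wp a c i (wp b c j f) x = wp b c j (wp a c i f) x.
Proof.
move=> h.
have e (d : bool) (k : 'I_n) : \forall u \near coord c x,
    wd d k (fun u => f (param c u)) u = wp d c k f (param c u).
  by apply: filterS (near_img hc cx) => u hu; rewrite /wp (chart_imgK hc hu).1.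
by rewrite /wp (wd_eq a i (smooth_wd b j h 1) (e b j))
  (wd_eq b j (smooth_wd a i h 1) (e a i)); exact: wdC (h 2).
Qed.

Lemma sm_zc i : sm c (zc c i) x.
Proof.
apply: smooth_eq (smooth_coord i _).
by apply: filterS (near_img hc cx) => u hu; rewrite /zc (chart_imgK hc hu).1.
Qed.

Lemma wp_zc b i j : wp b c j (zc c i) x = ((~~ b) && (j == i))%:R.
Proof.
rewrite -(wd_coord b j i (coord c x)); apply: wd_eq; first exact: germ_C_coord.
by apply: filterS (near_img hc cx) => u hu; rewrite /zc (chart_imgK hc hu).1.
Qed.

Lemma wp_cst b i (a : C R) : wp b c i (fun=> a) x = 0.
Proof. exact: wd_cst. Qed.

Lemma wpD b i f g : gC 1 c f x -> gC 1 c g x ->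
  wp b c i (fun y => f y + g y) x = wp b c i f x + wp b c i g x.
Proof. exact: wdD. Qed.

Lemma wpM b i f g : gC 1 c f x -> gC 1 c g x ->
  wp b c i (fun y => f y * g y) x = wp b c i f x * g x + f x * wp b c i g x.
Proof.
move=> hf hg; have [_ _ _ _ pK] := hc.
by rewrite /wp (wdM b i hf hg) pK.
Qed.

Lemma wp_conj b i f : gC 1 c f x ->
  wp b c i (fun y => (f y)^*) x = (wp (~~ b) c i f x)^*.
Proof. exact: wd_conj. Qed.

Lemma wp_zbc b i j : wp b c j (zbc c i) x = (b && (j == i))%:R.
Proof.
rewrite [LHS](wp_conj b j (sm_zc i 1)) wp_zc negbK.
by case: (_ && _); rewrite ?rmorph1 ?rmorph0.
Qed.

End OneChart.

Definition smt c d x : Prop := forall i, sm c (zc d i) x.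

Section TwoCharts.
Variables (c d : chart R X n) (x : X).
Hypotheses (hc : is_chart c) (hd : is_chart d) (cx : dom c x) (dx : dom d x).
Hypothesis cd : smt c d x.

Lemma param_transition f : \forall u \near coord c x,
  f (param d (coord d (param c u))) = f (param c u).
Proof.
have [_ _ _ _ pK] := hd.
by apply: filterS (near_param hc cx (near_dom hd dx)) => u hu; rewrite pK.
Qed.

Lemma gC_transition m f : gC m d f x -> gC m c f x.
Proof.
move=> h; apply: (germ_C_eq (param_transition f)).
apply: (germ_C_comp (f := fun u => f (param d u)) (g := fun u => coord d (param c u))).
  by have [_ _ _ _ pK] := hc; rewrite pK.
by move=> i; exact: cd.
Qed.

Lemma sm_transition f : sm d f x -> sm c f x.
Proof. by move=> h m; exact: gC_transition (h m). Qed.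

Lemma wp_transition b i f : gC 1 d f x ->
  wp b c i f x = \sum_j (wp false d j f x * wp b c i (zc d j) x +
                         wp true d j f x * wp b c i (zbc d j) x).
Proof.
move=> h; have [_ _ _ _ pK] := hc.
have hf : germ_C 1 (fun u => f (param d u)) (coord d (param c (coord c x))) by rewrite pK.
have hg j : germ_C 1 (fun u => coord d (param c u) 0 j) (coord c x) by exact: cd.
have gt := germ_C_comp hf hg.
rewrite [LHS](wd_eq b i gt (param_transition f)) (wd_comp b i hf hg).
by apply: eq_bigr => j _; rewrite dz_wd dzb_wd pK.
Qed.

End TwoCharts.

Lemma smt_trans c d e x : is_chart c -> is_chart d -> dom c x -> dom d x ->
  smt c d x -> smt d e x -> smt c e x.
Proof. by move=> hc hd cx dx cd de i; exact: sm_transition (de i). Qed.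

Lemma sm_invmx c p (A : X -> 'M[C R]_p) x (i j : 'I_p) : is_chart c -> dom c x ->
  A x \in unitmx -> (forall k l, sm c (fun y => A y k l) x) ->
  sm c (fun y => invmx (A y) i j) x.
Proof.
move=> hc cx Ax h; apply: (smooth_invmx (A := fun u => A (param c u))) => //.
by have [_ _ _ _ pK] := hc; rewrite pK.
Qed.

Lemma near_unit_chart c p (A : X -> 'M[C R]_p) x : is_chart c -> dom c x ->
  A x \in unitmx -> (forall k l, sm c (fun y => A y k l) x) ->
  \forall y \near x, A y \in unitmx.
Proof.
move=> hc cx Ax h; have [_ _ _ _ pK] := hc.
have := @near_unitmx _ _ _ (fun u => A (param c u)) (coord c x).
rewrite pK // => /(_ Ax (fun k l => h k l 0)) /(near_coord hc cx) h1.
by apply: filterS2 h1 (near_dom hc cx) => y; rewrite /= => + cy; rewrite pK.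
Qed.

End ChartCalculus.

(** * Algebra of tensor bundles *)

Section TensorAlgebra.
Context {R : realType} {n : nat}.
Implicit Types (T O Q : 'M[C R]_n) (E : tbundle).

(** Functoriality. Exterior powers are encoded inside tensor powers, so the case [Ext] is the
    distributive law instead of a Cauchy-Binet formula. *)
Lemma induced_mul T T' O O' E (b a : idx n E) :
  induced (T *m T') (O *m O') b a = \sum_c induced T O b c * induced T' O' c a.
Proof.
elim: E b a => [b a|b a|E1 ih1 E2 ih2 [b1 b2] [a1 a2]|p E ih b a] /=; rewrite ?mxE //.
  rewrite ih1 ih2 big_distrlr /= pair_bigA /=.
  by apply: eq_bigr => -[c1 c2] _ /=; rewrite mulrACA.
under eq_bigr do rewrite ih.
rewrite bigA_distr_bigA /=; apply: eq_bigr => c _.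
by rewrite big_split.
Qed.

Lemma prod_eqb (I : finType) (J : eqType) (f g : {ffun I -> J}) :
  \prod_i (f i == g i)%:R = (f == g)%:R :> C R.
Proof.
have [->|fg] := eqVneq f g; first by rewrite big1 // => i _; rewrite eqxx.
have [i fgi] : exists i, f i != g i.
  apply/existsP; apply: contraR fg; rewrite negb_exists => /forallP h.
  by apply/eqP/ffunP => i; apply/eqP; rewrite -[_ == _]negbK.
by rewrite (bigD1 i) //= (negbTE fgi) mul0r.
Qed.

Lemma induced1 E (b a : idx n E) : induced (1%:M : 'M[C R]_n) 1%:M b a = (b == a)%:R.
Proof.
elim: E b a => [b a|b a|E1 ih1 E2 ih2 [b1 b2] [a1 a2]|p E ih b a] /=; rewrite ?mxE //.
  by rewrite ih1 ih2 xpair_eqE -natrM mulnb.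
under eq_bigr do rewrite ih.
exact: prod_eqb.
Qed.

Lemma act_mul q E Q T O Q' T' O' (v : ecomps R n q E) :
  act Q T O (act Q' T' O' v) = act (Q *m Q') (T *m T') (O *m O') v.
Proof.
apply/funext => I; apply/funext => b; rewrite /act.
have hQ (J : {ffun 'I_q -> 'I_n}) : \prod_(i < q) (Q *m Q') (I i) (J i) =
    \sum_(K : {ffun 'I_q -> 'I_n}) (\prod_(i < q) Q (I i) (K i)) * (\prod_(i < q) Q' (K i) (J i)).
  (* The form part transforms by the matrix that [Q] induces on [Ext q Tan]. *)
  exact: (@induced_mul Q Q' Q Q' (Ext q Tan) I J).
under [RHS]eq_bigr => J _ do under eq_bigr => a _ do rewrite hQ induced_mul.
under [LHS]eq_bigr => K _ do under eq_bigr => c _ do rewrite mulr_sumr.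
under [LHS]eq_bigr => K _ do rewrite exchange_big /=.
rewrite [LHS]exchange_big /=; apply: eq_bigr => J _.
under [LHS]eq_bigr => K _ do under eq_bigr => c _ do rewrite mulr_sumr.
under [LHS]eq_bigr => K _ do rewrite exchange_big /=.
rewrite [LHS]exchange_big /=; apply: eq_bigr => a _.
rewrite mulr_suml mulr_suml; apply: eq_bigr => K _.
rewrite mulr_sumr mulr_suml; apply: eq_bigr => c _.
by rewrite !mulrA; congr (_ * _); rewrite -!mulrA; congr (_ * _); rewrite mulrCA.
Qed.

Lemma act_scalar1 q E (v : ecomps R n q E) : act 1%:M 1%:M 1%:M v = v.
Proof.
apply/funext => I; apply/funext => b; rewrite /act.
have h1 (J : {ffun 'I_q -> 'I_n}) :
    \prod_(i < q) (1%:M : 'M[C R]_n) (I i) (J i) = (I == J)%:R.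
  by rewrite -prod_eqb; apply: eq_bigr => i _; rewrite mxE.
rewrite (bigD1 I) //= (bigD1 b) //= h1 induced1 !eqxx !mul1r.
rewrite big1 => [|a /negbTE ab]; last by rewrite induced1 eq_sym ab mulr0 mul0r.
rewrite big1 ?addr0 // => J /negbTE IJ; rewrite big1 // => a _.
by rewrite h1 eq_sym IJ !mul0r.
Qed.

Lemma act0 q E Q T O : act Q T O (fun _ _ => 0 : C R) = (fun _ _ => 0) :> ecomps R n q E.
Proof.
apply/funext => I; apply/funext => b; rewrite /act big1 // => J _.
by rewrite big1 // => a _; rewrite mulr0.
Qed.

Lemma alternating_lin (I : Type) q (k : C R) (v w : {ffun 'I_q -> I} -> C R) :
  alternating v -> alternating w -> alternating (fun J => k * v J + w J).
Proof. by move=> hv hw s J; rewrite (hv s J) (hw s J) mulrDr mulrCA. Qed.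

Lemma alternating0 (I : Type) q : alternating (fun _ : {ffun 'I_q -> I} => 0 : C R).
Proof. by move=> s J; rewrite mulr0. Qed.

Lemma fibre_vector_lin E (k : C R) (v w : idx n E -> C R) :
  fibre_vector v -> fibre_vector w -> fibre_vector (fun a => k * v a + w a).
Proof.
elim: E v w => [||E1 ih1 E2 ih2|p E ih] //= v w [v1 v2] [w1 w2].
  by split=> [b|a]; [exact: ih1|exact: ih2].
by split=> [|i K]; [exact: alternating_lin|exact: ih].
Qed.

Lemma fibre_vector0 E : fibre_vector (fun _ : idx n E => 0 : C R).
Proof. by elim: E => //= p E ih; split=> // s J; rewrite mulr0. Qed.

Lemma fibre_vector_sum E (K : Type) (r : seq K) (k : K -> C R) (v : K -> idx n E -> C R) :
  (forall l, fibre_vector (v l)) -> fibre_vector (fun a => \sum_(l <- r) k l * v l a).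
Proof.
move=> hv; elim: r => [|l r ih].
  rewrite (_ : (fun _ => _) = fun _ => 0); first exact: fibre_vector0.
  by apply/funext => a; rewrite big_nil.
have := fibre_vector_lin (k l) (hv l) ih; congr (fibre_vector _).
by apply/funext => a; rewrite big_cons.
Qed.

(** All slots of a power are transformed by the same matrix, so alternation survives a simultaneous
    permutation of the slots; the constraint within one slot holds by linearity in the other
    ones. *)
Lemma fibre_vector_induced T O E (v : idx n E -> C R) : fibre_vector v ->
  fibre_vector (fun b => \sum_a induced T O b a * v a).
Proof.
elim: E v => [||E1 ih1 E2 ih2|p E ih] //= v [v1 v2]; split.
- move=> b2.
  have := fibre_vector_sum (index_enum _) (fun a2 => induced T O b2 a2)
    (fun a2 => ih1 _ (v1 a2)).
  congr (fibre_vector _); apply/funext => b1 /=.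
  under [LHS]eq_bigr => a2 _ do rewrite mulr_sumr.
  rewrite exchange_big /= pair_bigA /=; apply: eq_bigr => -[a1 a2] _ /=.
  by rewrite mulrA [_ * induced _ _ b1 _]mulrC.
- move=> b1.
  have := fibre_vector_sum (index_enum _) (fun a1 => induced T O b1 a1)
    (fun a1 => ih2 _ (v2 a1)).
  congr (fibre_vector _); apply/funext => b2 /=.
  under [LHS]eq_bigr => a1 _ do rewrite mulr_sumr.
  rewrite pair_bigA /=; apply: eq_bigr => -[a1 a2] _ /=.
  by rewrite mulrA.
- move=> s J; rewrite (reindex_inj (h := fun a : {ffun 'I_p -> idx n E} => [ffun k => a (s k)])) /=.
    rewrite mulr_sumr; apply: eq_bigr => a _; rewrite (v1 s a) mulrCA; congr (_ * (_ * _)).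
    rewrite [RHS](reindex_inj (@perm_inj _ s)) /=.
    by apply: eq_bigr => i _; rewrite !ffunE.
  move=> a a' /ffunP h; apply/ffunP => k; have := h ((s^-1)%g k).
  by rewrite !ffunE permKV.
- move=> i K.
  pose upd (a : {ffun 'I_p -> idx n E}) (e : idx n E) := [ffun j => if j == i then e else a j].
  have h (a : {ffun 'I_p -> idx n E}) : fibre_vector (fun e => v (upd a e)) by exact: v2.
  pose P (a : {ffun 'I_p -> idx n E}) := \prod_(j < p | j != i) induced T O (K j) (a j).
  (* Every a is upd a (a i); fix the value a0 of the remaining slot. *)
  case: (pickP (fun a : {ffun 'I_p -> idx n E} => true)) => [a0 _|none]; last first.
    rewrite (_ : (fun _ => _) = fun _ => 0); first exact: fibre_vector0.
    by apply/funext => e; rewrite big1 // => a; have := none a.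
  have := fibre_vector_sum (index_enum _)
    (fun a : {ffun 'I_p -> idx n E} => P a * (a i == a0 i)%:R) (fun a => ih _ (h a)).
  congr (fibre_vector _); apply/funext => e.
  transitivity (\sum_(a : {ffun 'I_p -> idx n E} | a i == a0 i) \sum_e' P a * (induced T O e e' * v (upd a e'))).
    rewrite [RHS]big_mkcond /=; apply: eq_bigr => a _.
    by case: (a i == a0 i); rewrite ?mulr0 ?mul0r // mulr1 mulr_sumr.
  rewrite pair_big_dep /=.
  rewrite (reindex (fun a : {ffun 'I_p -> idx n E} => (upd a (a0 i), a i))) /=.
    apply: eq_big => [a|a _]; first by rewrite /upd !ffunE !eqxx ?andbT.
    have -> : upd (upd a (a0 i)) (a i) = a.
      by apply/ffunP => j; rewrite !ffunE; case: eqP => // ->.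
    rewrite mulrA; congr (_ * _); rewrite [RHS](bigD1 i) //= ffunE eqxx mulrC.
    by congr (_ * _); apply: eq_bigr => j /negbTE ji; rewrite !ffunE ji.
  exists (fun ae => upd ae.1 ae.2) => [a _|[a e'] /=].
    by apply/ffunP => j; rewrite !ffunE; case: eqP => // ->.
  rewrite inE /= => /andP[/eqP hai _]; congr (_, _); last by rewrite /upd ffunE eqxx.
  by apply/ffunP => j; rewrite /upd !ffunE; case: eqP => [->|//]; rewrite hai.
Qed.

Lemma alternating_act q E Q T O (v : ecomps R n q E) :
  (forall a, alternating (fun J => v J a)) ->
  forall b, alternating (fun I => act Q T O v I b).
Proof.
move=> hv b s I; rewrite /act.
rewrite (reindex_inj (h := fun a : {ffun 'I_q -> 'I_n} => [ffun k => a (s k)])) /=.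
  rewrite mulr_sumr; apply: eq_bigr => J _; rewrite mulr_sumr; apply: eq_bigr => a _.
  rewrite (hv a s J) mulrCA; congr (_ * (_ * _ * _)).
  rewrite [RHS](reindex_inj (@perm_inj _ s)) /=.
  by apply: eq_bigr => i _; rewrite !ffunE.
move=> a a' /ffunP h; apply/ffunP => k; have := h ((s^-1)%g k).
by rewrite !ffunE permKV.
Qed.

Lemma fibre_vector_act q E Q T O (v : ecomps R n q E) :
  (forall J, fibre_vector (v J)) -> forall I, fibre_vector (act Q T O v I).
Proof.
move=> hv I.
have := fibre_vector_sum (index_enum _) (fun J : {ffun 'I_q -> 'I_n} => \prod_(i < q) Q (I i) (J i))
  (fun J => fibre_vector_induced T O (hv J)).
congr (fibre_vector _); apply/funext => b; rewrite /act.
apply: eq_bigr => J _; rewrite mulr_sumr; apply: eq_bigr => a _; exact: mulrA.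
Qed.

End TensorAlgebra.

(** * Point derivations and induced matrices *)

Section Derivations.
Context {R : realType} {X : topologicalType} {n : nat}.
Variables (c : chart R X n) (x : X) (D : (X -> C R) -> C R).
Implicit Types (f g : X -> C R).

(** This covers the Wirtinger derivatives of both charts and their combinations [twisted], so that
    the product rule on tensors is proved once. *)
Definition derivation : Prop :=
  [/\ forall a, D (fun=> a) = 0,
      forall f g, sm c f x -> sm c g x -> D (fun y => f y + g y) = D f + D g &
      forall f g, sm c f x -> sm c g x ->
        D (fun y => f y * g y) = D f * g x + f x * D g].

Hypothesis dD : derivation.

Lemma derivation_sum (I : Type) (r : seq I) (F : I -> X -> C R) :
  (forall i, sm c (F i) x) ->
  D (fun y => \sum_(i <- r) F i y) = \sum_(i <- r) D (F i).
Proof.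
move=> h; have [d0 dA _] := dD; elim: r => [|i r ih].
  rewrite big_nil -[RHS](d0 0); congr D; apply/funext => y; exact: big_nil.
rewrite big_cons -ih -dA; [|exact: h|exact: smooth_sum].
by congr D; apply/funext => y; rewrite big_cons.
Qed.

Lemma derivation_prod (I : finType) (F : I -> X -> C R) :
  (forall i, sm c (F i) x) ->
  D (fun y => \prod_i F i y) = \sum_i D (F i) * \prod_(j | j != i) F j x.
Proof.
move=> h; have [d0 _ dM] := dD.
have key (r : seq I) : uniq r -> D (fun y => \prod_(i <- r) F i y) =
    \sum_(i <- r) D (F i) * \prod_(j <- r | j != i) F j x.
  elim: r => [_|i r ih /= /andP[ir ur]].
    rewrite big_nil -(d0 1); congr D; apply/funext => y; exact: big_nil.
  rewrite (_ : (fun y => _) = fun y => F i y * \prod_(j <- r) F j y); last first.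
    by apply/funext => y; rewrite big_cons.
  rewrite dM; [|exact: h|exact: smooth_prod].
  rewrite (ih ur) big_cons big_cons eqxx /=; congr (_ * _ + _).
    rewrite big_seq [RHS]big_seq_cond; apply: eq_bigl => j.
    by case jr: (j \in r) => //=; apply/esym; apply: contraNneq ir => <-.
  rewrite mulr_sumr big_seq [RHS]big_seq; apply: eq_bigr => j jr.
  rewrite big_cons; have -> : i != j by apply: contraNneq ir => ->.
  exact: mulrCA.
by rewrite (key _ (index_enum_uniq I)).
Qed.

(* The derivative at the identity of [induced]. *)
Fixpoint dinduced (T O : 'M[C R]_n) E : idx n E -> idx n E -> C R :=
  match E return idx n E -> idx n E -> C R with
  | Tan => fun b a => T b a
  | Cot => fun b a => O b a
  | Tens E1 E2 => fun b a =>
      dinduced T O b.1 a.1 * (b.2 == a.2)%:R + (b.1 == a.1)%:R * dinduced T O b.2 a.2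
  | Ext p E1 => fun b a => \sum_(i < p)
      dinduced T O (b i) (a i) * \prod_(j < p | j != i) (b j == a j)%:R
  end.

Lemma sm_induced (M O : X -> 'M[C R]_n) E (b a : idx n E) :
  (forall i j, sm c (fun y => M y i j) x) -> (forall i j, sm c (fun y => O y i j) x) ->
  sm c (fun y => induced (M y) (O y) b a) x.
Proof.
move=> hM hO; elim: E b a => [||E1 ih1 E2 ih2 [b1 b2] [a1 a2]|p E ih b a] /=.
- exact: hM.
- exact: hO.
- exact: smoothM (ih1 _ _) (ih2 _ _).
- by apply: smooth_prod => i; exact: ih.
Qed.

Lemma sum_delta_r (I : finType) (F : I -> C R) a : \sum_c F c * (c == a)%:R = F a.
Proof.
rewrite (bigD1 a) //= eqxx mulr1 big1 ?addr0 // => i /negbTE ->; exact: mulr0.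
Qed.

(** A Leibniz rule for logarithmic derivatives: [D M = - M psi] and [D O = - O omega] persist in
    this shape under tensor products, [psi] and [omega] acting on one factor at a time. *)
Lemma derivation_induced (M O : X -> 'M[C R]_n) (psi omega : 'M[C R]_n) E (b a : idx n E) :
  (forall i j, sm c (fun y => M y i j) x) -> (forall i j, sm c (fun y => O y i j) x) ->
  (forall i j, D (fun y => M y i j) = - \sum_k M x i k * psi k j) ->
  (forall i j, D (fun y => O y i j) = - \sum_k O x i k * omega k j) ->
  D (fun y => induced (M y) (O y) b a) =
    - \sum_k induced (M x) (O x) b k * dinduced psi omega k a.
Proof.
move=> sM sO dM dO; have [d0 dA dMul] := dD.
elim: E b a => [||E1 ih1 E2 ih2 [b1 b2] [a1 a2]|p E ih b a] /=.
- exact: dM.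
- exact: dO.
- rewrite dMul; try exact: sm_induced.
  rewrite ih1 ih2 !mulNr mulrN -opprD; congr (- _).
  rewrite -(pair_bigA _ (fun k1 k2 => induced (M x) (O x) b1 k1 * induced (M x) (O x) b2 k2 *
     (dinduced psi omega k1 a1 * (k2 == a2)%:R + (k1 == a1)%:R * dinduced psi omega k2 a2))) /=.
  under [RHS]eq_bigr => k1 _ do under eq_bigr => k2 _ do rewrite mulrDr.
  under [RHS]eq_bigr => k1 _ do rewrite big_split.
  rewrite [RHS]big_split /=; congr (_ + _).
    rewrite mulr_suml; apply: eq_bigr => k1 _.
    transitivity (\sum_k2 induced (M x) (O x) b1 k1 * dinduced psi omega k1 a1 *
        induced (M x) (O x) b2 k2 * (k2 == a2)%:R).
      by rewrite sum_delta_r.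
    apply: eq_bigr => k2 _; rewrite !mulrA; congr (_ * _).
    by rewrite -!mulrA; congr (_ * _); exact: mulrC.
  rewrite exchange_big /= mulr_sumr; apply: eq_bigr => k2 _.
  transitivity (\sum_k1 induced (M x) (O x) b1 k1 * (induced (M x) (O x) b2 k2 *
      dinduced psi omega k2 a2) * (k1 == a1)%:R).
    by rewrite sum_delta_r.
  apply: eq_bigr => k1 _; rewrite -!mulrA; congr (_ * (_ * _)); exact: mulrC.
- rewrite derivation_prod; last by move=> i; exact: sm_induced.
  transitivity (- \sum_(i < p) (\sum_k induced (M x) (O x) (b i) k * dinduced psi omega k (a i))
      * \prod_(j < p | j != i) induced (M x) (O x) (b j) (a j)).
    by rewrite -sumrN; apply: eq_bigr => i _; rewrite ih mulNr.
  congr (- _); under [RHS]eq_bigr do rewrite mulr_sumr.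
  rewrite [RHS]exchange_big /=; apply: eq_bigr => i _.
  (* The slots other than [i] receive an identity matrix, so that the product of sums expands over
     all index functions. *)
  pose G j k := induced (M x) (O x) (b j) k *
     (if j == i then dinduced psi omega k (a j) else (k == a j)%:R).
  transitivity (\prod_(j < p) \sum_k G j k).
    rewrite [RHS](bigD1 i) //=; congr (_ * _); first by rewrite /G eqxx.
    by apply: eq_bigr => j /negbTE ji; rewrite /G ji sum_delta_r.
  rewrite bigA_distr_bigA /=; apply: eq_bigr => k _.
  rewrite big_split /=; congr (_ * _); rewrite (bigD1 i) //= eqxx; congr (_ * _).
  by apply: eq_bigr => j /negbTE ->.
Qed.

End Derivations.

(** * Antisymmetrization of form components *)

Section Antisymmetrization.
Context {R : realType} {n : nat}.

(** The components of the form sum_p theta^p /\ f_p; the Dolbeault operator has this shape with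
    [f p] the derivative in direction [p]. *)
Definition asym q (f : 'I_n -> {ffun 'I_q -> 'I_n} -> C R) (I : {ffun 'I_q.+1 -> 'I_n}) : C R :=
  \sum_(i < q.+1) (-1) ^+ i * f (I i) (del i I).

Lemma lift_perm_surj q (i : 'I_q.+1) (s : 'S_q.+1) : s ord0 = i ->
  exists t, lift_perm ord0 i t = s.
Proof.
move=> si; pose g k := odflt k (unlift i (s (lift ord0 k))).
have gE k : lift i (g k) = s (lift ord0 k).
  rewrite /g; case: unliftP => //= h; have := neq_lift ord0 k.
  by rewrite -(inj_eq (@perm_inj _ s)) si h eqxx.
have g_inj : injective g.
  by move=> k l /(congr1 (lift i)); rewrite !gE => /perm_inj/lift_inj.
exists (perm g_inj); apply/permP => k.
by case: (unliftP ord0 k) => [l ->|->]; rewrite ?lift_perm_id ?lift_perm_lift ?permE.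
Qed.

(** The permutations with value [i] at 0 are the lifts of ['S_q]. As [f p] is alternating, these q!
    permutations contribute equal terms, of sign (-1)^i. *)
Lemma asym_perm q (f : 'I_n -> {ffun 'I_q -> 'I_n} -> C R) I :
  (forall p, alternating (f p)) ->
  q`!%:R * asym f I = \sum_(s : 'S_q.+1)
    (-1) ^+ s * f (I (s ord0)) [ffun k => I (s (lift ord0 k))].
Proof.
move=> hf; rewrite (partition_big (fun s : 'S_q.+1 => s ord0) xpredT) //= mulr_sumr.
apply: eq_bigr => i _.
transitivity (\sum_(s : 'S_q) (-1) ^+ i * f (I i) (del i I)).
  by rewrite sumr_const card_Sn mulr_natl.
rewrite (reindex_onto (lift_perm ord0 i)
  (fun s => odflt 1%g [pick t | lift_perm ord0 i t == s])) /=; last first.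
  move=> s /eqP/lift_perm_surj[t ts]; case: pickP => [t' /eqP //|/(_ t)].
  by rewrite ts eqxx.
have lift_perm_inj : injective (@lift_perm q ord0 i).
  move=> t t' /permP h; apply/permP => k; have := h (lift ord0 k).
  by rewrite !lift_perm_lift => /lift_inj.
apply: eq_big => [s|s _].
  rewrite lift_perm_id eqxx /=; case: pickP => [t|/(_ s)]; rewrite ?eqxx //=.
  by move=> /eqP/lift_perm_inj ->; rewrite eqxx.
rewrite lift_perm_id odd_lift_perm /= signr_addb signr_odd -mulrA; congr (_ * _).
have -> : [ffun k => I (lift_perm ord0 i s (lift ord0 k))] = [ffun k => del i I (s k)].
  by apply/ffunP => k; rewrite !ffunE lift_perm_lift.
by rewrite (hf (I i) s (del i I)) mulrA -signr_addb addbb expr0 mul1r.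
Qed.

Lemma fact_neq0 q : q`!%:R != 0 :> C R.
Proof. by rewrite pnatr_eq0 -lt0n fact_gt0. Qed.

Lemma alternating_asym q (f : 'I_n -> {ffun 'I_q -> 'I_n} -> C R) :
  (forall p, alternating (f p)) -> alternating (asym f).
Proof.
move=> hf s I; apply: (mulfI (fact_neq0 q)); rewrite mulrCA !asym_perm //.
rewrite mulr_sumr [RHS](reindex_inj (mulIg s)) /=; apply: eq_bigr => t _.
rewrite odd_permM signr_addb mulrA [(-1) ^+ s * _]mulrC -[_ * (-1) ^+ s * (-1) ^+ s]mulrA.
rewrite -signr_addb addbb expr0 mulr1 ffunE permM; congr (_ * f _ _).
by apply/ffunP => k; rewrite !ffunE permM.
Qed.

(** In the sum over permutations, composing with the transposition of the first slot and slot k+1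
    preserves [g k] and changes the sign, so each [g k] contributes a sum equal to its negative. *)
Lemma asym_symmetric0 q (f : 'I_n -> {ffun 'I_q -> 'I_n} -> C R)
    (g : 'I_q -> 'I_n -> {ffun 'I_q -> 'I_n} -> C R) I :
  (forall p, alternating (f p)) -> (forall p K, f p K = \sum_k g k p K) ->
  (forall k p K, g k p K = g k (K k) [ffun l => if l == k then p else K l]) ->
  asym f I = 0.
Proof.
move=> hf hg hs; apply: (mulfI (fact_neq0 q)); rewrite mulr0 asym_perm //.
under eq_bigr => s _ do rewrite hg mulr_sumr.
rewrite exchange_big /= big1 // => k _.
set S := \sum_s _; have SN : S = - S.
  rewrite {1}/S (reindex_inj (mulgI (tperm ord0 (lift ord0 k)))) /= -sumrN.
  apply: eq_bigr => s _; rewrite odd_permM odd_tperm neq_lift.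
  rewrite signr_addb expr1 mulN1r mulNr; congr (- (_ * _)).
  rewrite hs !permM tpermL ffunE permM tpermR; congr (g _ _ _).
  apply/ffunP => l; rewrite !ffunE !permM.
  case: eqP => [->|/eqP lk]; first by rewrite // tpermL.
  rewrite tpermD //.
  by rewrite (inj_eq lift_inj) eq_sym.
apply/eqP; have /eqP : S + S = 0 by rewrite {1}SN addNr.
by rewrite -mulr2n mulrn_eq0.
Qed.

Lemma sum_insert (V : nmodType) q (i : 'I_q.+1) (F : 'I_n -> {ffun 'I_q -> 'I_n} -> V) :
  \sum_(J : {ffun 'I_q.+1 -> 'I_n}) F (J i) (del i J) =
  \sum_j \sum_(J : {ffun 'I_q -> 'I_n}) F j J.
Proof.
rewrite pair_bigA /=.
rewrite [RHS](reindex (fun J : {ffun 'I_q.+1 -> 'I_n} => (J i, del i J))) //.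
exists (fun p : 'I_n * {ffun 'I_q -> 'I_n} => [ffun k => oapp p.2 p.1 (unlift i k)]).
  move=> J _; apply/ffunP => k; rewrite ffunE /=.
  by case: (unliftP i k) => [l ->|->] /=; rewrite ?ffunE.
move=> [j J] _; congr (_, _) => /=; first by rewrite ffunE unlift_none.
by apply/ffunP => k; rewrite !ffunE liftK.
Qed.

Lemma prod_del q (Q : 'M[C R]_n) (I J : {ffun 'I_q.+1 -> 'I_n}) i :
  \prod_(k < q.+1) Q (I k) (J k) =
  Q (I i) (J i) * \prod_(k < q) Q (del i I k) (del i J k).
Proof.
by rewrite (bigD1_ord i) //=; congr (_ * _); apply: eq_bigr => k _; rewrite !ffunE.
Qed.

End Antisymmetrization.

(** * The Dolbeault operator under a change of frame *)

Section FrameChange.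
Context {R : realType} {X : topologicalType} {n : nat}.
Variables (z w : chart R X n) (x : X).
Hypotheses (hz : is_chart z) (hw : is_chart w) (zx : dom z x) (wx : dom w x).
Hypotheses (zw : smt z w x) (wz : smt w z x).
Variable phi : 'I_n -> 'I_n -> X -> C R.

Definition frame_Q (z w : chart R X n) (y : X) : 'M[C R]_n := \matrix_(i, j) wp true w i (zbc z j) y.
Definition frame_M (z w : chart R X n) (y : X) : 'M[C R]_n := \matrix_(b, a) wp false z a (zc w b) y.

Hypotheses (sphi : forall a j, sm z (phi a j) x)
  (Mx : frame_M z w x \in unitmx)
  (phiP : \forall y \near x, forall b j,
     wp true z j (zc w b) y = \sum_a phi a j y * frame_M z w y b a).

(** The operator D_j of the overview, evaluated at [x]. *)
Definition twisted j (f : X -> C R) : C R :=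
  wp true z j f x - \sum_a phi a j x * wp false z a f x.

Lemma derivation_wp b i : derivation z x (wp b z i ^~ x).
Proof.
split=> [a|f g hf hg|f g hf hg]; first exact: wp_cst.
  exact: wpD (hf 1) (hg 1).
exact: wpM (hf 1) (hg 1).
Qed.

Lemma derivation_wp_other b i : derivation z x (wp b w i ^~ x).
Proof.
have tr f : sm z f x -> sm w f x by exact: sm_transition.
split=> [a|f g /tr hf /tr hg|f g /tr hf /tr hg]; first exact: wp_cst.
  exact: wpD (hf 1) (hg 1).
exact: wpM (hf 1) (hg 1).
Qed.

Lemma derivation_twisted j : derivation z x (twisted j).
Proof.
have [t0 tD tM] := derivation_wp true j.
split=> [a|f g hf hg|f g hf hg]; rewrite /twisted.
- by rewrite t0 big1 ?subr0 // => k _; rewrite wp_cst mulr0.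
- rewrite (tD _ _ hf hg).
  have -> : \sum_a phi a j x * wp false z a (fun y => f y + g y) x =
      \sum_a phi a j x * wp false z a f x + \sum_a phi a j x * wp false z a g x.
    rewrite -big_split; apply: eq_bigr => k _.
    by have [_ -> //] := derivation_wp false k; rewrite mulrDr.
  by rewrite opprD addrACA.
rewrite (tM _ _ hf hg).
have -> : \sum_a phi a j x * wp false z a (fun y => f y * g y) x =
    (\sum_a phi a j x * wp false z a f x) * g x +
    f x * \sum_a phi a j x * wp false z a g x.
  rewrite mulr_suml mulr_sumr -big_split; apply: eq_bigr => k _.
  have [_ _ -> //] := derivation_wp false k.
  by rewrite mulrDr !mulrA [f x * _]mulrC.
move: (wp _ _ _ _ _) (\sum_a _) (wp _ _ _ _ _) (\sum_a _) (f x) (g x).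
by move=> *; ring.
Qed.

Lemma twisted_eq j f g : sm z f x -> (\forall y \near x, f y = g y) ->
  twisted j g = twisted j f.
Proof.
move=> hf h; rewrite /twisted (wp_eq hz zx true j (hf 1) h); congr (_ - _).
by apply: eq_bigr => a _; rewrite (wp_eq hz zx false a (hf 1) h).
Qed.

(** The coordinates [w^b] are killed by d/d(conj w). Expanded in [z] by the chain rule and [phiP],
    this says that dw/dz annihilates the difference of the two sides, and dw/dz is invertible. *)
Lemma wp_antiholo i a :
  wp true w i (zc z a) x = - \sum_j frame_Q z w x i j * phi a j x.
Proof.
pose v : 'cV[C R]_n := \col_a (wp true w i (zc z a) x + \sum_j frame_Q z w x i j * phi a j x).
suff v0 : v = 0.
  apply/eqP; rewrite -addr_eq0; apply/eqP.
  by have := congr1 (fun v : 'cV[C R]_n => v a 0) v0; rewrite !mxE.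
rewrite -[v](mulKmx Mx) (_ : _ *m v = 0) ?mulmx0 //.
apply/colP => b; rewrite !mxE.
have szw : gC 1 z (zc w b) x by exact: zw.
have := wp_zc hw wx true b i; rewrite /= (wp_transition hw hz wx zx wz true i szw) => h0.
rewrite -[RHS]h0 big_split /=.
under eq_bigr => k _ do rewrite !mxE mulrDr mulr_sumr.
rewrite big_split /=; congr (_ + _).
rewrite exchange_big /=; apply: eq_bigr => j _.
rewrite (nbhs_singleton phiP) mulr_suml; apply: eq_bigr => k _.
rewrite !mxE.
move: (phi k j x) (wp false z k (zc w b) x) (wp true w i (zbc z j) x) => x1 x2 x3.
by ring.
Qed.

Lemma wp_twisted i f : sm z f x ->
  wp true w i f x = \sum_j frame_Q z w x i j * twisted j f.
Proof.
move=> hf; rewrite (wp_transition hw hz wx zx wz true i (hf 1)) big_split /= addrC.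
under [RHS]eq_bigr => j _ do rewrite mulrBr.
rewrite [RHS]big_split /=; congr (_ + _).
  by apply: eq_bigr => j _; rewrite mxE mulrC.
under eq_bigr => a _ do rewrite wp_antiholo mulrN mulr_sumr.
rewrite !sumrN exchange_big /=; congr (- _); apply: eq_bigr => j _.
rewrite mulr_sumr; apply: eq_bigr => a _.
by rewrite mulrC mulrA.
Qed.

Lemma sm_frame_M b a : sm z (fun y => frame_M z w y b a) x.
Proof.
apply: smooth_eq (sm_wp hz zx false a (zw b)).
by apply: filterE => u; rewrite /frame_M mxE.
Qed.

Lemma sm_frame_O b a : sm z (fun y => (invmx (frame_M z w y))^T b a) x.
Proof.
apply: smooth_eq (sm_invmx a b hz zx Mx sm_frame_M).
by apply: filterE => u; rewrite mxE.
Qed.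

Lemma sm_frame_Q i j : sm z (fun y => frame_Q z w y i j) x.
Proof.
apply: (sm_transition hz hw zx wx zw).
apply: smooth_eq (sm_wp hw wx true i (_ : sm w (zbc z j) x)).
  by apply: filterE => u; rewrite /frame_Q mxE.
exact: smooth_conj (wz j).
Qed.

(* d phi^b_j / d z^a, up to sign the matrix of [phi, d/dz^a]. *)
Definition frame_psi j : 'M[C R]_n := \matrix_(b, a) - wp false z a (phi b j) x.

Lemma twisted_frame_M j b a :
  twisted j (fun y => frame_M z w y b a) =
  - \sum_k frame_M z w x b k * frame_psi j k a.
Proof.
have e1 : (fun y => frame_M z w y b a) = wp false z a (zc w b).
  by apply/funext => y; rewrite mxE.
rewrite {1}e1 /twisted (wpC hz zx true false j a (zw b)).
have s1 k : sm z (fun y => phi k j y * frame_M z w y b k) x.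
  exact: smoothM (sphi k j) (sm_frame_M b k).
have s2 : sm z (fun y => \sum_k phi k j y * frame_M z w y b k) x by exact: smooth_sum.
have -> : wp false z a (wp true z j (zc w b)) x =
    wp false z a (fun y => \sum_k phi k j y * frame_M z w y b k) x.
  by apply: (wp_eq hz zx _ _ (s2 1)); apply: filterS phiP => y ->.
rewrite (derivation_sum (derivation_wp false a)) // -sumrB -sumrN.
apply: eq_bigr => k _.
have [_ _ -> //] := derivation_wp false a; last exact: sm_frame_M.
have -> : wp false z a (fun y => frame_M z w y b k) x = wp false z k (wp false z a (zc w b)) x.
  have -> : (fun y => frame_M z w y b k) = wp false z k (zc w b).
    by apply/funext => y; rewrite mxE.
  exact: (wpC hz zx false false a k (zw b)).
by rewrite addrK [frame_psi _ _ _]mxE mulrN opprK mulrC.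
Qed.

(** Differentiating M^-1 M = 1 and inserting D_j M = - M psi gives D_j M^-1 = psi M^-1; its
    transpose is the dual representation, with - psi^T in place of psi. *)
Lemma twisted_frame_O j b a :
  twisted j (fun y => (invmx (frame_M z w y))^T b a) =
  - \sum_k (invmx (frame_M z w x))^T b k * (- (frame_psi j)^T) k a.
Proof.
have dT := derivation_twisted j; have [d0 dD dM] := dT.
set Ot := fun y => (invmx (frame_M z w y))^T.
have sO k l : sm z (fun y => Ot y k l) x by exact: sm_frame_O.
have hM : \forall y \near x, frame_M z w y \in unitmx.
  exact: near_unit_chart hz zx Mx sm_frame_M.
have hc c : \forall y \near x, \sum_k Ot y k a * frame_M z w y k c = (a == c)%:R.
  apply: filterS hM => y uy; have := congr1 (fun A : 'M[C R]_n => A a c) (mulVmx uy).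
  by rewrite !mxE => <-; apply: eq_bigr => k _; rewrite mxE.
have h1 c : \sum_k twisted j (fun y => Ot y k a) * frame_M z w x k c = frame_psi j a c.
  have sc k : sm z (fun y => Ot y k a * frame_M z w y k c) x.
    exact: smoothM (sO k a) (sm_frame_M k c).
  have := twisted_eq j (smooth_sum (index_enum _) sc) (hc c).
  rewrite d0 (derivation_sum dT) //.
  under [in RHS]eq_bigr => k _ do rewrite (dM _ _ (sO k a) (sm_frame_M k c)).
  rewrite big_split /= => /esym/eqP; rewrite addr_eq0 => /eqP ->.
  under eq_bigr => k _ do rewrite twisted_frame_M mulrN mulr_sumr.
  rewrite sumrN opprK exchange_big /=.
  transitivity (\sum_e (a == e)%:R * frame_psi j e c).
    apply: eq_bigr => e _; rewrite -(nbhs_singleton (hc e)) mulr_suml.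
    by apply: eq_bigr => k _; rewrite mulrA.
  rewrite (bigD1 a) //= eqxx mul1r big1 ?addr0 // => e /negbTE ea.
  by rewrite eq_sym ea mul0r.
have h2 k : \sum_c frame_M z w x k c * Ot x b c = (k == b)%:R.
  have := congr1 (fun A : 'M[C R]_n => A k b) (mulmxV Mx); rewrite !mxE => <-.
  by apply: eq_bigr => c _; rewrite [Ot x b c]mxE.
transitivity (\sum_c frame_psi j a c * Ot x b c).
  under [RHS]eq_bigr => c _ do rewrite -h1 mulr_suml.
  rewrite exchange_big /=.
  under [RHS]eq_bigr => k _ do under eq_bigr => c _ do rewrite -mulrA.
  under [RHS]eq_bigr => k _ do rewrite -mulr_sumr h2.
  by rewrite sum_delta_r.
rewrite -sumrN; apply: eq_bigr => c _.
have -> : (- (frame_psi j)^T) c a = - frame_psi j a c by rewrite 2!mxE.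
by rewrite mulrN opprK mulrC.
Qed.

(* The d(conj w)-derivatives of the form coefficients cancel, being symmetric. *)
Theorem dolbeault_frame_change q E (s r : X -> ecomps R n q E) :
  (forall J a, sm z (fun y => s y J a) x) ->
  (forall a, alternating (fun J => s x J a)) ->
  (\forall y \near x, r y =
     act (frame_Q z w y) (frame_M z w y) (invmx (frame_M z w y))^T (s y)) ->
  (fun (I : {ffun 'I_q.+1 -> 'I_n}) (b : idx n E) => \sum_(i < q.+1) (-1) ^+ i *
     wp true w (I i) (fun y => r y (del i I) b) x) =
  act (frame_Q z w x) (frame_M z w x) (invmx (frame_M z w x))^T
    (fun J a => \sum_(i < q.+1) (-1) ^+ i *
       (twisted (J i) (fun y => s y (del i J) a) -
        \sum_c dinduced (frame_psi (J i)) (- (frame_psi (J i))^T) a c * s x (del i J) c)).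
Proof.
move=> ss salt hr; apply/funext => I; apply/funext => b.
set Q := frame_Q z w; set M := frame_M z w; pose O y := (invmx (M y))^T.
pose ind (b a : idx n E) := induced (M x) (O x) b a : C R.
pose dind j (a c : idx n E) := dinduced (frame_psi j) (- (frame_psi j)^T) a c : C R.
pose P (K J : {ffun 'I_q -> 'I_n}) := \prod_(k < q) Q x (K k) (J k).
pose t (J : {ffun 'I_q -> 'I_n}) := \sum_a ind b a * s x J a.
pose N j (J : {ffun 'I_q -> 'I_n}) a :=
  twisted j (fun y => s y J a) - \sum_c dind j a c * s x J c.
(* [f1] collects the derivatives of the form coefficients, [f2] those of the bundle frame and of the
   components. *)
pose f1 p (K : {ffun 'I_q -> 'I_n}) :=
  \sum_(J : {ffun 'I_q -> 'I_n}) wp true w p (fun y => \prod_(k < q) Q y (K k) (J k)) x * t J.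
pose f2 p (K : {ffun 'I_q -> 'I_n}) :=
  \sum_j \sum_(J : {ffun 'I_q -> 'I_n}) Q x p j * P K J * \sum_a ind b a * N j J a.
have sQ k l : sm z (fun y => Q y k l) x by exact: sm_frame_Q.
have sP (K J : {ffun 'I_q -> 'I_n}) : sm z (fun y => \prod_(k < q) Q y (K k) (J k)) x.
  by apply: smooth_prod => k; exact: sQ.
have sI (b' a : idx n E) : sm z (fun y => induced (M y) (O y) b' a) x.
  by apply: sm_induced; [exact: sm_frame_M|exact: sm_frame_O].
have sT (K J : {ffun 'I_q -> 'I_n}) (a : idx n E) : sm z (fun y => \prod_(k < q) Q y (K k) (J k) *
    induced (M y) (O y) b a * s y J a) x.
  by apply: smoothM (ss J a); exact: smoothM (sP K J) (sI b a).
have dW p := derivation_wp_other true p.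
have split12 p (K : {ffun 'I_q -> 'I_n}) : wp true w p (fun y => r y K b) x = f1 p K + f2 p K.
  have sA : sm z (fun y => act (Q y) (M y) (O y) (s y) K b) x.
    by apply: smooth_sum => J; apply: smooth_sum => a; exact: sT.
  have -> : wp true w p (fun y => r y K b) x =
      wp true w p (fun y => act (Q y) (M y) (O y) (s y) K b) x.
    apply: (wp_eq hw wx _ _ (sm_transition hw hz wx zx wz sA 1)).
    by apply: filterS hr => y ->.
  rewrite /act (derivation_sum (dW p)); last by move=> J; apply: smooth_sum => a; exact: sT.
  transitivity (\sum_(J : {ffun 'I_q -> 'I_n}) (wp true w p (fun y => \prod_(k < q) Q y (K k) (J k)) x * t J +
    P K J * \sum_a (wp true w p (fun y => induced (M y) (O y) b a) x * s x J a +
       ind b a * wp true w p (fun y => s y J a) x))).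
    apply: eq_bigr => J _; rewrite (derivation_sum (dW p)) //.
    rewrite mulr_sumr [_ * t J]mulr_sumr -big_split; apply: eq_bigr => a _ /=.
    have [_ _ dM] := dW p.
    rewrite (dM _ _ (smoothM (sP K J) (sI b a)) (ss J a)) (dM _ _ (sP K J) (sI b a)).
    rewrite -/(ind b a) -/(P K J).
    move: (wp true w p _ x) (wp true w p _ x) (wp true w p _ x) (s x J a) (ind b a) (P K J).
    by move=> *; ring.
  rewrite big_split /=; congr (_ + _); rewrite /f2 exchange_big /=.
  apply: eq_bigr => J _.
  have -> : \sum_a (wp true w p (fun y => induced (M y) (O y) b a) x * s x J a +
       ind b a * wp true w p (fun y => s y J a) x) =
     \sum_j Q x p j * \sum_a ind b a * N j J a.
    transitivity (\sum_a \sum_j Q x p j *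
       (twisted j (fun y => induced (M y) (O y) b a) * s x J a +
        ind b a * twisted j (fun y => s y J a))).
      apply: eq_bigr => a _; rewrite (wp_twisted p (sI b a)) (wp_twisted p (ss J a)).
      rewrite mulr_suml mulr_sumr -big_split; apply: eq_bigr => j _ /=.
      move: (twisted j _) (twisted j _) (Q x p j) (s x J a) (ind b a) => x1 x2 x3 x4 x5.
      by ring.
    rewrite exchange_big /=; apply: eq_bigr => j _; rewrite -mulr_sumr; congr (_ * _).
    rewrite big_split /=.
    under [RHS]eq_bigr => a _ do rewrite /N mulrBr.
    rewrite [RHS]big_split /= addrC; congr (_ + _).
    under eq_bigr => a _ do rewrite (derivation_induced (derivation_twisted j) b a
      sm_frame_M sm_frame_O (twisted_frame_M j) (twisted_frame_O j)) mulNr mulr_suml.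
    rewrite !sumrN exchange_big /=; congr (- _); apply: eq_bigr => c _.
    by rewrite mulr_sumr; apply: eq_bigr => a _; rewrite mulrA.
  by rewrite mulr_sumr; apply: eq_bigr => j _; rewrite mulrA [P K J * _]mulrC.
transitivity (asym f1 I + asym f2 I).
  rewrite /asym -big_split /=; apply: eq_bigr => i _.
  by rewrite split12 mulrDr.
have -> : asym f1 I = 0.
  (* [g k] differentiates the k-th factor of [Q]; this is a second derivative of a conj z^j in the
     directions [p] and [K k], hence symmetric in them. *)
  pose g k p (K : {ffun 'I_q -> 'I_n}) := \sum_(J : {ffun 'I_q -> 'I_n})
    (wp true w p (fun y => Q y (K k) (J k)) x * \prod_(l < q | l != k) Q x (K l) (J l)) * t J.
  apply: (asym_symmetric0 (g := g)).
  - move=> p s' K; rewrite /f1 mulr_sumr.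
    rewrite (reindex_inj (h := fun a : {ffun 'I_q -> 'I_n} => [ffun k => a (s' k)])) /=; last first.
      move=> a a' /ffunP h; apply/ffunP => k; have := h ((s'^-1)%g k).
      by rewrite !ffunE permKV.
    apply: eq_bigr => J _.
    have -> : t [ffun k => J (s' k)] = (-1) ^+ s' * t J.
      rewrite /t mulr_sumr; apply: eq_bigr => a _.
      by rewrite (salt a s' J) mulrCA.
    rewrite mulrCA; congr (_ * (_ * _)); congr (wp true w p _ x).
    apply/funext => y; rewrite [RHS](reindex_inj (@perm_inj _ s')) /=.
    by apply: eq_bigr => k _; rewrite !ffunE.
  - move=> p K; rewrite /f1 /g exchange_big /=; apply: eq_bigr => J _.
    by rewrite (derivation_prod (dW p)) // mulr_suml.
  move=> k p K; apply: eq_bigr => J _; congr (_ * _ * _).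
    have sym i i' j : wp true w i (fun y => Q y i' j) x = wp true w i' (fun y => Q y i j) x.
      have e k' : (fun y => Q y k' j) = wp true w k' (zbc z j).
        by apply/funext => y; rewrite mxE.
      by rewrite !e (wpC hw wx) //; exact: smooth_conj (wz j).
    by rewrite ffunE eqxx sym.
  by apply: eq_bigr => l /negbTE lk; rewrite ffunE lk.
rewrite add0r /act.
under [RHS]eq_bigr => J _ do under eq_bigr => a _ do rewrite mulr_sumr.
under [RHS]eq_bigr => J _ do rewrite exchange_big /=.
rewrite [RHS]exchange_big /=; apply: eq_bigr => i _.
(* The index [j] produced by the derivative and the multi-index [J] of length q merge into one of
   length q+1, [j] at place [i]. *)
rewrite /f2 -(sum_insert i (fun j J => Q x (I i) j * P (del i I) J * \sum_a ind b a * N j J a)).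
rewrite mulr_sumr; apply: eq_bigr => J _; rewrite (prod_del _ I J i) -/(P _ _) !mulr_sumr.
apply: eq_bigr => a _; rewrite -/(ind b a) -/(N (J i) (del i J) a).
move: (Q x _ _) (P _ _) (ind b a) (N _ _ a) ((-1) ^+ i) => x1 x2 x3 x4 x5.
by ring.
Qed.

End FrameChange.

(** * Global forms and the extension operator *)

Section Cocycles.
Context {R : realType} {X : topologicalType} {n : nat}.
Implicit Types (c d z w : chart R X n) (x y : X) (A B : set (chart R X n)).

Definition hol c d x : Prop := forall i j, wp true c j (zc d i) x = 0.

Lemma hol_conj c d x i j : smt c d x -> hol c d x -> wp false c j (zbc d i) x = 0.
Proof.
move=> s h; have -> : wp false c j (zbc d i) x = (wp true c j (zc d i) x)^*.
  exact: (wp_conj false j (s i 1)).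
by rewrite h rmorph0.
Qed.

Section ThreeCharts.
Variables (c1 c2 c3 : chart R X n) (x : X).
Hypotheses (h1 : is_chart c1) (h2 : is_chart c2) (h3 : is_chart c3).
Hypotheses (x1 : dom c1 x) (x2 : dom c2 x) (x3 : dom c3 x).
Hypotheses (s12 : smt c1 c2 x) (s21 : smt c2 c1 x) (s23 : smt c2 c3 x) (s32 : smt c3 c2 x).
Hypothesis hh : (hol c1 c2 x /\ hol c2 c1 x) \/ (hol c2 c3 x /\ hol c3 c2 x).

(** In the chain rule the terms mixing z and conj z contain a factor from each transition. They
    vanish once one transition is holomorphic, the other being merely smooth: this allows charts of
    both complex structures. *)
Lemma cocycle_Q : frame_Q c1 c3 x = frame_Q c2 c3 x *m frame_Q c1 c2 x.
Proof.
apply/matrixP => i j; rewrite !mxE.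
have sj : gC 1 c2 (zbc c1 j) x by exact: (smooth_conj (s21 j) 1).
rewrite (wp_transition h3 h2 x3 x2 s32 true i sj); apply: eq_bigr => l _.
rewrite !mxE; case: hh => -[k1 k2]; last by rewrite k2 mulr0 add0r mulrC.
by rewrite (hol_conj _ _ s21 k2) mul0r add0r mulrC.
Qed.

Lemma cocycle_M : frame_M c1 c3 x = frame_M c2 c3 x *m frame_M c1 c2 x.
Proof.
apply/matrixP => b a; rewrite !mxE.
rewrite (wp_transition h1 h2 x1 x2 s12 false a (s23 b 1)); apply: eq_bigr => l _.
rewrite !mxE; case: hh => -[k1 k2]; last by rewrite k1 mul0r addr0.
by rewrite (hol_conj _ _ s12 k1) mulr0 addr0.
Qed.

End ThreeCharts.

Lemma frame_Q_refl c x : is_chart c -> dom c x -> frame_Q c c x = 1%:M.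
Proof.
by move=> hc cx; apply/matrixP => i j; rewrite !mxE (wp_zbc hc cx).
Qed.

Lemma frame_M_refl c x : is_chart c -> dom c x -> frame_M c c x = 1%:M.
Proof.
by move=> hc cx; apply/matrixP => i j; rewrite !mxE (wp_zc hc cx) eq_sym.
Qed.

(** With Z = dz/dw, Q is the conjugate transpose of Z. The chain rule gives M Z + N Y = 1 and conj N
    Z + conj M Y = 0; eliminating Y through the inverse of conj M exhibits a left inverse of Z. *)
Lemma frame_Q_unit z w x : is_chart z -> is_chart w -> dom z x -> dom w x ->
  smt z w x -> smt w z x -> frame_M z w x \in unitmx -> frame_Q z w x \in unitmx.
Proof.
move=> hz hw zx wx zw wz Mx.
pose Z := frame_M w z x.
pose N : 'M[C R]_n := \matrix_(b, g) wp true z g (zc w b) x.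
pose Y : 'M[C R]_n := \matrix_(g, b) wp false w b (zbc z g) x.
set M := frame_M z w x in Mx.
have QE : frame_Q z w x = (map_mx Num.conj Z)^T.
  apply/matrixP => i j; rewrite !mxE.
  exact: (wp_conj true i (wz j 1)).
have e1 : M *m Z + N *m Y = 1%:M.
  apply/matrixP => b' b; rewrite !mxE.
  have := wp_zc hw wx false b' b; rewrite /= (wp_transition hw hz wx zx wz false b (zw b' 1)).
  rewrite eq_sym => <-; rewrite -big_split; apply: eq_bigr => g _.
  by rewrite !mxE.
have e2 : map_mx Num.conj N *m Z + map_mx Num.conj M *m Y = 0.
  apply/matrixP => b' b; rewrite !mxE.
  have sb : gC 1 z (zbc w b') x by exact: (smooth_conj (zw b') 1).
  have h0 : wp false w b (zbc w b') x = 0 by rewrite (wp_zbc hw wx).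
  rewrite -[RHS]h0 (wp_transition hw hz wx zx wz false b sb).
  rewrite -big_split; apply: eq_bigr => g _; rewrite !mxE.
  by congr (_ * _ + _ * _); apply/esym; [exact: (wp_conj false g (zw b' 1))|
     exact: (wp_conj true g (zw b' 1))].
have Mc : map_mx Num.conj M \in unitmx by rewrite map_unitmx.
have Y' : Y = - (invmx (map_mx Num.conj M) *m (map_mx Num.conj N *m Z)).
  rewrite -[LHS](mulKmx Mc); have /eqP := e2; rewrite addrC addr_eq0 => /eqP ->.
  by rewrite mulmxN.
rewrite QE unitmx_tr map_unitmx.
have := e1; rewrite Y' mulmxN !mulmxA -mulmxBl => h.
by have [_] := mulmx1_unit h.
Qed.

Definition holomorphic_atlas A : Prop :=
  [/\ forall c, A c -> is_chart c, forall x, exists2 c, A c & dom c x &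
      forall c d x, A c -> A d -> dom c x -> dom d x -> smt c d x /\ hol c d x].

Lemma chart_atP A w x : holomorphic_atlas A ->
  A (chart_at A w x) /\ dom (chart_at A w x) x.
Proof.
move=> [_ /(_ x)[c Ac cx] _].
by rewrite /chart_at; case: xgetP => [d _ //|/(_ c)]; case.
Qed.

Definition frame_act z w x q E : ecomps R n q E -> ecomps R n q E :=
  act (frame_Q z w x) (frame_M z w x) (invmx (frame_M z w x))^T.

Section OneAtlas.
Variable A : set (chart R X n).
Hypothesis hA : holomorphic_atlas A.

Lemma atlas_frame_M_inv c d x : A c -> A d -> dom c x -> dom d x ->
  frame_M d c x *m frame_M c d x = 1%:M.
Proof.
move=> Ac Ad cx dx; have [ch _ sh] := hA.
have [scd hcd] := sh c d x Ac Ad cx dx; have [sdc hdc] := sh d c x Ad Ac dx cx.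
rewrite -cocycle_M ?frame_M_refl //; try exact: ch.
by left.
Qed.

Lemma atlas_frame_Q_inv c d x : A c -> A d -> dom c x -> dom d x ->
  frame_Q d c x *m frame_Q c d x = 1%:M.
Proof.
move=> Ac Ad cx dx; have [ch _ sh] := hA.
have [scd hcd] := sh c d x Ac Ad cx dx; have [sdc hdc] := sh d c x Ad Ac dx cx.
rewrite -cocycle_Q ?frame_Q_refl //; try exact: ch.
by left.
Qed.

Lemma atlas_frame_M_unit c d x : A c -> A d -> dom c x -> dom d x ->
  frame_M c d x \in unitmx /\ invmx (frame_M c d x) = frame_M d c x.
Proof.
move=> Ac Ad cx dx; have h := atlas_frame_M_inv Ac Ad cx dx.
have [_ u] := mulmx1_unit h; split=> //.
by rewrite -[LHS]mul1mx -h mulmxK.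
Qed.

Lemma transitionE c d x q E (v : ecomps R n q E) : A c -> A d -> dom c x -> dom d x ->
  transition c d x v = frame_act c d x v.
Proof.
move=> Ac Ad cx dx; rewrite /transition /frame_act.
have [_ ->] := atlas_frame_M_unit Ac Ad cx dx.
congr (act _ _ _ v); apply/matrixP => i j; rewrite !mxE; by [exact: pdb_wp|exact: pd_wp].
Qed.

End OneAtlas.

(** * Transport of forms between two atlases *)

Section Transport.
Variables (A B : set (chart R X n)).
Hypotheses (hA : holomorphic_atlas A) (hB : holomorphic_atlas B).
Hypothesis BA : forall z w x, A z -> B w -> dom z x -> dom w x -> smt w z x.
Variables gQ gM gO : chart R X n -> chart R X n -> X -> 'M[C R]_n.
Hypothesis g_smooth : forall z w x i j, A z -> B w -> dom z x -> dom w x ->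
  [/\ sm w (fun y => gQ z w y i j) x, sm w (fun y => gM z w y i j) x &
      sm w (fun y => gO z w y i j) x].
Hypothesis g_left : forall z z' w x, A z -> A z' -> B w ->
  dom z x -> dom z' x -> dom w x ->
  [/\ gQ z w x = gQ z' w x *m frame_Q z z' x, gM z w x = gM z' w x *m frame_M z z' x &
      gO z w x = gO z' w x *m (invmx (frame_M z z' x))^T].
Hypothesis g_right : forall z w w' x, A z -> B w -> B w' ->
  dom z x -> dom w x -> dom w' x ->
  [/\ gQ z w' x = frame_Q w w' x *m gQ z w x, gM z w' x = frame_M w w' x *m gM z w x &
      gO z w' x = (invmx (frame_M w w' x))^T *m gO z w x].

(** Common shape of rho and of its inverse. [g_left] makes the result independent of the chart
    chosen in [A], [g_right] gives the transition law in [B]. *)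
Definition transport q E (s : eform R X n q E) : eform R X n q E :=
  on_atlas B (fun w x => let z := chart_at A w x in
    act (gQ z w x) (gM z w x) (gO z w x) (s z x)).

Lemma on_atlas_in q E (s : eform R X n q E) (D : set (chart R X n)) c x : D c -> dom c x ->
  on_atlas D s c x = s c x.
Proof.
move=> Dc cx; apply/funext => J; apply/funext => a.
by rewrite /on_atlas ifT //; apply/asboolP.
Qed.

Lemma on_atlas_out q E (s : eform R X n q E) (D : set (chart R X n)) c x :
  ~ (D c /\ dom c x) -> on_atlas D s c x = fun _ _ => 0.
Proof.
move=> h; apply/funext => J; apply/funext => a.
by rewrite /on_atlas ifF //; apply/negP => /asboolP.
Qed.

Lemma on_atlas_idem q E (s : eform R X n q E) (D : set (chart R X n)) :
  on_atlas D (on_atlas D s) = on_atlas D s.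
Proof.
apply/funext => c; apply/funext => x; case: (pselect (D c /\ dom c x)) => [[Dc cx]|h].
  by rewrite on_atlas_in.
by rewrite !on_atlas_out.
Qed.

Lemma transportE q E (s : eform R X n q E) z w x : A0 A q E s ->
  A z -> B w -> dom z x -> dom w x ->
  transport s w x = act (gQ z w x) (gM z w x) (gO z w x) (s z x).
Proof.
move=> [_ _ tr _ _] Az Bw zx wx; rewrite /transport on_atlas_in //=.
have [Az' zx'] := chart_atP w x hA; move: (chart_at A w x) Az' zx' => z' Az' zx'.
rewrite (tr z z' x) // (transitionE hA) // act_mul.
by have [<- <- <-] := g_left Az Az' Bw zx zx' wx.
Qed.

Lemma transport_A0 q E (s : eform R X n q E) : A0 A q E s -> A0 B q E (transport s).
Proof.
move=> As; have [s1 s2 s3 s4 s5] := As.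
have [chA covA shA] := hA; have [chB covB shB] := hB.
split.
- exact: on_atlas_idem.
- move=> w J a Bw; apply: (smooth_on_chart (fun y => transport s w y J a) (chB w Bw)).2 => x wx.
  have [z Az zx] := covA x; have hz := chA z Az; have hw := chB w Bw.
  apply: (@sm_eq _ _ _ w x hw wx
    (fun y => act (gQ z w y) (gM z w y) (gO z w y) (s z y) J a)).
    apply: filterS2 (near_dom hz zx) (near_dom hw wx) => y zy wy.
    by rewrite (transportE As Az Bw zy wy).
  have sg i j := g_smooth i j Az Bw zx wx.
  apply: smooth_sum => K; apply: smooth_sum => b; apply: smoothM; first apply: smoothM.
  + by apply: smooth_prod => i; have [] := sg (J i) (K i).
  + by apply: sm_induced => i j; have [] := sg i j.
  have sz : sm z (fun y => s z y K b) x.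
    exact: (smooth_on_chart (fun y => s z y K b) hz).1 (s2 z K b Az) x zx.
  exact: (sm_transition hw hz wx zx (BA Az Bw zx wx) sz).
- move=> w w' x Bw Bw' wx wx'; have [z Az zx] := covA x.
  rewrite !(transportE As Az) // (transitionE hB) // /frame_act act_mul.
  by have [<- <- <-] := g_right Az Bw Bw' zx wx wx'.
- move=> w x; case: (pselect (B w /\ dom w x)) => [[Bw wx]|h] a.
    rewrite /transport on_atlas_in //; apply: alternating_act => b; exact: s4.
  by rewrite /transport on_atlas_out //; exact: alternating0.
move=> w x J; case: (pselect (B w /\ dom w x)) => [[Bw wx]|h].
  rewrite /transport on_atlas_in //; apply: fibre_vector_act => K; exact: s5.
by rewrite /transport on_atlas_out //; exact: fibre_vector0.
Qed.

End Transport.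

Lemma A0_ext A q E (s r : eform R X n q E) : on_atlas A s = s -> on_atlas A r = r ->
  (forall c x, A c -> dom c x -> s c x = r c x) -> s = r.
Proof.
move=> e1 e2 h; rewrite -e1 -e2; apply/funext => c; apply/funext => x.
case: (pselect (A c /\ dom c x)) => [[Ac cx]|nc]; last by rewrite !on_atlas_out.
by rewrite !on_atlas_in //; exact: h.
Qed.

Section DolbeaultA0.
Variable A : set (chart R X n).
Hypothesis hA : holomorphic_atlas A.

Lemma wp_scale c x b i (a : C R) (f : X -> C R) : is_chart c -> dom c x -> sm c f x ->
  wp b c i (fun y => a * f y) x = a * wp b c i f x.
Proof.
move=> hc cx hf; rewrite (wpM hc cx b i (germ_C_cst 1 a _) (hf 1)).
by rewrite wp_cst mul0r add0r.
Qed.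

Lemma alternating_wp c x b i (I : Type) q (v : X -> {ffun 'I_q -> I} -> C R) :
  is_chart c -> dom c x -> (forall J, sm c (fun y => v y J) x) ->
  (forall y, alternating (v y)) -> alternating (fun J => wp b c i (fun y => v y J) x).
Proof.
move=> hc cx sv av s J; rewrite -wp_scale //; congr (wp b c i _ x).
by apply/funext => y; exact: (av y s J).
Qed.

(** The constraint is a system of linear equations with constant coefficients, so it survives
    differentiation. *)
Lemma fibre_vector_wp c x b i E (v : X -> idx n E -> C R) : is_chart c -> dom c x ->
  (forall a, sm c (fun y => v y a) x) -> (forall y, fibre_vector (v y)) ->
  fibre_vector (fun a => wp b c i (fun y => v y a) x).
Proof.
move=> hc cx; elim: E v => [||E1 ih1 E2 ih2|p E ih] //= v sv fv.
  split=> [a2|a1]; [apply: (ih1 (fun y a1 => v y (a1, a2)))|apply: (ih2 (fun y a2 => v y (a1, a2)))];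
    by [move=> a; exact: sv|move=> y; case: (fv y)].
split; first by apply: alternating_wp => // y; case: (fv y).
move=> k K; apply: (ih (fun y a => v y _)) => [a|y]; first exact: sv.
by case: (fv y).
Qed.

Lemma dolbeaultE q E (s : eform R X n q E) c x : A c -> dom c x ->
  dolbeault A s c x = fun J a =>
    \sum_(i < q.+1) (-1) ^+ i * wp true c (J i) (fun y => s c y (del i J) a) x.
Proof.
move=> Ac cx; rewrite /dolbeault on_atlas_in //.
by apply/funext => J; apply/funext => a; apply: eq_bigr => i _; rewrite pdb_wp.
Qed.

Lemma dinduced0 E (b a : idx n E) : dinduced (0 : 'M[C R]_n) 0 b a = 0.
Proof.
elim: E b a => [b a|b a|E1 ih1 E2 ih2 b a|p E ih b a] /=; rewrite ?mxE //.
  by rewrite ih1 ih2 mul0r mulr0 addr0.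
by rewrite big1 // => i _; rewrite ih mul0r.
Qed.

Lemma dolbeault_A0 q E (s : eform R X n q E) : A0 A q E s -> A0 A q.+1 E (dolbeault A s).
Proof.
move=> [s1 s2 s3 s4 s5]; have [ch cov sh] := hA.
have ss c x J a : A c -> dom c x -> sm c (fun y => s c y J a) x.
  move=> Ac cx.
  exact: (smooth_on_chart (fun y => s c y J a) (ch c Ac)).1 (s2 c J a Ac) x cx.
split.
- exact: on_atlas_idem.
- move=> c J a Ac; have hc := ch c Ac; apply: (smooth_on_chart (fun y => dolbeault A s c y J a) hc).2 => x cx.
  apply: (@sm_eq _ _ _ c x hc cx (fun y =>
    \sum_(i < q.+1) (-1) ^+ i * wp true c (J i) (fun y => s c y (del i J) a) y)).
    by apply: filterS (near_dom hc cx) => y cy; rewrite dolbeaultE.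
  apply: smooth_sum => i; apply: smoothM; first exact: smooth_cst.
  exact: (sm_wp hc cx true (J i) (ss c x (del i J) a Ac cx)).
- move=> c d x Ac Ad cx dx; rewrite (transitionE hA) // !dolbeaultE //.
  have hc := ch c Ac; have hd := ch d Ad.
  have [scd hcd] := sh c d x Ac Ad cx dx; have [sdc hdc] := sh d c x Ad Ac dx cx.
  have [Mu _] := atlas_frame_M_unit hA Ac Ad cx dx.
  (* Between charts of one complex structure the Beltrami differential is zero, and the frame change
     formula becomes the invariance of dbar. *)
  have := @dolbeault_frame_change _ _ _ c d x hc hd cx dx scd sdc (fun _ _ _ => 0) _ Mu _
    q E (s c) (s d).
  move=> -> //.
  + rewrite /frame_act; congr (act _ _ _ _); apply/funext => J; apply/funext => a.
    apply: eq_bigr => i _; congr (_ * _); rewrite /twisted.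
    have -> : frame_psi c x (fun _ _ _ => 0) (J i) = 0.
      by apply/matrixP => k l; rewrite !mxE wp_cst oppr0.
    rewrite trmx0 oppr0 !big1 ?subr0 // => k _; by rewrite ?dinduced0 mul0r.
  + by move=> a j; exact: smooth_cst.
  + apply: filterS2 (near_dom hc cx) (near_dom hd dx) => y cy dy b j.
    rewrite big1 => [|k _]; last by rewrite mul0r.
    by have [_] := sh c d y Ac Ad cy dy; apply.
  + by move=> J a; exact: ss.
  + apply: filterS2 (near_dom hc cx) (near_dom hd dx) => y cy dy.
    by rewrite (s3 c d) // (transitionE hA).
- move=> c x a; case: (pselect (A c /\ dom c x)) => [[Ac cx]|h]; last first.
    by rewrite /dolbeault on_atlas_out //; exact: alternating0.
  rewrite dolbeaultE //.
  apply: (alternating_asym (f := fun p K => wp true c p (fun y => s c y K a) x)) => p.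
  exact: (alternating_wp true p (ch c Ac) cx (fun J => ss c x J a Ac cx) (fun y => s4 c y a)).
move=> c x J; case: (pselect (A c /\ dom c x)) => [[Ac cx]|h]; last first.
  by rewrite /dolbeault on_atlas_out //; exact: fibre_vector0.
rewrite dolbeaultE //.
apply: (fibre_vector_sum (index_enum _) (fun i : 'I_q.+1 => (-1) ^+ i)
  (v := fun i a => wp true c (J i) (fun y => s c y (del i J) a) x)) => i.
exact: (fibre_vector_wp true (J i) (ch c Ac) cx (fun a => ss c x (del i J) a Ac cx)
  (fun y => s5 c y (del i J))).
Qed.

End DolbeaultA0.

End Cocycles.

(** * The pairing in coordinates *)

Section Pairing.
Context {R : realType} {X : topologicalType} {n : nat}.
Variables (z : chart R X n) (phi : eform R X n 1 Tan).

Lemma wp_const_fun b i x (f : X -> C R) : (forall y, f y = f x) -> wp b z i f x = 0.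
Proof.
move=> h; have -> : f = fun=> f x by apply/funext.
exact: wp_cst.
Qed.

Definition phi_comp a g (y : X) : C R := phi z y [ffun=> g] a.

Lemma push0 (T : Type) q (a : T) (K : {ffun 'I_q -> T}) : push a K ord0 = a.
Proof. by rewrite ffunE unlift_none. Qed.

Lemma push_lift (T : Type) q (a : T) (K : {ffun 'I_q -> T}) k : push a K (lift ord0 k) = K k.
Proof. by rewrite ffunE liftK. Qed.

Lemma del_push (T : Type) q (a : T) (K : {ffun 'I_q -> T}) : del ord0 (push a K) = K.
Proof. by apply/ffunP => k; rewrite ffunE push_lift. Qed.

Lemma iop_dz a x (e : 'I_n + 'I_n) : iop z phi (dz_mform a) x [ffun=> e] =
  if e is inr g then phi_comp a g x else 0.
Proof.
rewrite /iop /wedgel; under eq_bigr => a' _ do rewrite big_ord1 expr0 mul1r ffunE /dz_mform push0.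
case: e => [e|g]; first by rewrite big1 // => a' _; rewrite mul0r.
rewrite (bigD1 a) //= eqxx mulr1 big1 ?addr0 // => a' /negbTE aa.
by rewrite (inj_eq (@inl_inj _ _)) aa mulr0.
Qed.

Lemma exp_dzE a x e : exp_dz z phi a x e =
  match e with inl g => (g == a)%:R | inr g => phi_comp a g x end.
Proof.
rewrite /exp_dz iop_dz /dz_mform ffunE; case: e => [g|g]; last by rewrite add0r.
by rewrite addr0.
Qed.

Lemma lie_anti q (f : X -> coform R 'I_n q) x (J : {ffun 'I_q.+1 -> 'I_n}) :
  anti_part (lie z phi (anti_mform f)) x J = \sum_(i < q.+1) (-1) ^+ i *
    \sum_a phi_comp a (J i) x * wp false z a (fun y => f y (del i J)) x.
Proof.
have antiE y (K : {ffun 'I_q -> 'I_n}) : anti_mform f y [ffun k => inr (K k)] = f y K.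
  rewrite /anti_mform (bigD1 K) //= eqxx mul1r big1 ?addr0 // => K' KK.
  case: eqP => [/ffunP h|_]; last by rewrite mul0r.
  by case/eqP: KK; apply/ffunP => k; have := h k; rewrite !ffunE => -[].
have delE i : del i [ffun k => inr (J k)] = [ffun k => inr (del i J k)] :> {ffun 'I_q -> 'I_n + 'I_n}.
  by apply/ffunP => k; rewrite !ffunE.
(* The image of del has no component of type (0, q+1). *)
rewrite /anti_part /lie [X in _ - X](_ : _ = 0) ?subr0; last first.
  by rewrite /del_mform big1 // => i _; rewrite ffunE mulr0.
rewrite /iop /wedgel exchange_big /=; apply: eq_bigr => i _.
rewrite mulr_sumr; apply: eq_bigr => a _; rewrite ffunE delE; congr (_ * (_ * _)).
rewrite /del_mform big_ord_recl push0 expr0 mul1r big1 ?addr0; last first.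
  by move=> k _; rewrite push_lift ffunE mulr0.
rewrite pd_wp del_push; congr (wp _ _ _ _ x); apply/funext => y; exact: antiE.
Qed.

Lemma frame_pairing_Tan x g b a :
  frame_pairing z phi (E := Tan) x g b a = - wp false z a (phi_comp b g) x.
Proof.
rewrite /= /bracket /wedgel /wedger.
under eq_bigr => a' _ do rewrite !big_ord1 /= subnn !expr0 !mul1r !ffunE pd_wp
  (@wp_const_fun _ _ _ (fun _ => (b == a)%:R)) // mulr0 sub0r pd_wp.
rewrite (bigD1 a) //= eqxx mul1r big1 ?addr0 // => a' /negbTE aa.
by rewrite aa mul0r oppr0.
Qed.

Lemma del_mform2 (b : X -> coform R ('I_n + 'I_n)%type 1) x
    (K : {ffun 'I_2 -> ('I_n + 'I_n)%type}) (g b' : 'I_n) :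
  K ord0 = inr g -> K (lift ord0 ord0) = inl b' ->
  del_mform z b x K = - wp false z b' (fun y => b y (del (lift ord0 ord0) K)) x.
Proof.
move=> k0 k1; rewrite /del_mform big_ord_recl k0 [X in X + _]mulr0 add0r.
by rewrite big_ord1 k1 expr1 mulN1r pd_wp.
Qed.

(** As dz^a is del-closed, only - del phi^a remains. Its component at ([inr g], [inl b]), with the
    antiholomorphic index first, brings a second sign. *)
Lemma frame_pairing_Cot x g b a :
  frame_pairing z phi (E := Cot) x g b a = wp false z b (phi_comp a g) x.
Proof.
rewrite /= /lie; set K := [ffun i => _].
have dz0 K' y : del_mform z (dz_mform a : X -> coform R _ 1) y K' = 0.
  rewrite /del_mform big1 // => i _; case: (K' i) => [a'|_]; last by rewrite mulr0.
  by rewrite pd_wp wp_const_fun ?mulr0.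
rewrite [X in X - _](_ : _ = 0) ?sub0r; last first.
  rewrite /iop /wedgel big1 // => a' _; rewrite big1 // => i _.
  by rewrite dz0 !mulr0.
rewrite (@del_mform2 _ _ K g b) ?ffunE // opprK.
have dK : del (lift ord0 ord0) K = [ffun=> inr g].
  by apply/ffunP => k; rewrite (ord1 k) !ffunE.
by congr (wp _ _ _ _ x); apply/funext => y; rewrite dK iop_dz.
Qed.

Definition frame_psi_of x g := frame_psi z x phi_comp g.

Lemma frame_pairingE E x g (b a : idx n E) : frame_pairing z phi x g b a =
  dinduced (frame_psi_of x g) (- (frame_psi_of x g)^T) b a.
Proof.
elim: E b a => [b a|b a|E1 ih1 E2 ih2 b a|p E ih b a].
- by rewrite frame_pairing_Tan /= mxE.
- by rewrite frame_pairing_Cot /= 3!mxE opprK.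
- by rewrite /= ih1 ih2.
by apply: eq_bigr => i _; congr (_ * _); exact: ih.
Qed.

Lemma pairingE A q E (s : eform R X n q E) x : A z -> dom z x ->
  pairing A phi s z x = fun J b => \sum_(i < q.+1) (-1) ^+ i *
    (\sum_a phi_comp a (J i) x * wp false z a (fun y => s z y (del i J) b) x +
     \sum_c dinduced (frame_psi_of x (J i)) (- (frame_psi_of x (J i))^T) b c *
        s z x (del i J) c).
Proof.
move=> Az zx; rewrite /pairing on_atlas_in //; apply/funext => J; apply/funext => b.
rewrite lie_anti.
under [RHS]eq_bigr => i _ do rewrite mulrDr.
rewrite [RHS]big_split /=; congr (_ + _).
rewrite /wedger exchange_big mulr_sumr /=; apply: eq_bigr => i _.
rewrite mulr_sumr mulr_sumr; apply: eq_bigr => c _.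
have iq : (i <= q)%N by rewrite -ltnS.
(* The sign of the Leibniz rule cancels the one of [wedger] up to (-1)^i, the sign of a wedge from
   the left. *)
have -> : (-1) ^+ q = (-1) ^+ (q - i) * (-1) ^+ i :> C R by rewrite -exprD subnK.
have : (-1) ^+ (q - i) * (-1) ^+ (q - i) = 1 :> C R by rewrite -expr2 sqrr_sign.
rewrite frame_pairingE.
move: ((-1) ^+ (q - i)) ((-1) ^+ i) (dinduced _ _ _ _) (s z x _ c) => e1 e2 x1 x2 ee.
transitivity ((e1 * e1) * (e2 * (x1 * x2))); first by ring.
by rewrite ee mul1r.
Qed.

End Pairing.

(** * The extension operator and its inverse *)

Section ExtensionOperator.
Context {R : realType} {X : topologicalType} {n : nat}.
Variables A B : set (chart R X n).
Hypotheses (hA : holomorphic_atlas A) (hB : holomorphic_atlas B).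
Hypothesis AB : forall z w x, A z -> B w -> dom z x -> dom w x -> smt z w x /\ smt w z x.
Hypothesis M_unit : forall z w x, A z -> B w -> dom z x -> dom w x ->
  frame_M z w x \in unitmx.

Local Notation phi := (beltrami A B).

Lemma chartA z : A z -> is_chart z. Proof. by have [h _ _] := hA; exact: h. Qed.
Lemma chartB w : B w -> is_chart w. Proof. by have [h _ _] := hB; exact: h. Qed.

Definition dbar_coords (z w : chart R X n) x : 'M[C R]_n :=
  \matrix_(i, b) wp true z b (zc w i) x.

Lemma mixed_cocycles_left z z' w x : A z -> A z' -> B w ->
  dom z x -> dom z' x -> dom w x ->
  frame_Q z w x = frame_Q z' w x *m frame_Q z z' x /\
  frame_M z w x = frame_M z' w x *m frame_M z z' x.
Proof.
move=> Az Az' Bw zx zx' wx; have [_ _ sh] := hA.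
have [s1 h1] := sh z z' x Az Az' zx zx'; have [s2 h2] := sh z' z x Az' Az zx' zx.
have [s3 s4] := AB Az' Bw zx' wx.
have cz := chartA Az; have cz' := chartA Az'; have cw := chartB Bw.
by split; [apply: cocycle_Q|apply: cocycle_M] => //; left.
Qed.

Lemma mixed_cocycles_right z w w' x : A z -> B w -> B w' ->
  dom z x -> dom w x -> dom w' x ->
  frame_Q z w' x = frame_Q w w' x *m frame_Q z w x /\
  frame_M z w' x = frame_M w w' x *m frame_M z w x.
Proof.
move=> Az Bw Bw' zx wx wx'; have [_ _ sh] := hB.
have [s1 h1] := sh w w' x Bw Bw' wx wx'; have [s2 h2] := sh w' w x Bw' Bw wx' wx.
have [s3 s4] := AB Az Bw zx wx.
have cz := chartA Az; have cw' := chartB Bw'; have cw := chartB Bw.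
by split; [apply: cocycle_Q|apply: cocycle_M] => //; right.
Qed.

Lemma dbar_coords_right z w w' x : A z -> B w -> B w' ->
  dom z x -> dom w x -> dom w' x ->
  dbar_coords z w' x = frame_M w w' x *m dbar_coords z w x.
Proof.
move=> Az Bw Bw' zx wx wx'; have [_ _ sh] := hB.
have [s1 h1] := sh w w' x Bw Bw' wx wx'.
have [s3 s4] := AB Az Bw zx wx.
apply/matrixP => i b; rewrite !mxE.
rewrite (wp_transition (chartA Az) (chartB Bw) zx wx s3 true b (s1 i 1)).
by apply: eq_bigr => l _; rewrite !mxE h1 mul0r addr0.
Qed.

Lemma invmx_mul_left (W M : 'M[C R]_n) : W \in unitmx -> M \in unitmx ->
  invmx (W *m M) *m W = invmx M.
Proof.
move=> Wu Mu; rewrite -[LHS](mulmxK Mu) -(mulmxA _ W M) mulVmx ?mul1mx //.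
by rewrite unitmx_mul Wu Mu.
Qed.

Lemma invmx_mul_right (M W : 'M[C R]_n) : M \in unitmx -> W \in unitmx ->
  W *m invmx (M *m W) = invmx M.
Proof.
move=> Mu Wu; rewrite -[LHS](mulKmx Mu) (mulmxA M W) mulmxV ?mulmx1 //.
by rewrite unitmx_mul Wu Mu.
Qed.

(** Changing [w] multiplies both dw/dz and dw/d(conj z) on the left by the same invertible matrix,
    which cancels; so any chart of [B] may replace the one chosen by [chart_at]. *)
Lemma beltramiE z w x : A z -> B w -> dom z x -> dom w x -> forall a g,
  phi_comp z phi a g x = (invmx (frame_M z w x) *m dbar_coords z w x) a g.
Proof.
move=> Az Bw zx wx a g; rewrite /phi_comp /beltrami on_atlas_in //=.
have [Bw' wx'] := chart_atP z x hB; move: (chart_at B z x) Bw' wx' => w' Bw' wx'.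
rewrite ffunE.
have -> : (\matrix_(i, b) pd z (zc w' i) b x : 'M[C R]_n) = frame_M z w' x.
  by apply/matrixP => i j; rewrite !mxE pd_wp.
have -> : (\matrix_(i, b) pdb z (zc w' i) b x : 'M[C R]_n) = dbar_coords z w' x.
  by apply/matrixP => i j; rewrite !mxE pdb_wp.
rewrite (dbar_coords_right Az Bw Bw' zx wx wx').
have [_ ->] := mixed_cocycles_right Az Bw Bw' zx wx wx'.
have Mu := M_unit Az Bw zx wx; have [Wu _] := atlas_frame_M_unit hB Bw Bw' wx wx'.
congr (fun D : 'M[C R]_n => D a g); rewrite !mulmxA; congr (_ *m _).
exact: invmx_mul_left.
Qed.

(** By the definition of phi, sum_a (dw^b/dz^a) (dz^a + phi^a) = dw^b. Hence the coefficients of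
    e^{i_phi} dz^a on the dw^b form the inverse transpose of dw/dz. *)
Lemma extension_cotangent z w x : A z -> B w -> dom z x -> dom w x ->
  \matrix_(b, a) \sum_(g < n)
     (exp_dz z phi a x (inl g) * pd w (zc z g) b x +
      exp_dz z phi a x (inr g) * pd w (zbc z g) b x) = (invmx (frame_M z w x))^T.
Proof.
move=> Az Bw zx wx; set Ot := \matrix_(b, a) _.
have Mu := M_unit Az Bw zx wx; have [zw wz] := AB Az Bw zx wx.
suff h : frame_M z w x *m Ot^T = 1%:M.
  by rewrite -[Ot]trmxK -[Ot^T](mulKmx Mu) h mulmx1.
apply/matrixP => b' b; rewrite mxE.
have h0 := wp_zc (chartB Bw) wx false b' b.
rewrite (wp_transition (chartB Bw) (chartA Az) wx zx wz false b (zw b' 1)) in h0.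
rewrite [RHS]mxE eq_sym -h0.
transitivity (\sum_a \sum_g (frame_M z w x b' a * (g == a)%:R * wp false w b (zc z g) x +
    frame_M z w x b' a * phi_comp z phi a g x * wp false w b (zbc z g) x)).
  apply: eq_bigr => a _; rewrite !mxE mulr_sumr; apply: eq_bigr => g _.
  by rewrite !exp_dzE !pd_wp mulrDr !mulrA.
rewrite exchange_big; apply: eq_bigr => g _; rewrite /= big_split /=; congr (_ + _).
  rewrite -mulr_suml; congr (_ * _).
  under eq_bigr do rewrite eq_sym.
  by rewrite sum_delta_r mxE.
rewrite -mulr_suml; congr (_ * _).
have := congr1 (fun D : 'M[C R]_n => D b' g) (mulKVmx Mu (dbar_coords z w x)).
rewrite [RHS]mxE mxE => <-; apply: eq_bigr => a _.
by rewrite (beltramiE Az Bw).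
Qed.

Lemma extension_transport q E (s : eform R X n q E) : extension A B phi q E s =
  transport A B frame_Q frame_M (fun z w x => (invmx (frame_M z w x))^T) s.
Proof.
apply/funext => w; apply/funext => x; rewrite /extension /transport.
case: (pselect (B w /\ dom w x)) => [[Bw wx]|h]; last by rewrite !on_atlas_out.
rewrite !on_atlas_in //=; have [Az zx] := chart_atP w x hA.
rewrite (extension_cotangent Az Bw zx wx).
by congr (act _ _ _ _); apply/matrixP => i j; rewrite !mxE ?pdb_wp ?pd_wp.
Qed.

Lemma mixed_units z w x : A z -> B w -> dom z x -> dom w x ->
  frame_Q z w x \in unitmx /\ frame_M z w x \in unitmx.
Proof.
move=> Az Bw zx wx; have Mu := M_unit Az Bw zx wx; split=> //.
have [zw wz] := AB Az Bw zx wx.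
exact: (frame_Q_unit (chartA Az) (chartB Bw) zx wx zw wz Mu).
Qed.

Lemma atlas_units (D : set (chart R X n)) c d x : holomorphic_atlas D -> D c -> D d -> dom c x -> dom d x ->
  frame_Q c d x \in unitmx /\ frame_M c d x \in unitmx.
Proof.
move=> hD Dc Dd cx dx; split; last by have [] := atlas_frame_M_unit hD Dc Dd cx dx.
by have [] := mulmx1_unit (atlas_frame_Q_inv hD Dc Dd cx dx).
Qed.

Lemma frame_smooth z w x i j : A z -> B w -> dom z x -> dom w x ->
  [/\ sm z (fun y => frame_Q z w y i j) x, sm z (fun y => frame_M z w y i j) x &
      sm z (fun y => (invmx (frame_M z w y))^T i j) x].
Proof.
move=> Az Bw zx wx; have [zw wz] := AB Az Bw zx wx.
have cz := chartA Az; have cw := chartB Bw; have Mu := M_unit Az Bw zx wx.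
split; [exact: (sm_frame_Q cz cw zx wx zw wz)|exact: (sm_frame_M cz zx zw)|].
exact: (sm_frame_O cz zx zw Mu).
Qed.

Lemma extension_A0 q E (s : eform R X n q E) : A0 A q E s ->
  A0 B q E (extension A B phi q E s).
Proof.
rewrite extension_transport; apply: (transport_A0 hA hB).
- by move=> z w x Az Bw zx wx; have [] := AB Az Bw zx wx.
- move=> z w x i j Az Bw zx wx; have [zw wz] := AB Az Bw zx wx.
  have [s1 s2 s3] := frame_smooth i j Az Bw zx wx.
  by split; apply: (sm_transition (chartB Bw) (chartA Az) wx zx wz).
- move=> z z' w x Az Az' Bw zx zx' wx.
  have [e1 e2] := mixed_cocycles_left Az Az' Bw zx zx' wx; split=> //.
  have [_ M1] := mixed_units Az' Bw zx' wx; have [_ M2] := atlas_units hA Az Az' zx zx'.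
  rewrite -trmx_mul e2; congr (_^T); rewrite -(invmx_mul_right M1 M2).
  by rewrite mulKmx.
move=> z w w' x Az Bw Bw' zx wx wx'.
have [e1 e2] := mixed_cocycles_right Az Bw Bw' zx wx wx'; split=> //.
have [_ M1] := mixed_units Az Bw zx wx; have [_ M2] := atlas_units hB Bw Bw' wx wx'.
rewrite -trmx_mul e2; congr (_^T); rewrite -(invmx_mul_left M2 M1).
by rewrite mulmxK.
Qed.

Lemma extensionE q E (s : eform R X n q E) z w x : A0 A q E s ->
  A z -> B w -> dom z x -> dom w x ->
  extension A B phi q E s w x = frame_act z w x (s z x).
Proof.
rewrite extension_transport => As Az Bw zx wx.
apply: (transportE hA _ As Az Bw zx wx) => z0 z' w0 y Az0 Az' Bw0 zy zy' wy.
have [e1 e2] := mixed_cocycles_left Az0 Az' Bw0 zy zy' wy; split=> //.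
have [_ M1] := mixed_units Az' Bw0 zy' wy; have [_ M2] := atlas_units hA Az0 Az' zy zy'.
rewrite -trmx_mul e2; congr (_^T); rewrite -(invmx_mul_right M1 M2).
by rewrite mulKmx.
Qed.

(** The inverse of rho, itself a transport in the opposite direction; it provides surjectivity onto
    [A0 B]. *)
Definition unextension q E : eform R X n q E -> eform R X n q E :=
  transport B A (fun w z x => invmx (frame_Q z w x)) (fun w z x => invmx (frame_M z w x))
    (fun w z x => (frame_M z w x)^T) (E := E).

Lemma unextension_left w w' z x : B w -> B w' -> A z -> dom w x -> dom w' x -> dom z x ->
  [/\ invmx (frame_Q z w x) = invmx (frame_Q z w' x) *m frame_Q w w' x,
      invmx (frame_M z w x) = invmx (frame_M z w' x) *m frame_M w w' x &
      (frame_M z w x)^T = (frame_M z w' x)^T *m (invmx (frame_M w w' x))^T].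
Proof.
move=> Bw Bw' Az wx wx' zx.
have [e1 e2] := mixed_cocycles_right Az Bw Bw' zx wx wx'.
have [Q1 M1] := mixed_units Az Bw zx wx; have [Q2 M2] := atlas_units hB Bw Bw' wx wx'.
rewrite e1 e2; split; [by rewrite invmx_mul_left|by rewrite invmx_mul_left|].
by rewrite -trmx_mul mulKmx.
Qed.

Lemma unextension_A0 q E (r : eform R X n q E) : A0 B q E r -> A0 A q E (unextension r).
Proof.
apply: (transport_A0 hB hA).
- by move=> w z x Bw Az wx zx; have [] := AB Az Bw zx wx.
- move=> w z x i j Bw Az wx zx; have [Qu Mu] := mixed_units Az Bw zx wx.
  have fs k l := frame_smooth k l Az Bw zx wx; have cz := chartA Az.
  split; [apply: sm_invmx => // k l; by have [] := fs k l|
          apply: sm_invmx => // k l; by have [] := fs k l|].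
  have [_ h _] := fs j i; apply: sm_eq h => //.
  by apply: filterE => y; rewrite [RHS]mxE.
- by move=> w w' z x Bw Bw' Az wx wx' zx; exact: unextension_left.
move=> w z z' x Bw Az Az' wx zx zx'.
have [e1 e2] := mixed_cocycles_left Az Az' Bw zx zx' wx.
have [Q1 M1] := mixed_units Az' Bw zx' wx; have [Q2 M2] := atlas_units hA Az Az' zx zx'.
rewrite e1 e2; split; [by rewrite invmx_mul_right|by rewrite invmx_mul_right|].
by rewrite -trmx_mul mulmxK.
Qed.

Lemma frame_act_inj z w x q E (v v' : ecomps R n q E) :
  A z -> B w -> dom z x -> dom w x ->
  frame_act z w x v = frame_act z w x v' -> v = v'.
Proof.
move=> Az Bw zx wx h; have [Qu Mu] := mixed_units Az Bw zx wx.
have inv (u : ecomps R n q E) : u = act (invmx (frame_Q z w x)) (invmx (frame_M z w x))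
    (frame_M z w x)^T (frame_act z w x u).
  by rewrite /frame_act act_mul !mulVmx // -trmx_mul mulVmx // trmx1 act_scalar1.
by rewrite [v]inv [v']inv h.
Qed.

Lemma extension_inj q E (s s' : eform R X n q E) : A0 A q E s -> A0 A q E s' ->
  extension A B phi q E s = extension A B phi q E s' -> s = s'.
Proof.
move=> As As' h; have [on _ _ _ _] := As; have [on' _ _ _ _] := As'.
apply: (A0_ext on on') => z x Az zx.
have [_ /(_ x)[w Bw wx] _] := hB.
by apply: (frame_act_inj Az Bw zx wx); rewrite -!extensionE // h.
Qed.

Lemma unextensionK q E (r : eform R X n q E) : A0 B q E r ->
  extension A B phi q E (unextension r) = r.
Proof.
move=> Br; have Au := unextension_A0 Br.
have [on1 _ _ _ _] := extension_A0 Au; have [on2 _ _ _ _] := Br.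
apply: (A0_ext on1 on2) => w x Bw wx; have [_ /(_ x)[z Az zx] _] := hA.
have [Qu Mu] := mixed_units Az Bw zx wx.
rewrite (extensionE Au Az Bw zx wx) /unextension (transportE hB _ Br Bw Az wx zx).
  by rewrite /frame_act act_mul !mulmxV // -trmx_mul mulmxV // trmx1 act_scalar1.
by move=> *; exact: unextension_left.
Qed.

Lemma extension_bij q E : set_bij (A0 A q E) (A0 B q E) (extension A B phi q E).
Proof.
split.
- by move=> s; exact: extension_A0.
- by move=> s s' /set_mem As /set_mem As'; exact: extension_inj.
by move=> r Br; exists (unextension r); [exact: unextension_A0|exact: unextensionK].
Qed.

Lemma dolbeault_extension q E (s : eform R X n q E) z w x : A0 A q E s ->
  A z -> B w -> dom z x -> dom w x ->
  dolbeault B (extension A B phi q E s) w x =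
  frame_act z w x ((dolbeault A s - pairing A phi s) z x).
Proof.
move=> As Az Bw zx wx; have [zw wz] := AB Az Bw zx wx.
have cz := chartA Az; have cw := chartB Bw; have Mu := M_unit Az Bw zx wx.
have [_ s2 _ s4 _] := As.
have ss J a : sm z (fun y => s z y J a) x.
  exact: (smooth_on_chart (fun y => s z y J a) cz).1 (s2 z J a Az) x zx.
have near_zw : \forall y \near x, dom z y /\ dom w y.
  by apply: filterS2 (near_dom cz zx) (near_dom cw wx).
(* The chart of [B] inside [beltrami] varies with the point; near [x] it is replaced by the fixed
   chart [w], where smoothness is visible. *)
have sphi a j : sm z (phi_comp z phi a j) x.
  apply: (@sm_eq _ _ _ z x cz zx (fun y =>
      \sum_k invmx (frame_M z w y) a k * wp true z j (zc w k) y)).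
    apply: filterS near_zw => y [zy wy]; rewrite (beltramiE Az Bw zy wy) [RHS]mxE.
    by apply: eq_bigr => k _; rewrite [dbar_coords z w y k j]mxE.
  apply: smooth_sum => k; apply: smoothM.
    by apply: sm_invmx => // i l; have [] := frame_smooth i l Az Bw zx wx.
  exact: (sm_wp cz zx true j (zw k)).
have phiP : \forall y \near x, forall b j, wp true z j (zc w b) y =
    \sum_a phi_comp z phi a j y * frame_M z w y b a.
  apply: filterS near_zw => y [zy wy] b j.
  have := congr1 (fun D : 'M[C R]_n => D b j)
    (mulKVmx (M_unit Az Bw zy wy) (dbar_coords z w y)).
  rewrite [RHS]mxE mxE => <-; apply: eq_bigr => a _.
  by rewrite (beltramiE Az Bw zy wy) mulrC.
rewrite (dolbeaultE _ Bw wx).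
rewrite (dolbeault_frame_change cz cw zx wx zw wz sphi Mu phiP ss (s4 z x)); last first.
  by apply: filterS near_zw => y [zy wy]; exact: extensionE.
rewrite /frame_act; congr (act _ _ _ _).
have -> : (dolbeault A s - pairing A phi s) z x =
  (fun J b => dolbeault A s z x J b - pairing A phi s z x J b) by [].
apply/funext => J; apply/funext => b.
rewrite (dolbeaultE _ Az zx) (pairingE _ _ Az zx) -sumrB; apply: eq_bigr => i _.
by rewrite -mulrBr /twisted opprD addrA.
Qed.

(** The form [s'] is identified chartwise with the inverse image under rho of dbar_t (rho s), which
    is known to be a global form; this avoids checking how [pairing] behaves under changes of
    chart. *)
Theorem extension_conjugates_dolbeault q E (s : eform R X n q E) : A0 A q E s ->
  A0 A q.+1 E (dolbeault A s - pairing A phi s) /\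
  extension A B phi q.+1 E (dolbeault A s - pairing A phi s) = dolbeault B (extension A B phi q E s).
Proof.
move=> As; set s' := dolbeault A s - _.
have BD : A0 B q.+1 E (dolbeault B (extension A B phi q E s)).
  by apply: dolbeault_A0 => //; exact: extension_A0.
have Au := unextension_A0 BD; have uK := unextensionK BD.
suff -> : s' = unextension (dolbeault B (extension A B phi q E s)) by [].
have [on _ _ _ _] := Au.
have on' : on_atlas A s' = s'.
  apply/funext => z; apply/funext => x; case: (pselect (A z /\ dom z x)) => [[Az zx]|h].
    by rewrite on_atlas_in.
  rewrite on_atlas_out //; apply/funext => J; apply/funext => a.
  have -> : s' z x J a = dolbeault A s z x J a - pairing A phi s z x J a by [].
  by rewrite /dolbeault /pairing !on_atlas_out // subrr.
apply: (A0_ext on' on) => z x Az zx; have [_ /(_ x)[w Bw wx] _] := hB.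
apply: (frame_act_inj Az Bw zx wx).
by rewrite -(extensionE Au) // uK (dolbeault_extension As Az Bw zx wx).
Qed.

End ExtensionOperator.

(** * Adapted charts of an analytic family *)

Section HolomorphicTransitions.
Context {R : realType} {X : topologicalType} {n : nat}.
Implicit Types (c d e : chart R X n) (x : X).

Lemma open_coord_image c (S : set X) : is_chart c -> open S ->
  open (coord c @` (dom c `&` S)).
Proof.
move=> hc oS; rewrite openE => _ [x [cx Sx] <-].
have nS : \forall y \near x, S y by exact: open_nbhs_nbhs.
apply: filterS2 (near_img hc cx) (near_param hc cx nS) => u hu Su.
by have [k1 k2] := chart_imgK hc hu; exists (param c u).
Qed.

Lemma holo_transitionP c d : is_chart c -> open (dom d) ->
  holo_transition c d <-> forall x, dom c x -> dom d x -> smt c d x /\ hol c d x.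
Proof.
move=> hc od; have oi := open_coord_image hc od.
split.
  move=> h x cx dx.
  have ux : (coord c @` (dom c `&` dom d)) (coord c x) by exists x.
  split=> [i|i j]; have [h1 h2] := h i; first by have /(smooth_onP _ oi) := h1; apply.
  by have := h2 _ j ux; rewrite dzb_wd.
move=> h i; split; first by apply/(smooth_onP _ oi) => _ [x [cx dx] <-]; have [h1 _] := h x cx dx; exact: (h1 i).
by move=> _ j [x [cx dx] <-]; rewrite dzb_wd; have [_] := h x cx dx; apply.
Qed.

Lemma hol_trans c d e x : is_chart c -> is_chart d -> dom c x -> dom d x ->
  smt c d x -> smt d e x -> hol c d x -> hol d e x -> hol c e x.
Proof.
move=> hc hd cx dx scd sde hcd hde i j.
rewrite (wp_transition hc hd cx dx scd true j (sde i 1)) big1 // => l _.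
by rewrite hcd hde mulr0 mul0r addr0.
Qed.

Lemma max_atlas_transition (A : set (chart R X n)) c d x :
  (forall d, A d -> is_chart d) -> (forall x, exists2 d, A d & dom d x) ->
  is_chart c -> is_chart d ->
  (forall e, A e -> holo_transition c e /\ holo_transition e c) ->
  (forall e, A e -> holo_transition d e /\ holo_transition e d) ->
  dom c x -> dom d x -> smt c d x /\ hol c d x.
Proof.
move=> hA covA hc hd hce hde cx dx; have [e Ae ex] := covA x.
have he := hA e Ae; have oe : open (dom e) by case: he.
have od : open (dom d) by case: hd.
have [/(holo_transitionP hc oe) /(_ x cx ex)[s1 h1] _] := hce e Ae.
have [_ /(holo_transitionP he od) /(_ x ex dx)[s2 h2]] := hde e Ae.
by split; [exact: smt_trans s2|exact: hol_trans h1 h2].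
Qed.

(* The chart H o (coord c), for a local biholomorphism H with inverse K. *)
Section Recoordinatize.
Variables (c : chart R X n) (V : set 'rV[C R]_n) (H K : 'rV[C R]_n -> 'rV[C R]_n).
Hypotheses (hc : is_chart c) (oV : open V) (VU : V `<=` chart_img c) (oHV : open (H @` V)).
Hypothesis KH : forall u, V u -> K (H u) = u.
Hypotheses (sH : forall u i, V u -> smooth (fun v => H v 0 i) u)
  (hH : forall u i j, V u -> wd true j (fun v => H v 0 i) u = 0)
  (sK : forall y i, (H @` V) y -> smooth (fun v => K v 0 i) y)
  (hK : forall y i j, (H @` V) y -> wd true j (fun v => K v 0 i) y = 0).

Definition recoord : chart R X n :=
  Chart [set x | dom c x /\ V (coord c x)] (fun x => H (coord c x)) (fun u => param c (K u)).

Lemma recoord_img : chart_img recoord = H @` V.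
Proof.
apply/seteqP; split=> [_ [x [cx Vx] <-]|_ [u Vu <-]]; first by exists (coord c x).
have [e1 e2] := chart_imgK hc (VU Vu).
by exists (param c u); rewrite /= ?e1.
Qed.

Lemma recoord_is_chart : is_chart recoord.
Proof.
have [oc oi cc cp pK] := hc; split.
- rewrite openE => x [cx Vx].
  have nV : \forall u \near coord c x, V u by exact: open_nbhs_nbhs.
  by apply: filterS2 (near_dom hc cx) (near_coord hc cx nV) => y.
- by rewrite recoord_img.
- move=> x [cx Vx]; apply: continuous_comp; first exact: cc.
  by apply/continuousVP => i; exact: germ_C_continuous (sH i Vx 0).
- rewrite recoord_img => y hy; have [u Vu uy] := hy.
  apply: continuous_comp; first by apply/continuousVP => i; exact: germ_C_continuous (sK i hy 0).
  by apply: cp; rewrite -uy KH //; exact: VU.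
by move=> x [cx Vx] /=; rewrite KH // pK.
Qed.

Lemma recoord_transition x : dom recoord x ->
  [/\ smt recoord c x, hol recoord c x, smt c recoord x & hol c recoord x].
Proof.
move=> rx; have [cx Vx] := rx.
have hy : (H @` V) (H (coord c x)) by exists (coord c x).
have e1 i : \forall y \near H (coord c x),
    K y 0 i = zc c i (param recoord y).
  have ny : \forall y \near H (coord c x), (H @` V) y by exact: open_nbhs_nbhs.
  apply: filterS ny => _ [u Vu <-].
  by rewrite /zc /= KH // (chart_imgK hc (VU Vu)).1.
have e2 i : \forall u \near coord c x, H u 0 i = zc recoord i (param c u).
  apply: filterS (near_img hc cx) => u hu.
  by rewrite /zc /= (chart_imgK hc hu).1.
split.
- by move=> i; exact: smooth_eq (e1 i) (sK i hy).
- by move=> i j; rewrite /wp (wd_eq true j (sK i hy 1) (e1 i)) hK.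
- by move=> i; exact: smooth_eq (e2 i) (sH i Vx).
by move=> i j; rewrite /wp (wd_eq true j (sH i Vx 1) (e2 i)) hH.
Qed.

End Recoordinatize.

End HolomorphicTransitions.

Section AdaptedCharts.
Context {R : realType} {n k : nat} (P : analyticFamily R n k).

(** The columns of [L] span a complement of the column space of [J], of dimension [p] by the
    rank. *)
Lemma complete_basis p m (J : 'M[C R]_(p + m, m)) : \rank J = m ->
  exists L : 'M[C R]_(p + m, p), row_mx L J \in unitmx.
Proof.
move=> rJ.
have rC : \rank ((J^T)^C)%MS = p by rewrite mxrank_compl mxrank_tr rJ addnK.
have [K eK] : exists K : 'M[C R]_(p, p + m), (K :=: (J^T)^C)%MS.
  exists (castmx (rC, erefl) (row_base (J^T)^C)%MS).
  by apply: eqmx_trans (eqmx_cast _ _) (eq_row_base _).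
exists K^T; rewrite -unitmx_tr tr_row_mx trmxK -row_full_unit -sub1mx.
rewrite -addsmxE (adds_eqmx eK (eqmx_refl J^T)) sub1mx addsmxC.
exact: addsmx_compl_full.
Qed.

Lemma proj_smooth W p i : atlas W -> dom W p ->
  sm W (fun q : P => proj q 0 i) p /\ forall j, wp true W j (fun q : P => proj q 0 i) p = 0.
Proof.
move=> AW Wp; have [hA _ _] := atlas_holo P; have hW := hA W AW.
have [h1 h2] := proj_holo (a := P) i AW; have Ip : chart_img W (coord W p) by exists p.
split; first by have [_ oi _ _ _] := hW; have /(smooth_onP _ oi) := h1; apply.
by move=> j; have := h2 _ j Ip; rewrite dzb_wd.
Qed.

Lemma adapted_transition (W W' : chart R P (n + k)) p : adapted W -> adapted W' -> dom W p -> dom W' p ->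
  smt W W' p /\ hol W W' p.
Proof.
move=> [[hW tW] _] [[hW' tW'] _] Wp W'p; have [hA _ cov] := atlas_holo P.
exact: (max_atlas_transition hA cov hW hW' tW tW' Wp W'p).
Qed.

Lemma adapted_atlas_transition (W d : chart R P (n + k)) p : adapted W -> atlas d -> dom W p -> dom d p ->
  smt W d p /\ smt d W p.
Proof.
move=> [[hW tW] _] Ad Wp dp; have [hA _ _] := atlas_holo P; have hd := hA d Ad.
have [t1 t2] := tW d Ad.
have oW : open (dom W) by case: hW.
have od : open (dom d) by case: hd.
have [s1 _] := (holo_transitionP hW od).1 t1 p Wp dp.
by have [s2 _] := (holo_transitionP hd oW).1 t2 p dp Wp.
Qed.

(* proj is completed to a chart by linear functions, with the inverse function theorem. *)
Theorem adapted_cover (p : P) : exists2 W : chart R P (n + k), adapted W & dom W p.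
Proof.
have [hA tA cov] := atlas_holo P; have [W0 AW0 W0p] := cov p.
have h0 := hA W0 AW0; have [_ oU _ _ _] := h0.
pose a := coord W0 p.
have Ua : chart_img W0 a by exists p.
pose J : 'M[C R]_(n + k, k) := \matrix_(j, i) wp false W0 j (fun q : P => proj q 0 i) p.
have rJ : \rank J = k.
  rewrite -mxrank_tr -[RHS](proj_submersion AW0 W0p); congr (\rank _).
  by apply/matrixP => i j; rewrite !mxE pd_wp.
have [L LJ] := complete_basis rJ.
pose H u : 'rV[C R]_(n + k) := row_mx (u *m L) (proj (param W0 u)).
have HL u i : H u 0 (lshift k i) = \sum_j u 0 j * L j i by rewrite row_mxEl mxE.
have HR u i : H u 0 (rshift n i) = proj (param W0 u) 0 i by rewrite row_mxEr.
have sH u i : chart_img W0 u -> smooth (fun v => H v 0 i) u /\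
    forall j, wd true j (fun v => H v 0 i) u = 0.
  move=> [q W0q <-]; case: (splitP i) => [i' ei|i' ei].
    have -> : i = lshift k i' by exact: val_inj.
    have -> : (fun v => H v 0 (lshift k i')) = (fun v => \sum_j v 0 j * L j i').
      by apply/funext => v; exact: HL.
    have st j : smooth (fun v : 'rV[C R]_(n + k) => v 0 j * L j i') (coord W0 q).
      exact: smoothM (smooth_coord j _) (smooth_cst _ _).
    split; first exact: smooth_sum.
    move=> j; rewrite wd_sum; last by move=> l; exact: (st l 1).
    rewrite big1 // => l _; rewrite wdM; [|exact: germ_C_coord|exact: germ_C_cst].
    by rewrite wd_coord wd_cst mul0r mulr0 addr0.
  have -> : i = rshift n i' by exact: val_inj.
  have -> : (fun v => H v 0 (rshift n i')) = (fun v => proj (param W0 v) 0 i').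
    by apply/funext => v; exact: HR.
  exact: proj_smooth.
have Ja : holo_jacobian H a \in unitmx.
  rewrite (_ : holo_jacobian H a = row_mx L J) //.
  apply/matrixP => l i; case: (splitP i) => [i' ei|i' ei].
    have -> : i = lshift k i' by exact: val_inj.
    have -> : holo_jacobian H a l (lshift k i') = wd false l (fun v => \sum_j v 0 j * L j i') a.
      by rewrite mxE; apply: (congr1 (fun f => wd false l f a)); apply/funext => v; exact: HL.
    rewrite row_mxEl wd_sum; last first.
      by move=> j; exact: germ_CM (germ_C_coord 1 j a) (germ_C_cst 1 _ a).
    rewrite (bigD1 l) //= big1 ?addr0 => [|j /negbTE jl];
      (rewrite wdM; [|exact: germ_C_coord|exact: germ_C_cst]);
      rewrite wd_coord wd_cst mulr0 addr0 /=; first by rewrite eqxx mul1r.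
    by rewrite eq_sym jl mul0r.
  have -> : i = rshift n i' by exact: val_inj.
  have -> : holo_jacobian H a l (rshift n i') = wd false l (fun v => proj (param W0 v) 0 i') a.
    by rewrite mxE; apply: (congr1 (fun f => wd false l f a)); apply/funext => v; exact: HR.
  by rewrite row_mxEr mxE.
have [V [K [oV Va VU oHV [KH sK hK]]]] := holo_inverse oU Ua (fun u i h => (sH u i h).1)
  (fun u i j h => (sH u i h).2 j) Ja.
have sHV u i : V u -> smooth (fun v => H v 0 i) u by move=> Vu; exact: (sH u i (VU _ Vu)).1.
have hHV u i j : V u -> wd true j (fun v => H v 0 i) u = 0.
  by move=> Vu; exact: (sH u i (VU _ Vu)).2.
have hr := recoord_is_chart h0 oV VU oHV KH sHV sK.
have tr := recoord_transition h0 VU oHV KH sHV hHV sK hK.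
exists (recoord W0 V H K); last by split.
split; last first.
  by move=> q [W0q _]; have [_ _ _ _ pK] := h0; rewrite /= row_mxKr pK.
split=> // d Ad; have hd := hA d Ad.
have od : open (dom d) by case: hd.
have or : open (dom (recoord W0 V H K)) by case: hr.
have o0 : open (dom W0) by case: h0.
split; apply/holo_transitionP => // q.
  move=> rq dq; have [r1 r2 _ _] := tr q rq; have W0q := rq.1.
  have [s1 s2] := (holo_transitionP h0 od).1 (tA W0 d AW0 Ad) q W0q dq.
  by split; [exact: smt_trans s1|exact: hol_trans r2 s2].
move=> dq rq; have [_ _ r1 r2] := tr q rq; have W0q := rq.1.
have [s1 s2] := (holo_transitionP hd o0).1 (tA d W0 Ad AW0) q dq W0q.
by split; [exact: smt_trans r1|exact: hol_trans s2 r2].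
Qed.

End AdaptedCharts.

(** * Slices of C^(n+k) at a fixed parameter *)

Section Slices.
Context {R : realType} {n k : nat}.
Implicit Types (u : 'rV[C R]_n) (t : 'rV[C R]_k) (v : 'rV[C R]_(n + k)).

Lemma absV_row_mx u t : absV (row_mx u t) = absV u + absV t.
Proof.
rewrite /absV big_split_ord; congr (_ + _); apply: eq_bigr => i _.
  by rewrite row_mxEl.
by rewrite row_mxEr.
Qed.

Lemma near_row_mx u t (Q : set 'rV[C R]_(n + k)) : (\forall v \near row_mx u t, Q v) ->
  \forall u' \near u, Q (row_mx u' t).
Proof.
move=> /nbhsVP[e e0 h]; apply/nbhsVP; exists e => // u' hu'; apply: h.
by rewrite opp_row_mx add_row_mx subrr absV_row_mx absV0 addr0.
Qed.

Lemma near_lsubmx v (Q : set 'rV[C R]_n) : (\forall u \near lsubmx v, Q u) ->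
  \forall v' \near v, Q (lsubmx v').
Proof.
move=> /nbhsVP[e e0 h]; apply/nbhsVP; exists e => // v' hv'; apply: h.
rewrite -linearB; apply: le_lt_trans hv'.
by rewrite -[X in _ <= absV X]hsubmxK absV_row_mx lerDl absV_ge0.
Qed.

Lemma near_rsubmx v (Q : set 'rV[C R]_k) : (\forall u \near rsubmx v, Q u) ->
  \forall v' \near v, Q (rsubmx v').
Proof.
move=> /nbhsVP[e e0 h]; apply/nbhsVP; exists e => // v' hv'; apply: h.
rewrite -linearB; apply: le_lt_trans hv'.
by rewrite -[X in _ <= absV X]hsubmxK absV_row_mx lerDr absV_ge0.
Qed.

Lemma smooth_row_mx u t i : smooth (fun u' => row_mx u' t 0 i : C R) u.
Proof.
case: (splitP i) => [i' ei|i' ei].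
  have -> : i = lshift k i' by exact: val_inj.
  apply: smooth_eq (smooth_coord i' u); apply: filterE => u'; by rewrite row_mxEl.
have -> : i = rshift n i' by exact: val_inj.
apply: smooth_eq (smooth_cst (t 0 i') u); apply: filterE => u'; by rewrite row_mxEr.
Qed.

Lemma smooth_slice (f : 'rV[C R]_(n + k) -> C R) u t : smooth f (row_mx u t) ->
  smooth (fun u' => f (row_mx u' t)) u.
Proof.
move=> h; apply: (smooth_comp (f := f) (g := fun u' => row_mx u' t)) => // i.
exact: smooth_row_mx.
Qed.

(** The inclusion of the slice is affine and holomorphic, so one term of the chain rule survives. *)
Lemma wd_slice b a (f : 'rV[C R]_(n + k) -> C R) u t : germ_C 1 f (row_mx u t) ->
  wd b a (fun u' => f (row_mx u' t)) u = wd b (lshift k a) f (row_mx u t).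
Proof.
move=> h.
have sr i : germ_C 1 (fun u' => row_mx u' t 0 i : C R) u by exact: smooth_row_mx.
have dl i c : wd c a (fun u' => row_mx u' t 0 (lshift k i) : C R) u = ((~~ c) && (a == i))%:R.
  rewrite -(wd_coord c a i u); apply: wd_eq; first exact: germ_C_coord.
  by apply: filterE => u'; rewrite row_mxEl.
have dr i c : wd c a (fun u' => row_mx u' t 0 (rshift n i) : C R) u = 0.
  rewrite -(wd_cst c a (t 0 i) u); apply: wd_eq; first exact: germ_C_cst.
  by apply: filterE => u'; rewrite row_mxEr.
rewrite [LHS](wd_comp b a (f := f) (g := fun u' => row_mx u' t) h sr).
rewrite big_split_ord /= [X in _ + X]big1 => [|i _]; last first.
  by rewrite wd_conj // !dr conjC0 !mulr0 addr0.
rewrite addr0 (bigD1 a) //= big1 => [|i /negbTE ia]; last first.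
  by rewrite wd_conj // !dl eq_sym ia !andbF conjC0 !mulr0 addr0.
rewrite addr0 wd_conj // !dl eqxx !andbT negbK dz_wd dzb_wd.
by case: b => /=; rewrite ?conjC0 ?conjC1 !(mulr0, mulr1, addr0, add0r).
Qed.

Lemma polydisc_near t : polydisc R k t -> \forall t' \near t, polydisc R k t'.
Proof.
move=> h; have h1 (j : 'I_k) : \forall t' \near t, `|(t' : 'rV[C R]_k) 0 j| < 1.
  have ob : open (ball (0 : C R) 1) by exact: ball_open.
  have hb : ball (0 : C R) 1 (t 0 j) by rewrite -ball_normE /= sub0r normrN; exact: h.
  have /nbhsCP[e e0 he] : nbhs (t 0 j) (ball (0 : C R) 1) by exact: open_nbhs_nbhs.
  apply/nbhsVP; exists e => // t' ht'.
  have : ball (0 : C R) 1 (t' 0 j).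
    apply: he; apply: le_lt_trans ht'.
    by have := absC_le_absV (t' - t) j; rewrite !mxE.
  by rewrite -ball_normE /= sub0r normrN.
have h2 : \forall t' \near t, forall j : 'I_k, `|(t' : 'rV[C R]_k) 0 j| < 1 by exact: filter_forall h1.
exact: h2.
Qed.

Lemma polydisc0 : polydisc R k 0.
Proof. by move=> j; rewrite mxE normr0 ltr01. Qed.

End Slices.

(** * The complex structures of the fibres *)

Section FibreCharts.
Context {R : realType} {n k : nat} (P : analyticFamily R n k) (T : trivialization P).
Local Notation X := (central_fibre P).
Local Notation F := (triv T).
Local Notation G := (triv_inv T).
Local Notation fc := (fibre_chart F G).
Implicit Types (W : chart R P (n + k)) (t : 'rV[C R]_k) (x : X) (p : P).

Lemma coord_triv W t x : adapted W -> polydisc R k t -> dom W (F x t) ->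
  coord W (F x t) = row_mx (coord (fc W t) x) t.
Proof.
by move=> [_ aW] ht Wx; rewrite -[LHS]hsubmxK (aW _ Wx) (proj_triv T).
Qed.

Lemma near_triv x t (Q : set P) : polydisc R k t -> (\forall p \near F x t, Q p) ->
  \forall y \near x & t' \near t, Q (F y t').
Proof. by move=> ht hQ; have h := @triv_continuous _ _ _ _ T x t ht; exact: h. Qed.

Lemma near_triv_fixed x t (Q : set P) : polydisc R k t -> (\forall p \near F x t, Q p) ->
  \forall y \near x, Q (F y t).
Proof.
move=> ht /(near_triv ht) [[S1 S2] [/= h1 h2] h].
by apply: filterS h1 => y Sy; apply: (h (y, t)); split=> //=; exact: nbhs_singleton h2.
Qed.

Lemma near_triv_inv p (Q : set X) : (\forall x \near G p, Q x) -> \forall q \near p, Q (G q).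
Proof. by move=> hQ; have h := @triv_inv_continuous _ _ _ _ T p; exact: h. Qed.

Lemma adapted_chart W : adapted W -> is_chart W.
Proof. by move=> [[]]. Qed.

Lemma fibre_chart_img W t : adapted W -> polydisc R k t ->
  chart_img (fc W t) = [set u | chart_img W (row_mx u t)].
Proof.
move=> aW ht; apply/seteqP; split=> [_ [x Wx <-]|u [p Wp pu]].
  by exists (F x t) => //; rewrite coord_triv.
have [_ hW] := aW; have pt : proj p = t by rewrite -(hW p Wp) pu row_mxKr.
have Fp : F (G p) t = p by rewrite -[in LHS]pt (triv_invK T).
by exists (G p); rewrite /= Fp // pu row_mxKl.
Qed.

Lemma fibre_chart_is_chart W t : adapted W -> polydisc R k t -> is_chart (fc W t).
Proof.
move=> aW ht; have hW := adapted_chart aW; have [oW oI cW cp pK] := hW; split.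
- rewrite openE => x Wx; apply: (near_triv_fixed ht (Q := dom W)).
  exact: near_dom.
- rewrite fibre_chart_img // openE => u Iu.
  by apply: (near_row_mx (Q := chart_img W)); exact: open_nbhs_nbhs.
- move=> x Wx S hS; change (\forall y \near x, S (lsubmx (coord W (F y t)))).
  apply: (near_triv_fixed ht (Q := fun p => S (lsubmx (coord W p)))).
  by apply: (near_coord hW Wx (Q := fun v => S (lsubmx v))); exact: near_lsubmx.
- rewrite fibre_chart_img // => u Iu S hS.
  change (\forall u' \near u, S (G (param W (row_mx u' t)))).
  apply: (near_row_mx (Q := fun v => S (G (param W v)))).
  exact: (cp _ Iu _ (near_triv_inv hS)).
move=> x Wx /=; rewrite -/(coord (fc W t) x) -coord_triv // pK //.
exact: (trivK T).
Qed.

Lemma triv_param W t u : adapted W -> polydisc R k t -> chart_img (fc W t) u ->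
  F (param (fc W t) u) t = param W (row_mx u t).
Proof.
move=> aW ht; rewrite fibre_chart_img // => Iu.
have [e1 e2] := chart_imgK (adapted_chart aW) Iu; have [_ hW] := aW.
rewrite /= -[X in F _ X](_ : proj (param W (row_mx u t)) = t) ?(triv_invK T) //.
by rewrite -(hW _ e2) e1 row_mxKr.
Qed.

Lemma fibre_chart_holo W W' t x : adapted W -> adapted W' -> polydisc R k t ->
  dom (fc W t) x -> dom (fc W' t) x ->
  smt (fc W t) (fc W' t) x /\ hol (fc W t) (fc W' t) x.
Proof.
move=> aW aW' ht Wx W'x; have hc := fibre_chart_is_chart aW ht.
have [s h] := adapted_transition aW aW' Wx W'x.
have e i : \forall u \near coord (fc W t) x,
    zc W' (lshift k i) (param W (row_mx u t)) = zc (fc W' t) i (param (fc W t) u).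
  apply: filterS (near_img hc Wx) => u hu.
  by rewrite /zc -(triv_param aW ht hu) /= mxE.
have si i : smooth (fun v => zc W' (lshift k i) (param W v)) (row_mx (coord (fc W t) x) t).
  by rewrite -coord_triv //; exact: s.
split=> i; first exact: smooth_eq (e i) (smooth_slice (si i)).
move=> j; rewrite /wp (wd_eq true j (smooth_slice (si i) 1) (e i)) (wd_slice true j (si i 1)).
by rewrite -coord_triv //; exact: h.
Qed.

Lemma fibre_holomorphic_atlas t : polydisc R k t -> holomorphic_atlas (fibre_atlas T t).
Proof.
move=> ht; split.
- by move=> _ [W aW ->]; exact: fibre_chart_is_chart.
- move=> x; have [W aW Wx] := adapted_cover (F x t).
  by exists (fc W t) => //; exists W.
by move=> _ _ x [W aW ->] [W' aW' ->]; exact: fibre_chart_holo.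
Qed.

Lemma triv_germ c W t x i : fibre_atlas T 0 c -> adapted W -> polydisc R k t ->
  dom c x -> dom W (F x t) ->
  smooth (fun v => coord W (F (param c (lsubmx v)) (rsubmx v)) 0 i) (row_mx (coord c x) t).
Proof.
move=> Ac aW ht cx Wx.
have [chA _ _] := fibre_holomorphic_atlas (@polydisc0 R k); have hc := chA c Ac.
have [_ oi _ cp pK] := hc; have hW := adapted_chart aW.
have [hP _ cov] := atlas_holo P; have [d Ad dx] := cov (F x t).
have hd := hP d Ad; have [od _ _ _ _] := hd; have [_ _ _ _ pKd] := hd.
pose S := [set v : 'rV[C R]_(n + k) | [/\ chart_img c (lsubmx v), polydisc R k (rsubmx v) &
             dom d (F (param c (lsubmx v)) (rsubmx v))]].
pose f (v : 'rV[C R]_(n + k)) := F (param c (lsubmx v)) (rsubmx v).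
have nf v (Q : set P) : chart_img c (lsubmx v) -> polydisc R k (rsubmx v) ->
    (\forall p \near f v, Q p) -> \forall v' \near v, Q (f v').
  move=> Iv tv /(near_triv tv) [[S1 S2] [/= h1 h2] h].
  have h3 : \forall v' \near v, S1 (param c (lsubmx v')).
    by apply: (near_lsubmx (Q := fun u => S1 (param c u))); have := cp _ Iv; apply.
  by apply: filterS2 h3 (near_rsubmx h2) => v' k1 k2; apply: (h (_, _)); split.
have oS : open S.
  rewrite openE => v [Iv tv dv].
  have h1 : \forall v' \near v, chart_img c (lsubmx v').
    by apply: near_lsubmx; exact: open_nbhs_nbhs.
  have h2 : \forall v' \near v, polydisc R k (rsubmx v').
    by apply: near_rsubmx; exact: polydisc_near.
  have h3 : \forall v' \near v, dom d (f v') by apply: nf => //; exact: near_dom.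
  by apply: filterS3 h1 h2 h3 => v'.
set v0 := row_mx _ _.
have Iv0 : chart_img c (lsubmx v0) by rewrite row_mxKl; exists x.
have tv0 : polydisc R k (rsubmx v0) by rewrite row_mxKr.
have f0 : f v0 = F x t by rewrite /f row_mxKl row_mxKr pK.
have Sv0 : S v0 by split=> //; rewrite -/(f v0) f0.
have sd j : smooth (fun v => coord d (f v) 0 j) v0.
  by have /(smooth_onP _ oS) := triv_smooth j Ac Ad; apply.
have [sWd sdW] := adapted_atlas_transition aW Ad Wx dx.
have sW : smooth (fun u => coord W (param d u) 0 i) (coord d (f v0)) by rewrite f0; exact: sdW.
have := smooth_comp (g := fun v => coord d (f v)) sW sd.
apply: smooth_eq.
have : \forall v \near v0, dom d (f v) by apply: nf => //; rewrite f0; exact: near_dom.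
by apply: filterS => v dv; rewrite /= pKd.
Qed.

Lemma triv_inv_germ c W t x i : fibre_atlas T 0 c -> adapted W -> polydisc R k t ->
  dom c x -> dom W (F x t) ->
  smooth (fun v => coord c (G (param W v)) 0 i) (coord W (F x t)).
Proof.
move=> Ac aW ht cx Wx.
have [chA _ _] := fibre_holomorphic_atlas (@polydisc0 R k); have hc := chA c Ac.
have hW := adapted_chart aW; have [_ _ _ _ pKW] := hW.
have [hP _ cov] := atlas_holo P; have [d Ad dx] := cov (F x t).
have hd := hP d Ad; have [od oid _ cpd pKd] := hd.
pose S := [set v | chart_img d v /\ dom c (G (param d v))].
have oS : open S.
  rewrite openE => v [Iv cv].
  have h1 : \forall v' \near v, chart_img d v' by exact: open_nbhs_nbhs.
  have h2 : \forall p \near param d v, dom c (G p).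
    by apply: (near_triv_inv (Q := dom c)); exact: near_dom.
  have h3 : \forall v' \near v, dom c (G (param d v')) := cpd _ Iv _ h2.
  by apply: filterS2 h1 h3 => v'.
have S0 : S (coord d (F x t)).
  by split; [exists (F x t)|rewrite pKd // (trivK T)].
have sc : smooth (fun v => coord c (G (param d v)) 0 i) (coord d (param W (coord W (F x t)))).
  rewrite pKW //.
  by have /(smooth_onP _ oS) := triv_inv_smooth i Ac Ad; apply.
have [sWd _] := adapted_atlas_transition aW Ad Wx dx.
have := smooth_comp (g := fun v => coord d (param W v)) sc sWd.
apply: smooth_eq; apply: filterS (near_param hW Wx (near_dom hd dx)) => v dv.
by rewrite /= pKd.
Qed.

Lemma fibre_charts_compat z w t x : polydisc R k t -> fibre_atlas T 0 z -> fibre_atlas T t w ->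
  dom z x -> dom w x -> smt z w x /\ smt w z x.
Proof.
move=> ht Az [W aW ->] zx wx.
have [chA _ _] := fibre_holomorphic_atlas (@polydisc0 R k); have hz := chA z Az.
have hw := fibre_chart_is_chart aW ht.
split=> i.
  apply: smooth_eq (smooth_slice (triv_germ (lshift k i) Az aW ht zx wx)).
  by apply: filterE => u; rewrite row_mxKl row_mxKr /zc /= mxE.
have h := triv_inv_germ i Az aW ht zx wx; rewrite coord_triv // in h.
exact: smooth_slice h.
Qed.

Lemma frame_M_near0 (x0 : X) : exists W, [/\ adapted W, dom (fc W 0) x0 &
  \forall x \near x0 & t \near (0 : 'rV[C R]_k),
    [/\ dom (fc W 0) x, dom (fc W t) x & frame_M (fc W 0) (fc W t) x \in unitmx]].
Proof.
have [W aW Wx0] := adapted_cover (F x0 0); exists W.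
have p0 := @polydisc0 R k; set c := fc W 0.
have Ac : fibre_atlas T 0 c by exists W.
have hc : is_chart c by exact: fibre_chart_is_chart.
have [_ _ cc _ pK] := hc; have cx0 : dom c x0 by [].
split=> //.
pose Phi b (v : 'rV[C R]_(n + k)) :=
  coord W (F (param c (lsubmx v)) (rsubmx v)) 0 (lshift k b).
(* [D] reads dw/dz off the trivialization as a function of point and parameter together, so
   invertibility at (x0, 0) persists jointly in both. *)
pose D v : 'M[C R]_n := \matrix_(b, a) wd false (lshift k a) (Phi b) v.
have sPhi b x t : polydisc R k t -> dom c x -> dom W (F x t) ->
    smooth (Phi b) (row_mx (coord c x) t) by move=> ht cx Wx; exact: triv_germ.
have DE x t : polydisc R k t -> dom c x -> dom W (F x t) ->
    D (row_mx (coord c x) t) = frame_M c (fc W t) x.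
  move=> ht cx Wx; apply/matrixP => b a; rewrite !mxE.
  rewrite -(wd_slice false a (sPhi b x t ht cx Wx 1)); apply/esym/wd_eq.
    exact: smooth_slice (sPhi b x t ht cx Wx) 1.
  by apply: filterE => u; rewrite /Phi row_mxKl row_mxKr /zc /= mxE.
have D0 : D (row_mx (coord c x0) 0) \in unitmx.
  by rewrite DE // frame_M_refl // unitmx1.
have nD : \forall v \near row_mx (coord c x0) 0, D v \in unitmx.
  apply: near_unitmx => // b a.
  apply: germ_C_eq (germ_C_wd false (lshift k a) (sPhi b x0 0 p0 cx0 Wx0 1)).
  by apply: filterE => v; rewrite mxE.
have nW := near_triv p0 (near_dom (adapted_chart aW) Wx0 : \forall p \near F x0 0, dom W p).
have nD' : \forall x \near x0 & t \near (0 : 'rV[C R]_k), D (row_mx (coord c x) t) \in unitmx.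
  have /nbhsVP[e e0 he] := nD; have e2 : 0 < e / 2 by rewrite divr_gt0.
  have h1 : \forall x \near x0, absV (coord c x - coord c x0) < e / 2.
    by apply: (near_coord hc cx0 (Q := fun u => absV (u - coord c x0) < e / 2)); apply/nbhsVP; exists (e / 2).
  have h2 : \forall t \near (0 : 'rV[C R]_k), absV (t - 0) < e / 2 by apply/nbhsVP; exists (e / 2).
  exists ([set x | absV (coord c x - coord c x0) < e / 2], [set t | absV (t - 0) < e / 2]) => //.
  move=> [x t] [/= k1 k2]; apply: he.
  rewrite opp_row_mx add_row_mx absV_row_mx; move: k1 k2.
  by move: (absV _) (absV _) => r1 r2; lra.
have nc : \forall x \near x0 & t \near (0 : 'rV[C R]_k), dom c x /\ polydisc R k t.
  exists (dom c, polydisc R k); first by split => /=; [exact: (near_dom hc cx0)|exact: (polydisc_near p0)].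
  by move=> [x t] [].
apply: filterS3 nW nD' nc => -[x t] /= k1 k2 [k3 k4]; split=> //.
by rewrite -DE.
Qed.

Lemma frame_M_unit_near : \forall t \near (0 : 'rV[C R]_k), polydisc R k t /\
  forall z w x, fibre_atlas T 0 z -> fibre_atlas T t w -> dom z x -> dom w x ->
    frame_M z w x \in unitmx.
Proof.
have p0 := @polydisc0 R k.
have K0 : compact (@fibre R n k P 0).
  have -> : @fibre R n k P 0 = proj (a := P) @^-1` [set 0] by [].
  apply: proj_proper; last exact: compact_set1.
  by move=> _ ->.
(* Properness gives compactness of the fibre as a subset of [P], whereas charts live on the subtype
   [X]; [good] is phrased on [P] to bridge the two. *)
pose good (t : 'rV[C R]_k) (p : P) := forall x : X, set_val x = p ->
  exists W, [/\ adapted W, dom (fc W 0) x, dom (fc W t) x &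
    frame_M (fc W 0) (fc W t) x \in unitmx].
have /compact_near_coveringP/(_ _ (nbhs (0 : 'rV[C R]_k)) good _) := K0.
have hcov p : @fibre R n k P 0 p -> \forall p' \near p & t \near (0 : 'rV[C R]_k), good t p'.
  move=> fp; pose x0 : X := exist _ p (mem_set fp).
  have [W [aW Wx0 [[S1 S2] [/= h1 h2] h]]] := frame_M_near0 x0.
  (* Neighbourhoods in [X] are traces of open sets of [P], by the subspace topology. *)
  have [S [[V oV VS] Sx0 SS1]] : exists S, [/\ (exists2 V : set P, open V & set_val @^-1` V = S),
    S x0 & S `<=` S1] by exact: h1.
  exists (V, S2).
    split=> //=; apply: open_nbhs_nbhs; split=> //.
    by move: Sx0; rewrite -VS.
  move=> [p' t] [/= Vp' S2t] x xp'; exists W.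
  have S1x : S1 x by apply: SS1; rewrite -VS /= xp'.
  by have [k1 k2 k3] := h (x, t) (conj S1x S2t).
move=> /(_ hcov) hgood.
apply: filterS2 (polydisc_near p0) hgood => t ht hg; split=> // z w x Az Bw zx wx.
(* Invertibility is known for one pair of charts at [x]; the cocycle identities carry it to every
   pair, since transitions within one complex structure are invertible. *)
have fx : @fibre R n k P 0 (set_val x) by exact: set_mem (valP x).
have [W [aW cx dx Mu]] := hg _ fx x erefl.
have hA := fibre_holomorphic_atlas p0; have hB := fibre_holomorphic_atlas ht.
have AB z' w' y : fibre_atlas T 0 z' -> fibre_atlas T t w' -> dom z' y -> dom w' y ->
  smt z' w' y /\ smt w' z' y by exact: fibre_charts_compat.
have Ac : fibre_atlas T 0 (fc W 0) by exists W.
have Bd : fibre_atlas T t (fc W t) by exists W.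
have [_ ->] := mixed_cocycles_right hA hB AB Az Bd Bw zx dx wx.
have [_ ->] := mixed_cocycles_left hA hB AB Az Ac Bd zx cx dx.
have [M1 _] := atlas_frame_M_unit hA Az Ac zx cx.
have [M2 _] := atlas_frame_M_unit hB Bd Bw dx wx.
by rewrite !unitmx_mul M1 M2 Mu.
Qed.

End FibreCharts.

(** * The conjugation formula and closedness for small parameters *)

Lemma A0_0 {R : realType} {X : topologicalType} {n : nat} (A : set (chart R X n)) q E :
  holomorphic_atlas A -> A0 A q E 0.
Proof.
move=> [hA _ _]; split.
- apply/funext => c; apply/funext => x; apply/funext => J; apply/funext => a.
  by rewrite /on_atlas; case: ifP.
- move=> c J a Ac; have [_ oI _ _ _] := hA c Ac.
  by apply/smooth_onP => // u _; exact: smooth_cst.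
- by move=> c d x _ _ _ _; rewrite /transition act0.
- by move=> c x a; exact: alternating0.
by move=> c x J; exact: fibre_vector0.
Qed.

Lemma extension0 {R : realType} {X : topologicalType} {n : nat} (A B : set (chart R X n)) phi q E :
  extension A B phi q E 0 = 0.
Proof.
apply/funext => w; apply/funext => x; apply/funext => J; apply/funext => a.
by rewrite /extension /on_atlas act0; case: ifP.
Qed.

Theorem theorem2p9 (R : realType) (n k : nat) (P : analyticFamily R n k)
    (F : trivialization P) :
  \forall t \near (0 : 'rV[C R]_k), forall (E : tbundle) (q : nat),
    let A := fibre_atlas F 0 in
    let At := fibre_atlas F t in
    let phi := beltrami A At in
    let rho r := extension A At phi r E in
    let rho_inv r := 'pinv_(fun=> 0) (A0 A r E) (rho r) in
    [/\ set_bij (A0 A q E) (A0 At q E) (rho q),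
        forall s, A0 A q E s ->
          rho_inv q.+1 (dolbeault At (rho q s)) =
            dolbeault A s - pairing A phi s
      & forall s, A0 A q E s ->
          (dolbeault At (rho q s) = 0 <->
           dolbeault A s - pairing A phi s = 0)].
Proof.
(* Smallness of [t] only secures membership in the polydisc and invertibility of dw/dz, hence it is
   uniform in [E] and [q]. *)
apply: filterS (frame_M_unit_near F) => t [ht Mu] E q.
set A := fibre_atlas F 0; set At := fibre_atlas F t; set phi := beltrami A At.
pose rho r := extension A At phi r E.
have hA : holomorphic_atlas A by exact: fibre_holomorphic_atlas (@polydisc0 R k).
have hAt : holomorphic_atlas At by exact: fibre_holomorphic_atlas ht.
have AAt z w x : A z -> At w -> dom z x -> dom w x -> smt z w x /\ smt w z x.
  exact: fibre_charts_compat.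
have bij r : set_bij (A0 A r E) (A0 At r E) (rho r).
  exact: (extension_bij hA hAt AAt Mu).
have conj := extension_conjugates_dolbeault hA hAt AAt Mu.
split=> [//|s As|s As]; have [As' eq_rho] := conj q E s As; rewrite -/phi in As' eq_rho.
  have [_ inj _] := bij q.+1.
  (* The partial inverse is meaningful only for values of rho on [A0 A], whence the use of the
     membership [As']. *)
  by rewrite -eq_rho; exact: (@pinvKV _ _ (fun=> 0) _ _ inj _ (mem_set As')).
split=> [h0|h0]; last by rewrite -[LHS]eq_rho h0 extension0.
have [_ inj _] := bij q.+1.
apply: inj; rewrite ?inE ?mem_set //; first exact: A0_0.
by rewrite /rho eq_rho extension0.
Qed.
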